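(* Let $d\in\mathbb{N}$, $d\ge1$, $0<\alpha<d$, $\gamma>1$ with $\gamma\ge2-\frac{\alpha}{d}$, $T>0$ and $\kappa\in\mathbb{R}\setminus\{0\}$. Let $(\rho,u)$ and $(\bar\rho,\bar u)$ be two smooth solutions on $[0,T)\times\mathbb{T}^d$, periodic in space with unit period and with $\rho\ge0$, of the Euler-Riesz system $$\partial_t\rho+\nabla\cdot(\rho u)=0,\qquad \partial_t(\rho u)+\nabla\cdot(\rho u\otimes u)+\rho\nabla\frac{\delta\mathcal{E}}{\delta\rho}(\rho)=0 .$$ Suppose that there exist $\bar\delta>0$ and $\bar M<\infty$ such that $\bar\delta\le\bar\rho(t,x)\le\bar M$ for all $(t,x)\in[0,T)\times\mathbb{T}^d$, and that $\nabla\bar u\in L^\infty(0,T;L^\infty(\mathbb{T}^d))$. Let $C_*>0$ be a constant such that for all $t\in[0,T)$ $$\|(\rho-\bar\rho)\,K_\alpha*(\rho-\bar\rho)\|_{L^1(\mathbb{T}^d)}\le C_*\int_{\mathbb{T}^d}h(\rho|\bar\rho)\,\mathrm{d}x$$ (such a constant exists because $\gamma\ge2-\alpha/d$), and assume $0<|\kappa|<\frac{2}{C_*}$. Let $$\Psi(t)=\int_{\mathbb{T}^d}\tfrac12\rho|u-\bar u|^2+h(\rho|\bar\rho)+\tfrac{\kappa}{2}(\rho-\bar\rho)\big(K_\alpha*(\rho-\bar\rho)\big)\,\mathrm{d}x$$ be the relative energy between the two solutions. Then $\Psi(t)\ge0$ for all $t\in[0,T)$, and there exists a constant $C>0$, independent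 of $t$, such that $$\Psi(t)\le e^{CT}\,\Psi(0)\qquad\text{for all }t\in[0,T).$$
   Context: $\mathbb{T}^d$ denotes the cube $(-1/2,1/2)^d$ with periodic boundary conditions. The kernel is $K_\alpha(x)=\frac{1}{d-\alpha}|x|^{\alpha-d}$, and for a function $f$ periodic with unit period, $(K_\alpha*f)(x)=\int_{\mathbb{T}^d}K_\alpha(y)f(x-y)\,\mathrm{d}y$. The internal energy is $h(\rho)=\frac{1}{\gamma-1}\rho^\gamma$, and $h(\rho|\bar\rho)=h(\rho)-h(\bar\rho)-h'(\bar\rho)(\rho-\bar\rho)$. The potential energy functional is $\mathcal{E}(\rho)=\int_{\mathbb{T}^d}h(\rho)+\frac{\kappa}{2}\rho(K_\alpha*\rho)\,\mathrm{d}x$, with functional derivative $\frac{\delta\mathcal{E}}{\delta\rho}(\rho)=h'(\rho)+\kappa K_\alpha*\rho$, so that $\rho\nabla\frac{\delta\mathcal{E}}{\delta\rho}(\rho)=\nabla\rho^\gamma+\kappa\rho\nabla(K_\alpha*\rho)$. The latter term can be written as $\nabla\cdot\big(\rho^\gamma I_d+\kappa S_\alpha(\rho)\big)$ with $$S_\alpha(\rho)(t,x)=\frac12\int_0^1\int_{\mathbb{T}^d}\rho(t,x+(\theta-1)y)\,\rho(t,x+\theta y)\,|y|^{\alpha-d-2}\,y\otimes y\,\mathrm{d}y\,\mathrm{d}\theta .$$ The constant $\kappa$ (interaction strength) may be positive or negative. *)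

(* Defs.v *)
From HB Require Import structures.
From mathcomp Require Import all_boot all_order all_algebra.
From mathcomp Require Import all_classical all_reals all_analysis.

Set Implicit Arguments.
Unset Strict Implicit.
Unset Printing Implicit Defensive.

Import Order.TTheory GRing.Theory Num.Theory.
Import numFieldNormedType.Exports.

Local Open Scope classical_set_scope.
Local Open Scope ring_scope.

(* Lebesgue measure on n.-tuple R, built by iterating the binary product
   measure; the sigma-algebra of n.-tuple R is the product one. *)
Section lebesgue_tuple.
Variable R : realType.
Local Notation mR := (measurableTypeR R).
Local Notation leb := (@lebesgue_measure R).

Definition tcons n (x : mR * n.-tuple mR) : n.+1.-tuple mR :=
  [the n.+1.-tuple mR of x.1 :: x.2].

Lemma measurable_tcons n : measurable_fun [set: mR * n.-tuple mR] (@tcons n).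
Proof. by apply: measurable_cons. Qed.

Section step.
Variable (m1 : {sigma_finite_measure set mR -> \bar R}).
Variables (n : nat) (m : {sigma_finite_measure set (n.-tuple mR) -> \bar R}).

Definition lebesgue_tuple_step : set (n.+1.-tuple mR) -> \bar R :=
  pushforward (m1 \x m)%E (@tcons n).

Let step0 : lebesgue_tuple_step set0 = 0%E.
Proof. by rewrite /lebesgue_tuple_step /pushforward preimage_set0 measure0. Qed.

Let step_ge0 A : (0 <= lebesgue_tuple_step A)%E.
Proof. by rewrite /lebesgue_tuple_step /pushforward; exact: measure_ge0. Qed.

Let step_sigma_additive : semi_sigma_additive lebesgue_tuple_step.
Proof.
move=> F mF tF mUF; rewrite /lebesgue_tuple_step /pushforward preimage_bigcup.
have mpre A : measurable A -> measurable (@tcons n @^-1` A).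
  by move=> mA; rewrite -[X in measurable X]setTI; exact: measurable_tcons.
apply: measure_semi_sigma_additive.
- by move=> i; exact: mpre.
- apply/trivIsetP => i j _ _ ij; rewrite -preimage_setI.
  by move/trivIsetP : tF => /(_ i j Logic.I Logic.I ij) ->; rewrite preimage_set0.
- by rewrite -preimage_bigcup; exact: mpre.
Qed.

HB.instance Definition _ := isMeasure.Build _ _ _ lebesgue_tuple_step
  step0 step_ge0 step_sigma_additive.

Let step_sigma_finite : sigma_finite setT lebesgue_tuple_step.
Proof.
have [F FT Foo] : sigma_finite setT (m1 \x m)%E.
  have /sigma_finiteP[F [TF ndF Foo]] := sigma_finiteT m1.
  have /sigma_finiteP[G [TG ndG Goo]] := sigma_finiteT m.
  exists (fun k => F k `*` G k).
    rewrite -setXTT TF TG; apply/seteqP; split => -[x y] /=.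
      move=> [[i _ Fx] [j _ Gy]]; exists (maxn i j) => //; split.
        by move: x Fx; exact/subsetPset/ndF/leq_maxl.
      by move: y Gy; exact/subsetPset/ndG/leq_maxr.
    by move=> [i _ []/= ? ?]; split; exists i.
  move=> k; have [? ?] := Foo k; have [? ?] := Goo k.
  split; first exact: measurableX.
  by rewrite product_measure1E// lte_mul_pinfty// ge0_fin_numE.
pose uncons (t : n.+1.-tuple mR) : mR * n.-tuple mR :=
  (thead t, [tuple of behead t]).
have muncons : measurable_fun setT uncons.
  apply/measurable_fun_pairP; split.
    exact: (@measurable_tnth _ mR n.+1 ord0).
  exact: measurable_behead.
have tconsK x : uncons (tcons x) = x.
  case: x => x s; rewrite /uncons /tcons; congr pair.
  exact/val_inj.
exists (fun k => uncons @^-1` F k).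
  by rewrite -preimage_bigcup -FT preimage_setT.
move=> k; have [mF Fk] := Foo k; split.
  by rewrite -[X in measurable X]setTI; exact: muncons.
rewrite /lebesgue_tuple_step /pushforward -comp_preimage.
by rewrite (_ : uncons \o @tcons n = id) //; apply/funext => x /=.
Qed.

HB.instance Definition _ := Measure_isSigmaFinite.Build _ _ _
  lebesgue_tuple_step step_sigma_finite.

End step.

Fixpoint lebesgue_tuple n : {sigma_finite_measure set (n.-tuple mR) -> \bar R} :=
  match n with
  | 0%N => @dirac _ (0.-tuple mR) [tuple] R
  | n'.+1 => @lebesgue_tuple_step leb n' (lebesgue_tuple n')
  end.

Lemma lebesgue_tuple_box n (A : 'I_n -> set mR) :
  (forall i, measurable (A i)) ->
  lebesgue_tuple n [set t | forall i, A i (tnth t i)] =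
  (\prod_(i < n) leb (A i))%E.
Proof.
elim: n A => [|n IHn] A mA.
  rewrite big_ord0 /= diracE.
  by rewrite mem_set//= => -[].
rewrite big_ord_recl /= /lebesgue_tuple_step /pushforward.
rewrite (_ : _ @^-1` _ =
    A ord0 `*` [set t | forall i, A (lift ord0 i) (tnth t i)]); last first.
  apply/seteqP; split => -[x s] /=.
    move=> h; split; first by have := h ord0.
    by move=> i /=; have := h (lift ord0 i); rewrite /tcons tnthS.
  move=> [h0 h] i; case: (unliftP ord0 i) => [j ->|-> //].
  by rewrite /tcons tnthS; exact: h.
rewrite product_measure1E//; first by congr (_ * _)%E; exact: IHn.
rewrite (_ : [set t | _] =
   \bigcap_(i in [set: 'I_n]) (@tnth n mR ^~ i @^-1` A (lift ord0 i))).
  apply: fin_bigcap_measurable => // i _.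
  by rewrite -[X in measurable X]setTI; exact: measurable_tnth.
by apply/seteqP; split => [t h i _|t h i]; [exact: h|exact: (h i)].
Qed.

End lebesgue_tuple.

Section smooth.
Variables (R : realType) (V W : normedModType R).

Fixpoint Ck (k : nat) (U : set V) (f : V -> W) : Prop :=
  match k with
  | 0%N => forall x, U x -> {for x, continuous f}
  | k'.+1 => (forall x, U x -> differentiable f x) /\
             (forall v : V, Ck k' U (fun x => 'D_v f x))
  end.

(* Smoothness on a set that need not be open: f is the restriction of a
   C^oo function defined on an open neighbourhood of A. *)
Definition smooth_on (A : set V) (f : V -> W) : Prop :=
  exists (U : set V) (F : V -> W),
    [/\ open U, A `<=` U, (forall k, Ck k U F) & {in A, f =1 F}].

End smooth.

Section euler_riesz.
Variables (R : realType) (d : nat).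
Local Notation mR := (measurableTypeR R).
Local Notation space := 'rV[R]_d.
Implicit Types (f g : space -> R) (x : space) (t : R).

(* The norm `|x| on matrices is the sup norm; this is the Euclidean one. *)
Definition enorm x : R := Num.sqrt (\sum_i x ord0 i ^+ 2).

Definition partial (i : 'I_d) f x : R := 'D_(delta_mx ord0 i) f x.

Definition cube : set (d.-tuple mR) :=
  [set y | forall i, - 2^-1 < tnth y i < 2^-1].

(* Functions on the torus are functions on R^d with unit period, integrated
   over the cube. *)
Definition periodic (W : Type) (f : space -> W) : Prop :=
  forall i x, f (x + delta_mx ord0 i) = f x.

Definition torus_integral f : R :=
  \int[lebesgue_tuple R d]_(y in cube) f (\row_i tnth y i).

Definition torus_L1norm f : R := torus_integral (fun x => `|f x|).

(* The value of 0 `^ (alpha - d) is 0, which is immaterial: the kernel is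
   only ever integrated. *)
Definition riesz_kernel (alpha : R) x : R :=
  (d%:R - alpha)^-1 * enorm x `^ (alpha - d%:R).

Definition riesz_conv (alpha : R) f x : R :=
  torus_integral (fun y => riesz_kernel alpha y * f (x - y)).

Definition internal_energy (gamma r : R) : R := (gamma - 1)^-1 * r `^ gamma.

Definition internal_energy' (gamma r : R) : R :=
  gamma / (gamma - 1) * r `^ (gamma - 1).

Lemma is_derive_internal_energy (gamma r : R) : 0 < r ->
  is_derive r 1 (internal_energy gamma) (internal_energy' gamma r).
Proof.
move=> r0.
rewrite (_ : internal_energy' gamma r =
    (gamma - 1)^-1 *: (gamma * r `^ (gamma - 1))); last first.
  by rewrite /internal_energy' /GRing.scale /= mulrA (mulrC gamma).
by have drg := is_derive1_powR gamma r0; exact: is_deriveZ.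
Qed.

Definition relative_internal_energy (gamma r s : R) : R :=
  internal_energy gamma r - internal_energy gamma s
  - internal_energy' gamma s * (r - s).

Definition variational_derivative (alpha gamma kappa : R) f x : R :=
  internal_energy' gamma (f x) + kappa * riesz_conv alpha f x.

(* In the momentum equation rho * grad (dE/drho) is grad (rho^gamma) +
   kappa * rho * grad (K * rho).  Where rho = 0 both vanish, whatever value
   'D takes for the possibly non-differentiable h'(rho).
   The equations are required for 0 < t < T; at t = 0, with the one-sided
   time derivative, they follow by continuity. *)
Definition euler_riesz_solution (alpha gamma kappa T : R)
    (rho : R -> space -> R) (u : R -> space -> space) : Prop :=
  let slab := [set p : R^o * space | 0 <= p.1 < T] in
  [/\ smooth_on slab (fun p => rho p.1 p.2 : R^o) /\
      smooth_on slab (fun p => u p.1 p.2),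
      forall t, 0 <= t < T -> periodic (rho t) /\ periodic (u t),
      forall t x, 0 <= t < T -> 0 <= rho t x,
      forall t x, 0 < t < T ->
        derive1 (fun s => rho s x) t
        + \sum_i partial i (fun z => rho t z * u t z ord0 i) x = 0
    & forall t x i, 0 < t < T ->
        derive1 (fun s => rho s x * u s x ord0 i) t
        + \sum_j partial j (fun z => rho t z * u t z ord0 i * u t z ord0 j) x
        + rho t x
          * partial i (variational_derivative alpha gamma kappa (rho t)) x = 0].

(* grad u belongs to L^oo(0, T; L^oo) of the torus. *)
Definition gradient_Linfty (T : R) (u : R -> space -> space) : Prop :=
  exists B : R, {ae @lebesgue_measure R, forall t : mR, 0 < t < T ->
    {ae lebesgue_tuple R d, forall y, cube y ->
      forall i j, `|partial j (fun z => u t z ord0 i) (\row_k tnth y k)| <= B}}.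

Definition relative_energy (alpha gamma kappa : R)
    (rho rhob : R -> space -> R) (u ub : R -> space -> space) t : R :=
  torus_integral (fun x =>
    2^-1 * rho t x * enorm (u t x - ub t x) ^+ 2
    + relative_internal_energy gamma (rho t x) (rhob t x)
    + kappa / 2 * ((rho t x - rhob t x)
        * riesz_conv alpha (fun z => rho t z - rhob t z) x)).

End euler_riesz.

(* Main.v *)
From HB Require Import structures.
From mathcomp Require Import all_boot all_order all_algebra.
From mathcomp Require Import all_classical all_reals all_analysis.
From mathcomp Require Import measurable_realfun archimedean ring lra.
Require Import Defs.

Set Implicit Arguments.
Unset Strict Implicit.
Unset Printing Implicit Defensive.

Import Order.TTheory GRing.Theory Num.Theory.
Import numFieldNormedType.Exports.

Local Open Scope classical_set_scope.
Local Open Scope ring_scope.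

(** Let r = rho - rhob and w = u - ub, and let E be the integral of
    rho |w|^2 / 2 + h(rho | rhob), so that Psi = E + kappa/2 times the integral of r (K * r).
    The inequality that defines Cstar gives (1 - |kappa| Cstar / 2) E <= Psi
    (total_energy_ge). This is the positivity of Psi, and it reduces the theorem to a bound
    Psi' <= L E on (0, T), since Psi is continuous at 0 and gronwall applies.

    Psi is differentiated under the integral sign. At each point the equations make the
    derivative of the energy density a divergence, minus a stress term quadratic in w or
    linear in h(rho | rhob) with the gradient of ub as a factor, minus
    kappa rho w . grad (K * r) (edenstE, from the purely algebraic energy_algebra). The
    divergence integrates to zero over the torus. The derivative of the interaction energy is
    kappa times the integral of (rho u - rhob ub) . grad (K * r) (potential_is_derive), so
    that u disappears from the interaction terms: Psi' is minus the integral of the stress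
    plus kappa times the integral of r ub . grad (K * r) (total_energy_is_derive).

    The first integral is at most a multiple of E. In the second, the gradient of K * r
    cannot be controlled by E, but the symmetry of the kernel helps
    (riesz_stress_bound): with the gradient on K, which makes it odd, the exchange of the two
    points replaces ub(x) by half of ub(x) - ub(x - y), which is at most of order |y| and
    restores the singularity |y|^(alpha - d). This is the tensor S_alpha in disguise.
    As the gradient of K need not be integrable, the computation is done for the kernels
    (|y|^2 + s)^((alpha - d)/2), with bounds that are uniform in s.

    What remains is the double integral of |y|^(alpha - d) |r(x)| |r(x - y)|, which
    riesz_self_bound estimates by the integral of r^2 where r is moderate and of
    |r|^(2 - alpha/d) where it is large, times a constant that depends on the mass of |r|.
    Masses are conserved, and h(rho | rhob) dominates both powers because
    gamma >= 2 - alpha/d and rhob lies between two positive constants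
    (relative_internal_energy_coercive). *)

(** * Integration over the cube *)

Section sup_norm.
Variables (R : realType) (d : nat).
Implicit Types x : 'rV[R]_d.

Lemma coord_le_norm x i : `|x ord0 i| <= `|x|.
Proof.
rewrite [leRHS]/Num.norm /= mx_normrE.
exact: (le_bigmax _ (fun ij => `|x ij.1 ij.2|) (ord0, i)).
Qed.

Lemma norm_le_coord x b : 0 <= b -> (forall i, `|x ord0 i| <= b) -> `|x| <= b.
Proof.
move=> b0 h; rewrite [leLHS]/Num.norm /= mx_normrE; apply/bigmax_leP; split => //.
by move=> [j i] _ /=; rewrite ord1.
Qed.

Lemma norm_lt_coord x b : 0 < b -> (forall i, `|x ord0 i| < b) -> `|x| < b.
Proof.
move=> b0 h; rewrite [ltLHS]/Num.norm /= mx_normrE; apply/bigmax_ltP; split => //.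
by move=> [j i] _ /=; rewrite ord1.
Qed.

Lemma continuous_ball_bounded (f : 'rV[R]_d -> R) (N : R) : continuous f ->
  exists B, forall x, `|x| <= N -> `|f x| <= B.
Proof.
move=> cf; pose box : set 'rV[R]_d := [set v | forall i, v ord0 i \in `[- N, N]].
have cK : compact box.
  by apply: (@rV_compact R d (fun=> `[- N, N]%classic)) => i; exact: segment_compact.
have /compact_bounded [M [_ hM]] : compact (f @` box).
  by apply: continuous_compact => //; exact: continuous_subspaceT.
exists (M + 1) => x xN; apply: hM; first by rewrite ltrDl.
exists x => // i; rewrite in_itv/= -ler_norml; apply: le_trans xN; exact: coord_le_norm.
Qed.

End sup_norm.

Section measurability.
Variables (R : realType) (d : nat).
Local Notation mR := (measurableTypeR R).

(** Only the coordinates are known to be measurable. The function is the limit of its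
    values at grid points of mesh 1/(n+1), and each grid point is the rounding of the
    points of a measurable piece. *)
Lemma continuous_row_measurable dT (T : measurableType dT) (D : set T)
    (y : 'I_d -> T -> mR) (f : 'rV[R]_d -> R) :
  measurable D -> (forall i, measurable_fun D (y i)) -> continuous f ->
  measurable_fun D (fun t => f (\row_i y i t)).
Proof.
move=> mD my cf.
pose q (n : nat) (t : T) : 'rV[int]_d := \row_i Num.floor (n.+1%:R * y i t).
pose p (n : nat) (z : 'rV[int]_d) : 'rV[R]_d := \row_i ((z ord0 i)%:~R / n.+1%:R).
apply: (@measurable_fun_cvg _ _ _ D (fun n t => f (p n (q n t)))).
- move=> n _ Y mY.
  rewrite (_ : _ `&` _ = \bigcup_(z : 'rV[int]_d)
     (if f (p n z) \in Y then D `&` \bigcap_(i in [set: 'I_d])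
       (D `&` (fun t => n.+1%:R * y i t) @^-1` `[(z ord0 i)%:~R, (z ord0 i + 1)%:~R[) else set0)); last first.
    apply/seteqP; split=> [t [Dt /= Yt]|t [z _]].
      exists (q n t) => //; rewrite mem_set//; split=> // i _; split => //=.
      rewrite in_itv/= !mxE.
      by rewrite floor_le /= floorD1_gt.
    case: ifPn => // /set_mem Yz [Dt /= h]; split=> //=.
    suff -> : q n t = z by [].
    apply/rowP => i; rewrite mxE; have [_] := h i Logic.I.
    rewrite /= in_itv/= => /andP[h1 h2].
    by apply: floor_def; rewrite h1 h2.
  apply: countable_bigcupT_measurable; first exact: countableP.
  move=> z; case: ifP => _ //; apply: measurableI => //.
  apply: fin_bigcap_measurable => // i _.
  have : measurable_fun D ((fun=> n.+1%:R : mR) \* y i) by apply: (@measurable_funM _ _ R D (cst (n.+1%:R : R)) (y i)) => //; exact: my.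
  by apply => //; exact: measurable_itv.
- move=> t Dt.
  apply: (@cvg_comp _ _ _ (fun n => p n (q n t)) f); last exact: cf.
  apply/cvgrPdist_lt => e e0; near=> n.
  rewrite [X in X < _]/Num.norm /= mx_normrE.
  apply/bigmax_ltP; split=> // -[j i] _ /=; rewrite !mxE.
  set x := (y i t : R).
  have n0 : 0 < n.+1%:R :> R by [].
  have h1 := floor_le (n.+1%:R * x).
  have h2 := floorD1_gt (n.+1%:R * x).
  have -> : x - (Num.floor (n.+1%:R * x))%:~R / n.+1%:R =
     (n.+1%:R * x - (Num.floor (n.+1%:R * x))%:~R) / n.+1%:R.
    by rewrite mulrBl [n.+1%:R * x]mulrC mulfK.
  rewrite ger0_norm; last by rewrite divr_ge0// subr_ge0.
  rewrite ltr_pdivrMr//; apply: (@lt_le_trans _ _ 1).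
    by rewrite ltrBlDl; move: h2; rewrite intrD.
  rewrite mulrC -ler_pdivrMr// div1r; near: n.
  have [N _ hN] := near_infty_natSinv_lt (PosNum e0).
  exists N => // n Nn /=; rewrite -[leRHS]invrK lef_pV2 ?posrE ?invr_gt0//.
  by rewrite ltW//; exact: hN.
Unshelve. all: by end_near.
Qed.

End measurability.

Section tuple_measure.
Variable R : realType.
Local Notation cub d := (@cube R d).
Local Notation mR := (measurableTypeR R).
Local Notation leb := (@lebesgue_measure R).

Lemma measurable_cube d : measurable (cub d).
Proof.
rewrite (_ : cub d =
   \bigcap_(i in [set: 'I_d]) (@tnth d mR ^~ i @^-1` `]- 2^-1, 2^-1[)).
  apply: fin_bigcap_measurable => // i _.
  rewrite -[X in measurable X]setTI; exact: measurable_tnth.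
apply/seteqP; split => [t h i _|t h i] /=; first by rewrite in_itv/=; exact: h.
by have := h i Logic.I; rewrite /= in_itv.
Qed.

Arguments measurable_cube : clear implicits.

Lemma lebesgue_cube d : lebesgue_tuple R d (cub d) = 1%E.
Proof.
rewrite (_ : cub d = [set t | forall i, `]- 2^-1, 2^-1[%classic (tnth t i)]).
  rewrite (@lebesgue_tuple_box R d (fun=> `]- 2^-1, 2^-1[%classic)) => [|i].
    rewrite big1// => i _; rewrite lebesgue_measure_itv/= lte_fin gtrN ?invr_gt0//.
    by rewrite -EFinD opprK -[X in X + _]mul1r -[X in _ + X]mul1r -splitr.
  exact: measurable_itv.
by apply/seteqP; split => [t h i|t h i]; have := h i; rewrite /= in_itv.
Qed.

Lemma integral_tcons n (f : n.+1.-tuple mR -> \bar R) :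
  measurable_fun setT f ->
  (leb \x lebesgue_tuple R n)%E.-integrable setT (f \o @tcons R n) ->
  (\int[lebesgue_tuple R n.+1]_y f y =
   \int[(leb \x lebesgue_tuple R n)%E]_z f (tcons z))%E.
Proof.
move=> mf intf; have := @integral_pushforward _ _ _ _ _ _ (@measurable_tcons R n)
  (leb \x lebesgue_tuple R n)%E setT f mf.
by rewrite preimage_setT => /(_ intf measurableT).
Qed.

Definition upd n (y : n.-tuple mR) (i : 'I_n) (s : mR) : n.-tuple mR :=
  [tuple if j == i then s else tnth y j | j < n].

Lemma upd0 n (y : n.-tuple mR) s t : upd (tcons (s, y)) ord0 t = tcons (t, y).
Proof.
apply: eq_from_tnth => j; rewrite tnth_mktuple.
case: (unliftP ord0 j) => [k ->|->]; last by [].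
by rewrite -[_ == _]/false /= /tcons !tnthS.
Qed.

Lemma updS n (y : n.-tuple mR) s t i :
  upd (tcons (s, y)) (lift ord0 i) t = tcons (s, upd y i t).
Proof.
apply: eq_from_tnth => j; rewrite tnth_mktuple.
case: (unliftP ord0 j) => [k ->|->] //=.
by rewrite (inj_eq lift_inj) /tcons !tnthS tnth_mktuple.
Qed.

Lemma cube_tcons n s (y : n.-tuple mR) :
  cub n.+1 (tcons (s, y)) <-> (- 2^-1 < s < 2^-1) /\ cub n y.
Proof.
split=> [h|[h1 h2] i].
  split; first exact: (h ord0).
  by move=> i; have := h (lift ord0 i); rewrite /tcons tnthS.
by case: (unliftP ord0 i) => [k ->|->] //; rewrite /tcons tnthS; exact: h2.
Qed.

(** Fubini's theorem in the i-th coordinate, which the induction brings to the head of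
    the tuple. *)
Lemma integral_slice0 n (i : 'I_n) (g : n.-tuple mR -> R) (B : R) :
  measurable_fun setT g -> (forall y, `|g y| <= B) ->
  (forall y, ~ cub n y -> g y = 0) ->
  (forall y, \int[leb]_s (g (upd y i s))%:E = 0)%E ->
  (\int[lebesgue_tuple R n]_y (g y)%:E = 0)%E.
Proof.
elim: n i g => [[//]|n IHn] i g mg gB g0 hi.
have mgt : measurable_fun setT (fun z : mR * n.-tuple mR => g (tcons z)).
  by apply: measurableT_comp => //; exact: measurable_tcons.
have intg : (leb \x lebesgue_tuple R n)%E.-integrable setT
    ((EFin \o g) \o @tcons R n).
  have mc : measurable (cub n) by exact: measurable_cube.
  rewrite (_ : _ \o _ = EFin \o
      ((g \o @tcons R n) \_ (`]- 2^-1, 2^-1[ `*` cub n))); last first.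
    apply/funext => -[s y] /=; rewrite patchE; case: ifPn => // /negP yc.
    congr EFin; apply: g0 => /cube_tcons[h1 h2]; apply: yc; apply/mem_set.
    by split => //=; rewrite in_itv.
  have mI : measurable (`]- 2^-1, 2^-1[ `*` cub n : set (mR * n.-tuple mR)).
    by apply: measurableX => //; exact: measurable_itv.
  rewrite -restrict_EFin; apply/integrable_restrict => //; rewrite setTI.
  apply: (@measurable_bounded_integrable _ _ _ _ (g \o @tcons R n)) => //.
  - rewrite [ltLHS]product_measure1E//=.
    by rewrite lebesgue_cube mule1 lebesgue_measure_itv/=; case: ifP => _; rewrite ?ltry.
  - exact: measurable_funS mgt.
  - exists B; split=> [|M BM y _]; first exact: num_real.
    exact: le_trans (gB _) (ltW BM).
rewrite (integral_tcons (f := EFin \o g))//; last exact/measurable_EFinP.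
case: (unliftP ord0 i) hi => [j ->|->] hi.
  rewrite -(integral12_prod_meas1 intg); apply: integral0_eq => s _.
  apply: (IHn j) => [|y|y yc|y].
  - by apply: measurableT_comp mgt _; exact: measurable_pair1.
  - exact: gB.
  - by apply: g0 => /cube_tcons[].
  - by have := hi (tcons (s, y)); under eq_integral do rewrite updS.
rewrite -(integral21_prod_meas1 intg); apply: integral0_eq => y _.
by have := hi (tcons (0, y)); under eq_integral do rewrite upd0.
Qed.

Definition tneg n (y : n.-tuple mR) : n.-tuple mR := [tuple - tnth y i | i < n].

Lemma measurable_tneg n : measurable_fun setT (@tneg n).
Proof.
apply/measurable_fun_tnthP => i.
rewrite (_ : _ \o _ = (fun y => - tnth y i)); last first.
  by apply/funext => y /=; rewrite tnth_mktuple.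
by apply: measurableT_comp => //; exact: measurable_tnth.
Qed.

Lemma tneg_tcons n s (y : n.-tuple mR) : tneg (tcons (s, y)) = tcons (- s, tneg y).
Proof.
apply: eq_from_tnth => j; rewrite tnth_mktuple.
case: (unliftP ord0 j) => [k ->|->] //.
by rewrite /tcons !tnthS tnth_mktuple.
Qed.

Lemma lebesgue_tuple_neg n (A : set (n.-tuple mR)) : measurable A ->
  lebesgue_tuple R n (@tneg n @^-1` A) = lebesgue_tuple R n A.
Proof.
elim: n A => [|n IHn] A mA.
  congr (_ _); apply/seteqP; split=> y /=; rewrite (tuple0 y).
    by rewrite (tuple0 (tneg _)).
  by rewrite (tuple0 (tneg _)).
have mtA : measurable (@tcons R n @^-1` A).
  by rewrite -[X in measurable X]setTI; exact: measurable_tcons.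
rewrite /= /lebesgue_tuple_step /pushforward /product_measure1.
pose F s : \bar R := lebesgue_tuple R n (xsection (@tcons R n @^-1` A) s).
have mF : measurable_fun setT F by exact: measurable_fun_xsection.
transitivity (\int[leb]_s (F (- s)%R))%E.
  apply: eq_integral => s _ /=; rewrite /F -IHn; last exact: measurable_xsection.
  congr (_ _); apply/seteqP; split=> y /=; rewrite /xsection /= !inE /= tneg_tcons.
    by [].
  by [].
transitivity (\int[pushforward leb (-%R : mR -> mR)]_s F s)%E.
  rewrite ge0_integral_pushforward//.
by apply: eq_measure_integral => //= B mB _; exact: lebesgue_measureN.
Qed.

End tuple_measure.

(** * Weighted integrals on the torus *)

Section tint.
Variables (R : realType) (d : nat).
Local Notation mR := (measurableTypeR R).
Local Notation T := (d.-tuple mR).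
Local Notation mu := (lebesgue_tuple R d).
Local Notation cub := (@cube R d).
Local Notation space := 'rV[R]_d.
Implicit Types (k f g : space -> R).

Let mC : measurable cub := @measurable_cube R d.
Hint Resolve mC : core.

Definition rowt (y : T) : space := \row_i tnth y i.

(** Riesz kernels are integrable and unbounded, all other functions are bounded: the
    former enter integrals as weights against the latter. *)
Definition weight k := mu.-integrable cub (EFin \o (k \o rowt)).

Definition bmeas f := measurable_fun cub (f \o rowt) /\
  exists B : R, forall y, cub y -> `|f (rowt y)| <= B.

Definition tint k f := torus_integral (fun y => k y * f y).

Lemma torus_integralE f : torus_integral f = tint (cst 1) f.
Proof. by rewrite /tint; congr torus_integral; apply/funext => y; rewrite mul1r. Qed.

Lemma eq_tint k f g : (forall y, cub y -> f (rowt y) = g (rowt y)) -> tint k f = tint k g.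
Proof.
move=> fg; rewrite /tint /torus_integral; apply: eq_Rintegral => y /set_mem Cy.
by congr (_ * _); exact: fg.
Qed.

Lemma continuous_bmeas f : continuous f -> bmeas f.
Proof.
move=> cf; split.
  apply: continuous_row_measurable => //= i.
  by apply: measurable_funTS; exact: measurable_tnth.
have [B hB] := continuous_ball_bounded 1 cf; exists B => y Cy; apply: hB.
by apply: norm_le_coord => // i; rewrite mxE ler_norml; have := Cy i; lra.
Qed.

Lemma bmeas_cst (c : R) : bmeas (cst c).
Proof. by split; [exact: measurable_cst|exists `|c|]. Qed.

Lemma bmeasD f g : bmeas f -> bmeas g -> bmeas (fun y => f y + g y).
Proof.
move=> [mf [B fB]] [mg [B' gB]]; split; first exact: measurable_funD.
exists (B + B') => y Cy; apply: le_trans (ler_normD _ _) _.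
by apply: lerD; [exact: fB|exact: gB].
Qed.

Lemma bmeasM f g : bmeas f -> bmeas g -> bmeas (fun y => f y * g y).
Proof.
move=> [mf [B fB]] [mg [B' gB]]; split; first exact: measurable_funM.
exists (B * B') => y Cy; rewrite normrM.
by apply: ler_pM => //; [exact: fB|exact: gB].
Qed.

Lemma bmeasZ c f : bmeas f -> bmeas (fun y => c * f y).
Proof. by apply: bmeasM; exact: bmeas_cst. Qed.

Lemma bmeasN f : bmeas f -> bmeas (fun y => - f y).
Proof.
move=> [mf [B fB]]; split; last by exists B => y Cy; rewrite normrN; exact: fB.
exact: measurableT_comp.
Qed.

Lemma bmeasB f g : bmeas f -> bmeas g -> bmeas (fun y => f y - g y).
Proof. by move=> bf bg; apply: bmeasD => //; exact: bmeasN. Qed.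

Lemma bmeas_norm f : bmeas f -> bmeas (fun y => `|f y|).
Proof.
move=> [mf [B fB]]; split; last by exists B => y Cy; rewrite normr_id; exact: fB.
exact: measurableT_comp.
Qed.

Lemma bmeas_sum I (s : seq I) (f : I -> space -> R) : (forall i, bmeas (f i)) ->
  bmeas (fun y => \sum_(i <- s) f i y).
Proof.
move=> bf; elim: s => [|i s IHs].
  rewrite (_ : (fun y => _) = cst 0); first exact: bmeas_cst.
  by apply/funext => y; rewrite big_nil.
rewrite (_ : (fun y => _) = (fun y => f i y + \sum_(i <- s) f i y)).
  exact: bmeasD.
by apply/funext => y; rewrite big_cons.
Qed.

Lemma weight_bmeas f : bmeas f -> weight f.
Proof.
move=> [mf [B fB]]; apply: (@measurable_bounded_integrable _ _ _ _ (f \o rowt)) => //.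
- by rewrite [ltLHS](@lebesgue_cube R d) ltry.
- by exists B; split => [|M BM y Cy]; [exact: num_real|exact: le_trans (fB _ Cy) (ltW BM)].
Qed.

Lemma weight1 : weight (cst 1).
Proof. exact/weight_bmeas/bmeas_cst. Qed.

Lemma weight_measurable k : weight k -> measurable_fun cub (k \o rowt).
Proof. by move=> /integrableP[/measurable_EFinP]. Qed.

Lemma weight_norm k : weight k -> weight (fun y => `|k y|).
Proof. by move=> wk; exact: (integrable_norm wk). Qed.

Lemma weightM k f : weight k -> bmeas f -> weight (fun y => k y * f y).
Proof.
move=> wk [mf [B fB]].
apply: (@le_integrable _ _ _ mu _ mC _ (EFin \o (fun y => `|B| * k (rowt y)))).
- apply/measurable_EFinP; apply: measurable_funM => //.
  exact: weight_measurable.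
- move=> y Cy /=; rewrite lee_fin !normrM mulrC ler_wpM2r// normr_id.
  exact: le_trans (fB _ Cy) (ler_norm _).
- have := integrableZl mC `|B| wk.
  by [].
Qed.

Lemma weightD k k' : weight k -> weight k' -> weight (fun y => k y + k' y).
Proof.
move=> wk wk'; have := integrableD mC wk wk'.
by [].
Qed.

Lemma weightZ c k : weight k -> weight (fun y => c * k y).
Proof. by move=> wk; have := integrableZl mC c wk. Qed.

Lemma le_weight k k' : measurable_fun cub (k \o rowt) -> weight k' ->
  (forall y, cub y -> `|k (rowt y)| <= k' (rowt y)) -> weight k.
Proof.
move=> mk wk' kk'; apply: (le_integrable mC _ _ wk').
  exact/measurable_EFinP.
by move=> y Cy; rewrite lee_fin (le_trans (kk' _ Cy))// ler_norm.
Qed.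

Lemma tintD k f g : weight k -> bmeas f -> bmeas g ->
  tint k (fun y => f y + g y) = tint k f + tint k g.
Proof.
move=> wk bf bg; rewrite -RintegralD//; try exact: (weightM wk).
by apply: eq_Rintegral => y _; rewrite mulrDr.
Qed.

Lemma tintB k f g : weight k -> bmeas f -> bmeas g ->
  tint k (fun y => f y - g y) = tint k f - tint k g.
Proof.
move=> wk bf bg; rewrite -RintegralB//; try exact: (weightM wk).
by apply: eq_Rintegral => y _; rewrite mulrBr.
Qed.

Lemma tintZ k c f : weight k -> bmeas f ->
  tint k (fun y => c * f y) = c * tint k f.
Proof.
move=> wk bf; rewrite -RintegralZl//; try exact: (weightM wk).
by apply: eq_Rintegral => y _; rewrite mulrCA.
Qed.

Lemma tintN k f : weight k -> bmeas f -> tint k (fun y => - f y) = - tint k f.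
Proof.
move=> wk bf; rewrite -mulN1r -tintZ//.
by apply: eq_tint => y _; rewrite mulN1r.
Qed.

Lemma tint0 k : tint k (fun=> 0) = 0.
Proof.
rewrite /tint /torus_integral (@eq_Rintegral _ _ _ _ _ (cst 0)).
  by rewrite Rintegral_cst// mul0r.
by move=> y _; rewrite mulr0.
Qed.

Lemma tint_sum k I (s : seq I) (f : I -> space -> R) :
  weight k -> (forall i, bmeas (f i)) ->
  tint k (fun y => \sum_(i <- s) f i y) = \sum_(i <- s) tint k (f i).
Proof.
move=> wk bf; elim: s => [|i s IHs].
  rewrite big_nil; transitivity (tint k (fun=> 0)); last exact: tint0.
  by apply: eq_tint => y _; rewrite big_nil.
rewrite big_cons -IHs -tintD//; last exact: bmeas_sum.
by apply: eq_tint => y _; rewrite big_cons.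
Qed.

Lemma le_tint k f g : weight k -> (forall y, 0 <= k y) -> bmeas f -> bmeas g ->
  (forall y, cub y -> f (rowt y) <= g (rowt y)) -> tint k f <= tint k g.
Proof.
move=> wk k0 bf bg fg; apply: le_Rintegral => //; try exact: (weightM wk).
by move=> y Cy; rewrite ler_wpM2l//; exact: fg.
Qed.

Lemma tint_ge0 k f : (forall y, 0 <= k y) -> (forall y, cub y -> 0 <= f (rowt y)) ->
  0 <= tint k f.
Proof.
move=> k0 f0; apply: Rintegral_ge0 => y Cy.
by apply: mulr_ge0 => //; exact: f0.
Qed.

Lemma ler_norm_tint k f : weight k -> bmeas f ->
  `|tint k f| <= tint (fun y => `|k y|) (fun y => `|f y|).
Proof.
move=> wk bf; apply: le_trans (le_normr_Rintegral mC (weightM wk bf)) _.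
by rewrite le_eqVlt; apply/orP; left; apply/eqP; apply: eq_Rintegral => y _; rewrite normrM.
Qed.

Lemma tint_bound k f B : weight k -> bmeas f ->
  (forall y, cub y -> `|f (rowt y)| <= B) ->
  `|tint k f| <= B * tint (fun y => `|k y|) (cst 1).
Proof.
move=> wk bf fB; apply: le_trans (ler_norm_tint wk bf) _.
have wk' := weight_norm wk.
rewrite -tintZ//; last exact: bmeas_cst.
apply: le_tint => //; first exact: bmeas_norm.
  by apply: bmeasZ; exact: bmeas_cst.
by move=> y Cy /=; rewrite mulr1; exact: fB.
Qed.

(** The functions F for which Fubini's theorem applies to k1 x * k2 y * F x y whatever
    the weights k1 and k2. *)
Definition jmeas (F : space -> space -> R) :=
  measurable_fun setT (fun z : T * T => F (rowt z.1) (rowt z.2)) /\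
  exists B : R, forall x y, cub x -> cub y -> `|F (rowt x) (rowt y)| <= B.

Lemma jmeas_swap F : jmeas F -> jmeas (fun x y => F y x).
Proof.
move=> [mF [B FB]]; split; last by exists B => x y Cx Cy; exact: FB.
exact: (measurableT_comp mF (@measurable_swap _ _ T T)).
Qed.

Lemma jmeas_l F x : jmeas F -> cub x -> bmeas (F (rowt x)).
Proof.
move=> [mF [B FB]] Cx; split; last by exists B => y Cy; exact: FB.
apply: measurable_funTS.
exact: (measurableT_comp mF (@measurable_pair1 _ _ T T x)).
Qed.

Let patchC k : T -> R := (k \o rowt) \_ cub.

Let patchC_int k : weight k -> mu.-integrable setT (EFin \o patchC k).
Proof.
move=> wk; rewrite /patchC -restrict_EFin; apply/integrable_restrict => //.
by rewrite setTI.
Qed.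

Let fubini_slice k1 k2 F x : weight k2 -> jmeas F ->
  (\int[mu]_y (patchC k1 x * patchC k2 y * F (rowt x) (rowt y))%:E)%E =
  (patchC k1 x * tint k2 (F (rowt x)))%:E.
Proof.
move=> wk2 jF; have [Cx|Cx] := boolP (x \in cub); last first.
  rewrite integral0_eq => [|y _]; first by rewrite /patchC patchE (negbTE Cx) mul0r.
  by rewrite /patchC patchE (negbTE Cx) !mul0r.
have bF := jmeas_l jF (set_mem Cx).
rewrite EFinM /tint /torus_integral /Rintegral fineK; last first.
  by apply: integrable_fin_num => //; exact: (weightM wk2 bF).
rewrite -integralZl//; last exact: (weightM wk2 bF).
rewrite [RHS]integral_mkcond; apply: eq_integral => y _ /=.
rewrite patchE /patchC [in X in _ * X * _]patchE; case: ifP => _ /=.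
  by rewrite -EFinM mulrA.
by rewrite mulr0 mul0r.
Qed.

Section fubini.
Variables (k1 k2 : space -> R) (F : space -> space -> R).
Hypotheses (wk1 : weight k1) (wk2 : weight k2) (jF : jmeas F).

Let f (z : T * T) := patchC k1 z.1 * patchC k2 z.2 * F (rowt z.1) (rowt z.2).

Let mf : measurable_fun setT f.
Proof.
apply: measurable_funM; last by case: jF.
apply: measurable_funM.
  apply: (@measurableT_comp _ _ _ _ _ _ (patchC k1)) => //.
  by have /integrableP[/measurable_EFinP] := patchC_int wk1.
apply: (@measurableT_comp _ _ _ _ _ _ (patchC k2)) => //.
by have /integrableP[/measurable_EFinP] := patchC_int wk2.
Qed.

Let intf : (mu \x mu)%E.-integrable setT (EFin \o f).
Proof.
apply/integrable12ltyP; first exact/measurable_EFinP.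
have [_ [B FB]] := jF.
pose c := (\int[mu]_y `|patchC k2 y|%:E * `|B|%:E)%E.
have Pk1 := integrable_norm (patchC_int wk1).
have Pk2 := integrable_norm (patchC_int wk2).
have cfin : c \is a fin_num.
  by rewrite /c fin_numM//; exact: integrable_fin_num Pk2.
apply: (@le_lt_trans _ _ (\int[mu]_x (`|patchC k1 x|%:E * c))%E); last first.
  rewrite -(fineK cfin) integralZr//; apply: lte_mul_pinfty => //.
  - by apply: integral_ge0 => // x _; rewrite lee_fin.
  - exact: integrable_fin_num Pk1.
  - by rewrite ltry.
have mk1 : measurable_fun setT (fun x => `|patchC k1 x|%:E).
  exact: measurable_int Pk1.
have mk2 : measurable_fun setT (fun x => `|patchC k2 x|%:E).
  exact: measurable_int Pk2.
apply: ge0_le_integral => //.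
- by move=> x _; exact: integral_ge0.
- apply: (measurable_fun_fubini_tonelli_F (abse \o (EFin \o f))) => //=.
  by apply: measurableT_comp => //; exact/measurable_EFinP.
- by rewrite -(fineK cfin); exact: emeasurable_funM.
move=> x _.
have c0 : (0 <= c)%E by apply: mule_ge0 => //; exact: integral_ge0.
rewrite /c muleA -integralZl// -ge0_integralZr//.
- apply: ge0_le_integral => //.
  + move/measurable_EFinP : mf => mf'.
    apply: measurableT_comp => //.
    exact: (measurableT_comp mf' (@measurable_pair1 _ _ T T x)).
  + by do ?[exact: measurable_cst|exact: mk2|apply: emeasurable_funM].
  + move=> y _; rewrite /f /= lee_fin !normrM.
    have [Cx|Cx] := boolP (x \in cub); last first.
      by rewrite /patchC patchE (negbTE Cx) normr0 !mul0r.
    have [Cy|Cy] := boolP (y \in cub); last first.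
      by rewrite [patchC k2 _]patchE (negbTE Cy) normr0 !mulr0 !mul0r.
    apply: ler_wpM2l; first by rewrite mulr_ge0.
    apply: le_trans (FB _ _ _ _) (ler_norm _); exact/set_mem.
- by do ?[exact: measurable_cst|exact: mk2|apply: emeasurable_funM].
Qed.

Lemma fubini_measurable :
  measurable_fun setT (fun x => patchC k1 x * tint k2 (F (rowt x))).
Proof.
apply/measurable_EFinP; have := measurable_fubini_F intf.
rewrite (_ : fubini_F _ _ = EFin \o (fun x => patchC k1 x * tint k2 (F (rowt x))))//.
by apply/funext => x; exact: fubini_slice.
Qed.

Lemma tint_fubini :
  tint k1 (fun x => tint k2 (F x)) = tint k2 (fun y => tint k1 (fun x => F x y)).
Proof.
have patchE' k (G : space -> R) : tint k G = fine (\int[mu]_x (patchC k x * G (rowt x))%:E)%E.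
  rewrite /tint /torus_integral /Rintegral integral_mkcond; congr fine.
  apply: eq_integral => x _; rewrite patchE /patchC [in RHS]patchE.
  by case: ifP => //; rewrite mul0r.
rewrite !patchE'; congr fine; transitivity (\int[mu]_x \int[mu]_y (f (x, y))%:E)%E.
  by apply: eq_integral => x _; rewrite -fubini_slice.
rewrite (Fubini intf); apply: eq_integral => y _.
rewrite -(@fubini_slice k2 k1 (fun y x => F x y))//; last exact: jmeas_swap.
by apply: eq_integral => x _; rewrite /f /= [patchC k1 x * _]mulrC.
Qed.

End fubini.

Lemma fubini_bmeas k F : weight k -> jmeas F -> bmeas (fun x => tint k (F x)).
Proof.
move=> wk jF; have [_ [B FB]] := jF.
split; last first.
  exists (B * tint (fun y => `|k y|) (cst 1)) => x Cx; apply: tint_bound => //.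
    exact: jmeas_l.
  by move=> y Cy; exact: FB.
have := fubini_measurable weight1 wk jF.
move=> /(measurable_funS measurableT (@subsetT _ cub)).
apply: eq_measurable_fun => x Cx.
by rewrite /patchC patchE Cx mul1r.
Qed.

Lemma jmeas1 f : continuous f -> jmeas (fun x _ => f x).
Proof.
move=> cf; have [_ [B fB]] := continuous_bmeas cf.
split; last by exists B => x y Cx _; exact: fB.
apply: continuous_row_measurable => // i.
exact: (measurableT_comp (@measurable_tnth _ _ d i) measurable_fst).
Qed.

Lemma jmeasB f : continuous f -> jmeas (fun x y => f (x - y)).
Proof.
move=> cf; split.
  rewrite (_ : (fun z => _) =
      (fun z : T * T => f (\row_i (tnth z.1 i - tnth z.2 i : mR)))); last first.
    by apply/funext => z; congr f; apply/rowP => i; rewrite !mxE.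
  apply: continuous_row_measurable => // i; apply: measurable_funB.
    exact: (measurableT_comp (@measurable_tnth _ _ d i) measurable_fst).
  exact: (measurableT_comp (@measurable_tnth _ _ d i) measurable_snd).
have [B hB] := continuous_ball_bounded 1 cf; exists B => x y Cx Cy; apply: hB.
by apply: norm_le_coord => // i; rewrite !mxE ler_norml; have := Cx i; have := Cy i; lra.
Qed.

Lemma jmeasM F G : jmeas F -> jmeas G -> jmeas (fun x y => F x y * G x y).
Proof.
move=> [mF [B FB]] [mG [B' GB]]; split; first exact: measurable_funM.
exists (B * B') => x y Cx Cy; rewrite normrM.
by apply: ler_pM => //; [exact: FB|exact: GB].
Qed.

Lemma jmeas_min F G : jmeas F -> jmeas G -> jmeas (fun x y => Num.min (F x y) (G x y)).
Proof.
move=> [mF [B FB]] [mG [B' GB]]; split; first exact: measurable_minr.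
exists (`|B| + `|B'|) => x y Cx Cy; rewrite /Num.min; case: ifP => _.
  by apply: le_trans (FB _ _ Cx Cy) _; rewrite (le_trans (ler_norm _))// lerDl.
by apply: le_trans (GB _ _ Cx Cy) _; rewrite (le_trans (ler_norm _))// lerDr.
Qed.

Lemma rowt_tneg y : rowt (tneg y) = - rowt y.
Proof. by apply/rowP => i; rewrite !mxE tnth_mktuple. Qed.

Let tnegK (y : T) : tneg (tneg y) = y.
Proof. by apply: eq_from_tnth => i; rewrite !tnth_mktuple opprK. Qed.

Let cub_tneg (y : T) : cub (tneg y) -> cub y.
Proof.
by move=> Cy i; have := Cy i; rewrite tnth_mktuple; lra.
Qed.

Lemma bmeas_neg f : bmeas f -> bmeas (fun y => f (- y)).
Proof.
move=> [mf [B fB]].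
have cubN (y : T) : cub y -> cub (tneg y).
  by move=> Cy; apply: cub_tneg; rewrite tnegK.
split; last by exists B => y /cubN/fB; rewrite rowt_tneg.
rewrite (_ : _ \o _ = (f \o rowt) \o @tneg R d); last first.
  by apply/funext => y /=; rewrite rowt_tneg.
apply: (measurable_comp mC _ mf); last by apply: measurable_funTS; exact: measurable_tneg.
by move=> _ [y Cy <-]; exact: cubN.
Qed.

Lemma tint_neg k f : weight k -> bmeas f ->
  tint (fun y => k (- y)) (fun y => f (- y)) = tint k f.
Proof.
move=> wk bf; pose g := patchC (fun y => k y * f y).
have tE k' f' : tint k' f' = fine (\int[mu]_y (patchC (fun y => k' y * f' y) y)%:E)%E.
  rewrite /tint /torus_integral /Rintegral integral_mkcond; congr fine.
  by apply: eq_integral => y _; rewrite /patchC !patchE; case: ifP.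
have wkf := weightM wk bf; have ig := patchC_int wkf.
have mg : measurable_fun setT (EFin \o g) by exact: measurable_int ig.
have gE y : patchC (fun y => k (- y) * f (- y)) y = g (tneg y).
  rewrite /g /patchC !patchE /= rowt_tneg.
  case: ifPn => [Cy|/negP Cy].
    rewrite ifT//; apply/mem_set; apply: cub_tneg; rewrite tnegK; exact/set_mem.
  by rewrite ifF//; apply/negP => /set_mem/cub_tneg Cy'; apply: Cy; exact/mem_set.
rewrite !tE; congr fine.
under eq_integral do rewrite gE.
have mn := @measurable_tneg R d.
transitivity (\int[pushforward mu (@tneg R d)]_y (g y)%:E)%E.
  rewrite (integral_pushforward mn mg) ?preimage_setT//.
  apply/integrableP; split; first exact: measurableT_comp.
  have mag : measurable_fun setT (abse \o (EFin \o g)) by exact: measurableT_comp.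
  have := @ge0_integral_pushforward _ _ _ _ _ _ mn mu setT _ measurableT mag
    (fun y _ => abse_ge0 _).
  rewrite preimage_setT => <-.
  have /integrableP[_] := ig; congr (_ < _)%E.
  by apply: eq_measure_integral => //= A mA _; rewrite -[LHS]lebesgue_tuple_neg.
by apply: eq_measure_integral => //= A mA _; exact: lebesgue_tuple_neg.
Qed.

End tint.

(** * Divergence theorem and translation invariance on the torus *)

Section oned.
Variable R : realType.
Local Notation leb := (@lebesgue_measure R).

Lemma continuous_itv_integrable (f : R -> R) (i : interval R) a b : continuous f ->
  [set` i] `<=` `[a, b] -> leb.-integrable [set` i] (EFin \o f).
Proof.
move=> cf iab; apply: (@integrableS _ _ _ leb `[a, b]) => //.
apply: continuous_compact_integrable; first exact: segment_compact.
exact: continuous_subspaceT.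
Qed.

Lemma continuous_antiderivative (f : R -> R) (a : R) : continuous f ->
  exists F : R -> R, forall x, a < x -> is_derive x 1 F (f x).
Proof.
move=> cf; exists (fun x => \int[leb]_(t in `[a, x]) f t) => x ax.
have [||df dfE] := @continuous_FTC1_closed R f a x (x + 1) _ _ ax (cf x).
- by rewrite ltrDl.
- exact: (@continuous_itv_integrable _ _ a (x + 1)).
by rewrite -dfE derive1E; exact: derivableP.
Qed.

Lemma integral_is_derive (f F : R -> R) (a b : R) : a < b -> continuous f ->
  (forall x, a <= x <= b -> is_derive x 1 F (f x)) ->
  \int[leb]_(t in `]a, b[) f t = F b - F a.
Proof.
move=> ab cf dF.
have cF x : a <= x <= b -> {for x, continuous F}.
  move=> /dF dFx; apply: differentiable_continuous.
  by apply/derivable1_diffP; exact: ex_derive.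
have := @continuous_FTC2 R f F a b ab (continuous_subspaceT cf).
rewrite Rintegral_itv_obnd_cbnd; last first.
  by apply: (@continuous_itv_integrable _ _ a b) => //; exact: subset_itv_oo_cc.
rewrite Rintegral_itv_bndo_bndc; last first.
  by apply: (@continuous_itv_integrable _ _ a b) => //; exact: subset_itv_co_cc.
move=> h; rewrite /Rintegral h//.
  split.
  - move=> x xab; have [] := dF x _ => //.
    by move: xab; rewrite in_itv/= => /andP[/ltW-> /ltW->].
  - by apply/cvg_at_right_filter/cF; rewrite lexx ltW.
  - by apply/cvg_at_left_filter/cF; rewrite lexx ltW.
move=> x xab; rewrite derive1E; apply: derive_val; apply: dF.
by move: xab; rewrite in_itv/= => /andP[/ltW-> /ltW->].
Qed.

(** An antiderivative grows by the same amount over any two periods. *)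
Lemma periodic_shift_integral (f : R -> R) (c : R) : continuous f ->
  (forall s, f (s + 1) = f s) ->
  \int[leb]_(s in `]- 2^-1, 2^-1[) f (s + c) = \int[leb]_(s in `]- 2^-1, 2^-1[) f s.
Proof.
move=> cf pf; have [F dF] := continuous_antiderivative (- (`|c| + 2)) cf.
have nc := ler_norm c; have nc' := ler_norm (- c); rewrite normrN in nc'.
have ab : - 2^-1 < 2^-1 :> R by lra.
have cfc : continuous (fun s => f (s + c)).
  by move=> s; apply: continuous_comp; [apply: cvgD => //; exact: cvg_cst|exact: cf].
have shD (x a : R) : - (`|c| + 2) < x + a -> is_derive x 1 (fun s => F (s + a)) (f (x + a)).
  move=> h; have h1 := dF _ h.
  have h2 : is_derive x (1 : R) (fun s : R => s + a) 1.
    by apply: is_derive_eq; rewrite addr0.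
  have := @is_derive1_comp R F (fun s => s + a) x _ _ h1 h2.
  by rewrite mulr1.
have -> := @integral_is_derive (fun s => f (s + c)) (fun s => F (s + c)) _ _ ab cfc
  (fun x xab => shD x c ltac:(lra)).
have -> := @integral_is_derive f F _ _ ab cf (fun x xab => dF x ltac:(lra)).
pose H s := F (s + 1) - F s.
have dH x : - (`|c| + 2) < x -> is_derive x 1 H 0.
  move=> xc; have h1 : is_derive x (1 : R) (fun s => F (s + 1)) (f (x + 1)) by apply: shD; lra.
  have h2 := dF _ xc.
  by apply: is_derive_eq; rewrite pf subrr.
suff HH : forall p q, - (`|c| + 2) < p -> p <= q -> H p = H q.
  have [c0|c0] := leP 0 c.
    have := HH (- 2^-1) (- 2^-1 + c); rewrite /H.
    rewrite (_ : - 2^-1 + c + 1 = 2^-1 + c); last by lra.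
    rewrite (_ : - 2^-1 + 1 = 2^-1 :> R); last by lra.
    by move=> ->//; lra.
  have := HH (- 2^-1 + c) (- 2^-1); rewrite /H.
  rewrite (_ : - 2^-1 + c + 1 = 2^-1 + c); last by lra.
  rewrite (_ : - 2^-1 + 1 = 2^-1 :> R); last by lra.
  by move=> ->//; lra.
move=> p q hp pq.
have [||x _] := @MVT_segment R H (cst 0) p q pq.
- by move=> x /[!in_itv]/= /andP[h1 h2]; apply: dH; lra.
- apply: derivable_within_continuous => x /[!in_itv]/= /andP[h1 h2].
  by have [] := dH x _ => //; lra.
by rewrite mul0r => /eqP; rewrite subr_eq0 => /eqP.
Qed.

End oned.

Section continuous_ops.
Variables (R : realType) (T : topologicalType).
Implicit Types f g : T -> R.

Lemma continuousD_fun f g : continuous f -> continuous g -> continuous (fun x => f x + g x).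
Proof. by move=> cf cg x; apply: cvgD; [exact: cf|exact: cg]. Qed.

Lemma continuousB_fun f g : continuous f -> continuous g -> continuous (fun x => f x - g x).
Proof. by move=> cf cg x; apply: cvgB; [exact: cf|exact: cg]. Qed.

Lemma continuousN_fun f : continuous f -> continuous (fun x => - f x).
Proof. by move=> cf x; apply: cvgN; exact: cf. Qed.

Lemma continuousM_fun f g : continuous f -> continuous g -> continuous (fun x => f x * g x).
Proof. by move=> cf cg x; apply: cvgM; [exact: cf|exact: cg]. Qed.

Lemma continuous_norm_fun f : continuous f -> continuous (fun x => `|f x|).
Proof. by move=> cf x; apply: cvg_norm; exact: cf. Qed.

Lemma continuous_min_fun f g : continuous f -> continuous g ->
  continuous (fun x => Num.min (f x) (g x)).
Proof.
move=> cf cg; rewrite (_ : (fun x => _) = (fun x => 2^-1 * (f x + g x - `|f x - g x|))).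
  move=> x; apply: cvgM; first exact: cvg_cst.
  apply: (continuousB_fun (continuousD_fun cf cg)).
  exact/continuous_norm_fun/continuousB_fun.
apply/funext => x; have [h|h] := lerP (f x) (g x).
  by lra.
by lra.
Qed.

Lemma continuous_sum_fun I (s : seq I) (f : I -> T -> R) :
  (forall i, continuous (f i)) -> continuous (fun x => \sum_(i <- s) f i x).
Proof.
move=> cf; elim: s => [|i s IHs].
  rewrite (_ : (fun x => _) = cst 0); first exact: cst_continuous.
  by apply/funext => x; rewrite big_nil.
rewrite (_ : (fun x => _) = (fun x => f i x + \sum_(i <- s) f i x)).
  exact: continuousD_fun.
by apply/funext => x; rewrite big_cons.
Qed.

End continuous_ops.

Section slices.
Variables (R : realType) (d : nat).
Local Notation mR := (measurableTypeR R).
Local Notation T := (d.-tuple mR).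
Local Notation mu := (lebesgue_tuple R d).
Local Notation leb := (@lebesgue_measure R).
Local Notation cub := (@cube R d).
Local Notation space := 'rV[R]_d.
Implicit Types (f g : space -> R) (x : space).
Local Notation e := (delta_mx ord0).

Lemma continuous_line f x (v : space) : continuous f -> continuous (fun s : R => f (x + s *: v)).
Proof.
move=> cf s; apply: continuous_comp; last exact: cf.
by apply: cvgD; [exact: cvg_cst|apply: cvgZl].
Qed.

Lemma rowt_upd (y : T) i s : rowt (upd y i s) = rowt (upd y i 0) + s *: e i.
Proof.
apply/rowP => j; rewrite !mxE !tnth_mktuple eqxx/=.
by case: eqP => _; rewrite ?mulr1 ?mulr0 ?add0r ?addr0.
Qed.

Lemma torus_integral_slice0 (i : 'I_d) f : continuous f ->
  (forall x, x ord0 i = 0 -> \int[leb]_(s in `]- 2^-1, 2^-1[) f (x + s *: e i) = 0) ->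
  torus_integral f = 0.
Proof.
move=> cf h; have [mf [B fB]] := continuous_bmeas cf.
have mC := @measurable_cube R d.
rewrite /torus_integral /Rintegral integral_mkcond.
pose g := (f \o @rowt R d) \_ cub.
transitivity (fine (\int[mu]_y (g y)%:E)).
  by congr fine; apply: eq_integral => y _; rewrite /g !patchE; case: ifP.
rewrite (@integral_slice0 R d i g `|B|)//.
- by apply/(measurable_restrictT _ mC).
- move=> y; rewrite /g patchE; case: ifPn => [/set_mem Cy|_]; last by rewrite normr0.
  by apply: le_trans (fB _ Cy) _; exact: ler_norm.
- by move=> y Cy; rewrite /g patchE; case: ifPn => // /set_mem.
move=> y; pose x := rowt (upd y i 0).
have [Cy|Cy] := pselect (forall j, j != i -> - 2^-1 < tnth y j < 2^-1); last first.
  rewrite integral0_eq// => s _; congr EFin; rewrite /g patchE; case: ifPn => // /set_mem Cs.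
  exfalso; apply: Cy => j ji; have := Cs j; rewrite tnth_mktuple.
  by rewrite (negbTE ji).
have := h x; rewrite {1}/x mxE tnth_mktuple eqxx => /(_ erefl) h0.
transitivity (\int[leb]_(s in `](- 2^-1)%R, (2^-1)%R[) (f (x + s *: e i))%:E)%E.
  rewrite [RHS]integral_mkcond; apply: eq_integral => s _.
  rewrite /g !patchE /= rowt_upd -/x.
  have -> : (upd y i s \in cub) = (s \in (`]- 2^-1, 2^-1[%classic : set R)).
    apply/idP/idP => /set_mem.
      move=> Cs; apply/mem_set; rewrite /= in_itv/=.
      by have := Cs i; rewrite tnth_mktuple eqxx.
    rewrite /= in_itv/= => sI; apply/mem_set => j; rewrite tnth_mktuple.
    by case: eqP => // /eqP; exact: Cy.
  by case: ifP.
rewrite -[LHS]fineK; first by rewrite [fine _]h0.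
apply: integrable_fin_num; first exact: measurable_itv.
apply: (@continuous_itv_integrable _ _ _ (- 2^-1) 2^-1).
  exact: continuous_line.
exact: subset_itv_oo_cc.
Qed.

Lemma is_derive_line f x (v : space) s : derivable f (x + s *: v) v ->
  is_derive s 1 (fun t : R => f (x + t *: v)) ('D_v f (x + s *: v)).
Proof.
move=> df.
have E : (fun h : R => h^-1 *: (f (h *: v + (x + s *: v)) - f (x + s *: v))) =
    (fun h : R => h^-1 *: ((fun t : R => f (x + t *: v)) (h *: (1 : R) + s)
       - (fun t : R => f (x + t *: v)) s)).
  apply/funext => h /=; congr (_ *: (f _ - _)).
  by rewrite [h *: 1]mulr1 scalerDl addrCA.
split; first by rewrite /derivable -E.
by rewrite /derive -E.
Qed.

(** On each line in direction i the integral is the difference of the values on the two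
    faces. Equal values are all that is asked for, since the kernels, which are functions
    on the cube, are not periodic. *)
Lemma torus_integral_partial (i : 'I_d) f :
  (forall x, derivable f x (e i)) -> continuous (partial i f) ->
  (forall x, x ord0 i = 0 -> f (x + 2^-1 *: e i) = f (x - 2^-1 *: e i)) ->
  torus_integral (partial i f) = 0.
Proof.
move=> df cdf face; apply: (@torus_integral_slice0 i) => // x xi.
have -> := @integral_is_derive R (fun s => partial i f (x + s *: e i))
  (fun s => f (x + s *: e i)) (- 2^-1) 2^-1 ltac:(lra) (@continuous_line _ x (e i) cdf)
  (fun s _ => is_derive_line (df _)).
by rewrite face// scaleNr subrr.
Qed.

Lemma continuous_shift f (y : space) : continuous f -> continuous (fun x => f (x + y)).
Proof.
have cy : continuous (fun x : space => x + y).
  by move=> x; exact: (@cvgD _ _ _ _ _ (fun x : space => x) (fun=> y) x y (@cvg_id _ (nbhs x)) (cvg_cst _)).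
by move=> cf x; apply: (@continuous_comp _ _ _ (fun x : space => x + y) f); [exact: cy|exact: cf].
Qed.

Lemma torus_integral_shift1 (i : 'I_d) c f : continuous f -> periodic f ->
  torus_integral (fun x => f (x + c *: e i)) = torus_integral f.
Proof.
move=> cf pf; have cfc : continuous (fun x => f (x + c *: e i)).
  exact: continuous_shift.
have := @torus_integral_slice0 i (fun x => f (x + c *: e i) - f x).
rewrite !torus_integralE tintB; [|exact: weight1|exact: continuous_bmeas..].
move=> h; apply/eqP; rewrite -subr_eq0; apply/eqP; apply: h.
  exact: continuousB_fun.
move=> x _; rewrite RintegralB; last 3 first.
- exact: measurable_itv.
- apply: (@continuous_itv_integrable _ _ _ (- 2^-1) 2^-1); last exact: subset_itv_oo_cc.
  exact: (@continuous_line _ x (e i) cfc).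
- apply: (@continuous_itv_integrable _ _ _ (- 2^-1) 2^-1); last exact: subset_itv_oo_cc.
  exact: continuous_line.
have := @periodic_shift_integral R (fun s => f (x + s *: e i)) c (@continuous_line _ x (e i) cf).
under eq_Rintegral do rewrite scalerDl addrA.
move=> ->; first by rewrite subrr.
by move=> s; rewrite scalerDl scale1r addrA pf.
Qed.

Lemma periodic_sub (W : Type) (f : space -> W) y : periodic f -> periodic (fun x => f (x + y)).
Proof. by move=> pf i x; rewrite addrAC pf. Qed.

Lemma torus_integral_shift f y : continuous f -> periodic f ->
  torus_integral (fun x => f (x + y)) = torus_integral f.
Proof.
move=> cf pf; rewrite [y]row_sum_delta.
elim: (index_enum _) => [|i s IHs].
  by congr torus_integral; apply/funext => x; rewrite big_nil addr0.
rewrite -IHs.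
have := @torus_integral_shift1 i (y ord0 i) (fun x => f (x + \sum_(j <- s) y 0 j *: e j)).
move=> <-; [|exact: continuous_shift|exact: periodic_sub].
by congr torus_integral; apply/funext => x; rewrite big_cons addrA.
Qed.

End slices.

(** * Powers, norms and the Riesz kernel *)

Section powers.
Variable R : realType.
Implicit Types p s x y : R.

Lemma le_powR p x y : 0 <= p -> 0 <= x -> x <= y -> x `^ p <= y `^ p.
Proof. by move=> p0 x0 xy; apply: ge0_ler_powR => //; rewrite nnegrE// (le_trans x0). Qed.

Lemma le_powR_neg p x y : p <= 0 -> 0 < x -> x <= y -> y `^ p <= x `^ p.
Proof.
move=> p0 x0 xy; have y0 := lt_le_trans x0 xy.
rewrite -[p]opprK !(powRN _ (- p)) lef_pV2 ?posrE ?powR_gt0//.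
by apply: le_powR => //; rewrite ?oppr_ge0// ltW.
Qed.

(** Extending s^p by 0 to negative s gives a C^1 function on the line for p > 1, so
    that the pressure remains differentiable where the density vanishes. *)
Definition pospow p s := (Num.max s 0) `^ p.

Lemma pospowE p s : 0 <= s -> pospow p s = s `^ p.
Proof. by move=> s0; rewrite /pospow max_l. Qed.

Lemma pospow0 p s : p != 0 -> s <= 0 -> pospow p s = 0.
Proof. by move=> p0 s0; rewrite /pospow max_r// powR0. Qed.

Lemma continuous_pospow p : 0 < p -> continuous (pospow p).
Proof.
move=> p0 s; have [s0|s0|s0] := ltgtP s 0.
- rewrite /continuous_at [pospow p s]pospow0 ?gt_eqF ?ltW//.
  apply: (@cvg_trans _ (cst 0 @ nbhs s)).
    apply: near_eq_cvg; near=> t; rewrite /= pospow0 ?gt_eqF// ltW//.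
    by near: t; exact: lt_nbhsl.
  exact: cvg_cst.
- rewrite /continuous_at [pospow p s]pospowE ?ltW//.
  apply: (@cvg_trans _ ((fun t => t `^ p) @ nbhs s)).
    apply: near_eq_cvg; near=> t; rewrite pospowE// ltW//.
    by near: t; exact: lt_nbhsr.
  have : {for s, continuous (fun t : R => t `^ p)}; last by [].
  apply: differentiable_continuous; apply/derivable1_diffP.
  by have [] := is_derive1_powR p s0.
- rewrite /continuous_at s0 [pospow p 0]pospow0 ?gt_eqF//; apply/cvgr0Pnorm_lt => e e0; near=> t.
  rewrite ger0_norm ?powR_ge0//.
  have [t0|t0] := leP t 0; first by rewrite pospow0 ?gt_eqF.
  rewrite pospowE ?ltW// -[ltRHS](@powRr1 _ e) ?ltW//.
  rewrite -(mulVf (lt0r_neq0 p0)) powRrM; apply: gt0_ltr_powR => //.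
  + by rewrite nnegrE ltW.
  + by rewrite nnegrE powR_ge0.
  + near: t; apply: lt_nbhsl; exact: powR_gt0.
Unshelve. all: by end_near. Qed.

Lemma is_derive_pospow p s : 1 < p -> is_derive s 1 (pospow p) (p * pospow (p - 1) s).
Proof.
move=> p1; have p0 : 0 < p by apply: lt_trans p1.
have [s0|s0|s0] := ltgtP s 0.
- rewrite (@pospow0 (p - 1)) ?ltW ?subr_eq0 ?gt_eqF// mulr0.
  have near0 : \forall t \near s, pospow p t = cst 0 t.
    near=> t; rewrite pospow0 ?gt_eqF// ltW//.
    by near: t; exact: lt_nbhsl.
  have near0' : \forall t \near s, cst 0 t = pospow p t by near do apply/esym.
  split; first by apply: (near_eq_derivable near0').
  by rewrite (near_eq_derive _ near0)//; exact: derive_val.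
- have nearp : \forall t \near s, pospow p t = (t `^ p).
    near=> t; rewrite pospowE// ltW//; near: t; exact: lt_nbhsr.
  have nearp' : \forall t \near s, (t `^ p) = pospow p t by near do apply/esym.
  have dp := is_derive1_powR p s0.
  rewrite pospowE ?ltW//; split; first by apply: (near_eq_derivable nearp').
  by rewrite (near_eq_derive _ nearp)//; exact: derive_val.
- rewrite s0; have E : (fun h : R => h^-1 *: (pospow p (h *: (1 : R) + 0) - pospow p 0)) @ 0^'
      --> p * pospow (p - 1) 0 -> is_derive (0 : R) 1 (pospow p) (p * pospow (p - 1) 0).
    move=> h; split; first by apply/cvg_ex; eexists; exact: h.
    exact/cvg_lim.
  apply: E; rewrite pospow0 ?gt_eqF// (@pospow0 (p - 1)) ?subr_eq0 ?gt_eqF// mulr0.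
  apply: (@cvg_trans _ (pospow (p - 1) @ 0^')).
    apply: near_eq_cvg; near=> h.
    have h0 : h != 0 by near: h; exact: nbhs_dnbhs_neq.
    rewrite subr0 addr0 [h *: 1]mulr1 /GRing.scale /=.
    have [hn|hp|hE] := ltgtP h 0; last by rewrite hE eqxx in h0.
      by rewrite !pospow0 ?ltW ?subr_eq0 ?gt_eqF// mulr0.
    rewrite !pospowE ?ltW// -(@mulr_powRB1 _ h p) ?ltW//.
    by rewrite mulKf.
  apply: cvg_within_filter.
  have p10 : 0 < p - 1 by rewrite subr_gt0.
  have cp : continuous (pospow (p - 1)) by exact: continuous_pospow.
  by have := cp 0; rewrite /continuous_at pospow0 ?gt_eqF.
Unshelve. all: by end_near. Qed.

End powers.

Section norms.
Variables (R : realType) (d : nat).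
Implicit Types x y : 'rV[R]_d.

Definition sqnorm x := \sum_i x ord0 i ^+ 2.

Lemma sqnorm_ge0 x : 0 <= sqnorm x.
Proof. by apply: sumr_ge0 => i _; exact: sqr_ge0. Qed.

Lemma coord_sqr_le x i : x ord0 i ^+ 2 <= sqnorm x.
Proof.
rewrite /sqnorm (bigD1 i)//= lerDl; apply: sumr_ge0 => j _; exact: sqr_ge0.
Qed.

Lemma enormE x : enorm x = Num.sqrt (sqnorm x). Proof. by []. Qed.

Lemma sqr_enorm x : enorm x ^+ 2 = sqnorm x.
Proof. by rewrite enormE sqr_sqrtr// sqnorm_ge0. Qed.

Lemma norm_le_enorm x : `|x| <= enorm x.
Proof.
apply: norm_le_coord => [|i]; first exact: sqrtr_ge0.
by rewrite -sqrtr_sqr; apply: ler_wsqrtr; exact: coord_sqr_le.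
Qed.

Lemma norm_sqr_le x : `|x| ^+ 2 <= sqnorm x.
Proof. by rewrite -sqr_enorm; apply: lerXn2r; rewrite ?nnegrE ?sqrtr_ge0// norm_le_enorm. Qed.

Lemma continuous_coord i : continuous (fun x : 'rV[R]_d => x ord0 i).
Proof. exact: coord_continuous. Qed.

Lemma continuous_sqnorm : continuous sqnorm.
Proof.
apply: continuous_sum_fun => i.
rewrite (_ : (fun x => _) = fun x : 'rV[R]_d => x ord0 i * x ord0 i).
  by apply: continuousM_fun; exact: continuous_coord.
by apply/funext => x; rewrite expr2.
Qed.

Lemma rV_neq0 x : x != 0 -> 0 < `|x| /\ 0 < sqnorm x.
Proof.
move=> x0; have nx : 0 < `|x| by rewrite normr_gt0.
by split => //; apply: lt_le_trans (norm_sqr_le x); rewrite exprn_gt0.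
Qed.

End norms.

Section sup_kernel.
Variables (R : realType) (d : nat) (alpha : R).
Hypothesis alpha0d : 0 < alpha < d%:R.
Local Notation mR := (measurableTypeR R).
Local Notation T := (d.-tuple mR).
Local Notation mu := (lebesgue_tuple R d).
Local Notation cub := (@cube R d).
Local Notation space := 'rV[R]_d.
Implicit Types (f g : space -> R) (x y : space).

(** A kernel that dominates the Riesz kernel up to a constant; balls of the sup norm are
    boxes, whose measure is explicit. *)
Definition supk y : R := `|y| `^ (alpha - d%:R).

Let mC : measurable cub := @measurable_cube R d.

Let ad0 : alpha - d%:R < 0. Proof. by move/andP: alpha0d => [_]; rewrite subr_lt0. Qed.

Lemma measurable_rowt_norm : measurable_fun setT (fun y : T => `|rowt y|).
Proof.
apply: (@continuous_row_measurable R d _ _ _ _ (fun x => `|x|)) => //.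
  by move=> i; exact: measurable_tnth.
by move=> x; exact: norm_continuous.
Qed.

Lemma measurable_supk : measurable_fun setT (fun y : T => supk (rowt y)).
Proof.
exact: (measurableT_comp (@measurable_powR R (alpha - d%:R)) measurable_rowt_norm).
Qed.

Definition tball (r : R) : set T := [set y | `|rowt y| < r].

Lemma lebesgue_ball (r : R) : 0 < r ->
  mu (tball r) = ((2 * r) ^+ d)%:E.
Proof.
move=> r0; rewrite (_ : tball r = [set t : T | forall i, `]- r, r[%classic (tnth t i)]).
  rewrite (@lebesgue_tuple_box R d (fun=> `]- r, r[%classic)); last first.
    by move=> i; exact: measurable_itv.
  rewrite (eq_bigr (fun=> (2 * r)%:E)) => [|i _].
    by rewrite prodEFin prodr_const card_ord.
  by rewrite lebesgue_measure_itv/= lte_fin gtrN// -EFinD opprK mulr_natl.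
apply/seteqP; split => y /= h.
  move=> i; have := le_lt_trans (coord_le_norm (rowt y) i) h.
  by rewrite mxE ltr_norml in_itv.
by apply: norm_lt_coord => // i; have := h i; rewrite mxE ltr_norml /= in_itv.
Qed.

Lemma measurable_ball (r : R) : measurable (tball r).
Proof.
have := measurable_rowt_norm measurableT (measurable_itv `]-oo, r[).
by rewrite setTI; congr measurable; apply/seteqP; split => y; rewrite /= in_itv.
Qed.

Lemma dyadic_shell (r t : R) : 0 < t < r ->
  exists k, r * 2^-1 ^+ k.+1 <= t < r * 2^-1 ^+ k.
Proof.
move=> /andP[t0 tr].
have ex : exists k, r * 2^-1 ^+ k.+1 <= t.
  have r0 := lt_trans t0 tr.
  have : (fun k => r * 2^-1 ^+ k) @ \oo --> r * 0.
    apply: cvgM; first exact: cvg_cst.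
    by apply: cvg_expr; rewrite ger0_norm; lra.
  rewrite mulr0 => /cvgr0Pnorm_lt /(_ _ t0)[N _ hN]; exists N.
  have := hN N.+1 (leqnSn N) => /(le_lt_trans (ler_norm _)); exact: ltW.
case: (ex_minnP ex) => k hk kmin; exists k; rewrite hk/=.
case: k => [|k] in hk kmin *; first by rewrite expr0 mulr1.
rewrite ltNge; apply/negP => h; have := kmin _ h; by rewrite ltnn.
Qed.

(* the ratio and the prefactor of the geometric series over dyadic shells *)
Let z : R := 2^-1 `^ alpha.
Let A : R := 2 `^ (d%:R - alpha) * 2 ^+ d.

Let z0 : 0 < z. Proof. by rewrite powR_gt0. Qed.
Let z1 : z < 1.
Proof.
have -> : 1 = 1 `^ alpha :> R by rewrite powR1.
by move/andP: alpha0d => [a0 _]; apply: gt0_ltr_powR => //; rewrite ?nnegrE; lra.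
Qed.

(** On the shell between radii r 2^-(k+1) and r 2^-k the kernel is at most its value on
    the inner sphere, and the measure of the ball is (2 r 2^-k)^d: the shells contribute a
    geometric series of ratio 2^-alpha. *)
Lemma supk_ball (r : R) : 0 < r ->
  (\int[mu]_(y in tball r) (supk (rowt y))%:E <=
   (A / (1 - z) * r `^ alpha)%:E)%E.
Proof.
move=> r0.
pose B k := tball (r * 2^-1 ^+ k).
pose c k : R := (r * 2^-1 ^+ k.+1) `^ (alpha - d%:R).
have rk0 k : 0 < r * 2^-1 ^+ k :> R by rewrite mulr_gt0// exprn_gt0.
have c0 k : 0 <= c k by exact: powR_ge0.
have mB k : measurable (B k) by exact: measurable_ball.
have m0 := measurable_ball r.
have mind k : measurable_fun setT (fun y : T => (c k * \1_(B k) y)%:E).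
  by apply/measurable_EFinP; apply: measurable_funM.
apply: (@le_trans _ _ (\int[mu]_y \sum_(0 <= k <oo) (c k * \1_(B k) y)%:E)%E).
  rewrite integral_mkcond; apply: ge0_le_integral => //.
  - by move=> y _; rewrite patchE; case: ifP => // _; rewrite lee_fin powR_ge0.
  - apply/(measurable_restrictT _ m0); apply/measurable_EFinP.
    by apply: measurable_funTS; exact: measurable_supk.
  - apply: ge0_emeasurable_sum => //.
    by move=> k y _ _; rewrite lee_fin mulr_ge0.
  move=> y _; rewrite patchE; case: ifPn => [/set_mem /= yr|_]; last first.
    by apply: nneseries_ge0 => k _ _; rewrite lee_fin mulr_ge0.
  have [y0|y0] := eqVneq (rowt y) 0.
    rewrite /supk y0 normr0 powR0; last by rewrite lt_eqF.
    by apply: nneseries_ge0 => k _ _; rewrite lee_fin mulr_ge0.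
  have [ny _] := rV_neq0 y0.
  have [k /andP[hk1 hk2]] := @dyadic_shell r `|rowt y| ltac:(by rewrite ny yr).
  apply: le_trans (@nneseries_lim_ge _ _ xpredT 0 k.+1 _); last first.
    by move=> n _ _; rewrite lee_fin mulr_ge0.
  rewrite big_nat_recr//= -[leLHS]add0e; apply: leeD.
    by apply: sume_ge0 => n _; rewrite lee_fin mulr_ge0.
  rewrite lee_fin indicE mem_set// mulr1 /c /supk.
  by apply: le_powR_neg => //; exact: ltW.
rewrite integral_nneseries//; last by move=> k y _; rewrite lee_fin mulr_ge0.
apply: lime_le.
  by apply: is_cvg_nneseries => k _ _; apply: integral_ge0 => y _; rewrite lee_fin mulr_ge0.
apply: nearW => n.
have -> : (\sum_(0 <= k < n) \int[mu]_y (c k * \1_(B k) y)%:E)%E =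
    (series (geometric (A * r `^ alpha) z) n)%:E.
  rewrite /series /= -sumEFin; apply: eq_bigr => k _.
  under eq_integral do rewrite EFinM.
  have ck0 : (0 <= (c k)%:E)%E by rewrite lee_fin.
  rewrite ge0_integralZl//; last exact/measurable_EFinP.
  rewrite integral_indic// setIT [X in (_ * X)%E](lebesgue_ball (rk0 k)).
  rewrite -EFinM; congr EFin; rewrite /c /A /z /geometric/=.
  have r'0 := rk0 k; have -> : r * 2^-1 ^+ k.+1 = 2^-1 * (r * 2^-1 ^+ k).
    by rewrite exprS mulrCA.
  have qa : (r * 2^-1 ^+ k) `^ alpha = r `^ alpha * (2^-1 `^ alpha) ^+ k.
    rewrite powRM ?exprn_ge0 ?(ltW r0)//; congr (_ * _).
    by rewrite -!powR_mulrn ?powR_ge0 ?invr_ge0// -!powRrM mulrC.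
  rewrite -[RHS]mulrA -qa; set q := r * _ in r'0 *.
  have -> : (2^-1 * q) `^ (alpha - d%:R) = 2 `^ (d%:R - alpha) * q `^ (alpha - d%:R).
    rewrite powRM ?invr_ge0 ?(ltW r'0)//; congr (_ * _).
    by rewrite -powR_inv1// -powRrM mulN1r opprB.
  have -> : q `^ alpha = q `^ (alpha - d%:R) * q ^+ d.
    by rewrite -powR_mulrn ?(ltW r'0)// -powRD ?subrK// (gt_eqF r'0) implybT.
  rewrite exprMn; ring.
rewrite lee_fin; have -> : A / (1 - z) * r `^ alpha = A * r `^ alpha / (1 - z) by rewrite mulrAC.
apply: geometric_le_lim => //.
- by rewrite mulr_ge0 ?powR_ge0// /A mulr_ge0 ?powR_ge0// exprn_ge0.
- by rewrite ger0_norm ?ltW.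
Qed.

Definition supk_const : R := A / (1 - z).

Lemma supk_const_ge0 : 0 <= supk_const.
Proof.
by rewrite divr_ge0 ?subr_ge0 ?(ltW z1)// /A mulr_ge0 ?powR_ge0// exprn_ge0.
Qed.

Lemma cube_norm_lt1 (y : T) : cub y -> `|rowt y| < 1.
Proof.
move=> Cy; apply: norm_lt_coord => // i; rewrite mxE ltr_norml.
by have := Cy i; lra.
Qed.

Lemma weight_supk : weight supk.
Proof.
apply/integrableP; split.
  by apply/measurable_EFinP; apply: measurable_funTS; exact: measurable_supk.
apply: (@le_lt_trans _ _ (supk_const * 1 `^ alpha)%:E); last by rewrite ltry.
apply: le_trans (supk_ball ltr01).
rewrite (eq_integral (fun y : T => (supk (rowt y))%:E)); last first.
  by move=> y _ /=; rewrite ger0_norm// powR_ge0.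
apply: ge0_subset_integral => //; first exact: measurable_ball.
- by apply/measurable_EFinP; apply: measurable_funTS; exact: measurable_supk.
- by move=> y _; rewrite lee_fin powR_ge0.
- by move=> y /cube_norm_lt1.
Qed.

Definition supk_trunc (r : R) y : R := if `|y| < r then supk y else 0.

Lemma supk_ge0 y : 0 <= supk y. Proof. exact: powR_ge0. Qed.

Lemma supkN y : supk (- y) = supk y. Proof. by rewrite /supk normrN. Qed.

Lemma supk_trunc_ge0 r y : 0 <= supk_trunc r y.
Proof. by rewrite /supk_trunc; case: ifP => // _; exact: supk_ge0. Qed.

Lemma supk_truncE r : supk_trunc r \o @rowt R d = (supk \o @rowt R d) \_ (tball r).
Proof.
apply/funext => y; rewrite /= /supk_trunc patchE.
by case: (boolP (`|rowt y| < r)) => h; [rewrite mem_set|rewrite memNset//; exact/negP].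
Qed.

Lemma weight_supk_trunc r : weight (supk_trunc r).
Proof.
apply: (le_weight _ weight_supk) => [|y _].
  rewrite supk_truncE; apply: measurable_funTS.
  apply/(measurable_restrictT _ (measurable_ball r)); apply: measurable_funTS.
  exact: measurable_supk.
by rewrite ger0_norm ?supk_trunc_ge0// /supk_trunc; case: ifP => // _; exact: supk_ge0.
Qed.

Lemma tint_supk_trunc (r : R) : 0 < r ->
  tint (supk_trunc r) (cst 1) <= supk_const * r `^ alpha.
Proof.
move=> r0; rewrite -lee_fin; apply: le_trans (supk_ball r0).
rewrite /tint /torus_integral /Rintegral fineK; last first.
  apply: integrable_fin_num => //.
  exact: (weightM (weight_supk_trunc r) (@bmeas_cst R d 1)).
rewrite (eq_integral (fun y : T => (((supk \o @rowt R d) \_ (tball r)) y)%:E)); last first.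
  by move=> y _; rewrite mulr1 -supk_truncE.
rewrite [leRHS]integral_mkcond restrict_EFin.
have mt : measurable_fun setT (((supk \o @rowt R d) \_ (tball r))).
  apply/(measurable_restrictT _ (measurable_ball r)); apply: measurable_funTS.
  exact: measurable_supk.
apply: ge0_subset_integral => //.
  exact/measurable_EFinP.
by move=> y _; rewrite lee_fin -supk_truncE; exact: supk_trunc_ge0.
Qed.

(** The origin has to be discarded, because there the Riesz kernel has the value 0 while
    its regularisations blow up. *)
Lemma rowt0_negligible : mu.-negligible [set y : T | rowt y = 0].
Proof.
have mb : measurable [set t : T | forall i, [set (0 : R)] (tnth t i)].
  rewrite (_ : mkset _ = \bigcap_(i in [set: 'I_d]) ((fun t : T => tnth t i) @^-1` [set 0])).
    apply: fin_bigcap_measurable => // i _; rewrite -[X in measurable X]setTI.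
    exact: (@measurable_tnth _ _ d i).
  by apply/seteqP; split => [t h i _|t h i]; [exact: (h i)|exact: (h i Logic.I)].
exists [set t : T | forall i, [set (0 : R)] (tnth t i)]; split => //.
  rewrite (@lebesgue_tuple_box R d (fun=> [set 0]))//.
  have : (0 < d)%N.
    by move/andP: alpha0d => [a0 /(lt_trans a0)]; rewrite ltr0n.
  case: d => // n _; rewrite big_ord_recl.
  by rewrite lebesgue_measure_set1 mul0e.
move=> y /= /rowP h i; have := h i; by rewrite !mxE.
Qed.

Local Notation K := (@riesz_kernel R d alpha).

Let da0 : 0 < d%:R - alpha.
Proof. by rewrite subr_gt0; move/andP: alpha0d => []. Qed.

Lemma riesz_kernelE y : K y = (d%:R - alpha)^-1 * sqnorm y `^ ((alpha - d%:R) / 2).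
Proof.
rewrite /riesz_kernel enormE -powR12_sqrt ?sqnorm_ge0// -powRrM; congr (_ * _ `^ _).
by rewrite mulrC.
Qed.

Lemma riesz_kernel_ge0 y : 0 <= K y.
Proof. by rewrite mulr_ge0 ?powR_ge0// invr_ge0 ltW. Qed.

Lemma riesz_kernel_le y : K y <= (d%:R - alpha)^-1 * supk y.
Proof.
rewrite ler_wpM2l ?invr_ge0 ?(ltW da0)//.
have [->|/rV_neq0[y0 _]] := eqVneq y 0.
  rewrite enormE /sqnorm /supk big1 ?sqrtr0 ?normr0// => i _.
  by rewrite mxE expr0n.
by apply: le_powR_neg; [exact: ltW|by []|exact: norm_le_enorm].
Qed.

Lemma sqnormN y : sqnorm (- y) = sqnorm y.
Proof. by apply: eq_bigr => i _; rewrite mxE sqrrN. Qed.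

Lemma riesz_kernelN y : K (- y) = K y.
Proof. by rewrite !riesz_kernelE sqnormN. Qed.

Lemma weight_riesz_kernel : weight K.
Proof.
apply: (le_weight _ (weightZ (d%:R - alpha)^-1 weight_supk)) => [|y _]; last first.
  by rewrite ger0_norm ?riesz_kernel_ge0// riesz_kernel_le.
apply: measurable_funTS.
rewrite (_ : _ \o _ = (fun r : R => (d%:R - alpha)^-1 * r `^ ((alpha - d%:R) / 2)) \o
   (fun y : T => sqnorm (rowt y))); last first.
  by apply/funext => y; rewrite /= riesz_kernelE.
apply: measurableT_comp.
  by apply: measurable_funM => //; exact: (@measurable_powR R).
apply: (@continuous_row_measurable R d _ _ _ _ (@sqnorm R d)) => //.
  by move=> i; exact: measurable_tnth.
exact: continuous_sqnorm.
Qed.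

(** The gradient of the Riesz kernel is not integrable when alpha <= 1. These smooth
    kernels increase to the Riesz kernel as s decreases to 0, and dregk is their gradient. *)
Definition regk (s : R) y : R :=
  (d%:R - alpha)^-1 * (sqnorm y + s) `^ ((alpha - d%:R) / 2).

Definition dregk (s : R) (i : 'I_d) y : R :=
  - (y ord0 i * (sqnorm y + s) `^ ((alpha - d%:R) / 2 - 1)).

Lemma is_derive_of_line f x (v : space) (l : R) :
  is_derive (0 : R) 1 (fun t : R => f (x + t *: v)) l -> is_derive x v f l.
Proof.
have E : (fun h : R => h^-1 *: (f (h *: v + x) - f x)) =
    (fun h : R => h^-1 *: ((fun t : R => f (x + t *: v)) (h *: (1 : R) + 0)
       - (fun t : R => f (x + t *: v)) 0)).
  by apply/funext => h /=; rewrite scale0r !addr0 [_%:A]mulr1 [_ + x]addrC.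
by move=> [h1 h2]; split; [rewrite /derivable E|rewrite /derive E].
Qed.

Lemma sqnorm_line x i (t : R) :
  sqnorm (x + t *: delta_mx ord0 i) = sqnorm x + 2 * t * x ord0 i + t ^+ 2.
Proof.
rewrite /sqnorm (bigD1 i)//= [in RHS](bigD1 i)//= !mxE !eqxx/=.
rewrite (eq_bigr (fun j => x ord0 j ^+ 2)) => [|j ji].
  ring.
by rewrite !mxE (negbTE ji) andbF mulr0 addr0.
Qed.

Lemma continuous_regpow (s p : R) : 0 < s -> continuous (fun y => (sqnorm y + s) `^ p).
Proof.
move=> s0 y; have ys : 0 < sqnorm y + s by rewrite ltr_wpDl// sqnorm_ge0.
apply: (@continuous_comp _ _ _ (fun y => sqnorm y + s) (fun r : R => r `^ p)).
  apply: (@continuousD_fun R _ (@sqnorm R d) (cst s)); first exact: continuous_sqnorm.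
  exact: cst_continuous.
apply: differentiable_continuous; apply/derivable1_diffP.
by have [] := is_derive1_powR p ys.
Qed.

Lemma continuous_regk s : 0 < s -> continuous (regk s).
Proof.
move=> s0; apply: (@continuousM_fun R _ (cst _)); first exact: cst_continuous.
exact: continuous_regpow.
Qed.

Lemma continuous_dregk s i : 0 < s -> continuous (dregk s i).
Proof.
move=> s0; apply: continuousN_fun; apply: continuousM_fun; last exact: continuous_regpow.
exact: continuous_coord.
Qed.

Lemma is_derive_regk s i y : 0 < s -> is_derive y (delta_mx ord0 i) (regk s) (dregk s i y).
Proof.
move=> s0; have ys : 0 < sqnorm y + s by rewrite ltr_wpDl// sqnorm_ge0.
apply: is_derive_of_line.
pose q t : R := sqnorm y + 2 * t * y ord0 i + t ^+ 2 + s.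
have q0 : q 0 = sqnorm y + s by rewrite /q mulr0 mul0r expr0n !addr0.
have dq : is_derive (0 : R) 1 q (2 * y ord0 i).
  rewrite /q; apply: is_derive_eq.
  rewrite /GRing.scale /=; ring.
have := is_derive1_powR ((alpha - d%:R) / 2) ys; rewrite -{1}q0 => dp.
have := @is_derive1_comp _ _ _ _ _ _ dp dq => dc.
have -> : (fun t : R => regk s (y + t *: delta_mx ord0 i)) =
    (d%:R - alpha)^-1 *: (fun t : R => q t `^ ((alpha - d%:R) / 2)).
  by apply/funext => t; rewrite /regk sqnorm_line.
apply: is_derive_eq.
rewrite /dregk /GRing.scale /=; move: da0; set D := d%:R => da.
field.
by rewrite gt_eqF.
Qed.

Lemma regk_face s i x : x ord0 i = 0 ->
  regk s (x + 2^-1 *: delta_mx ord0 i) = regk s (x - 2^-1 *: delta_mx ord0 i).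
Proof.
by move=> xi; rewrite /regk -scaleNr !sqnorm_line xi !mulr0 sqrrN.
Qed.

Lemma dregkN s i y : dregk s i (- y) = - dregk s i y.
Proof. by rewrite /dregk sqnormN mxE mulNr. Qed.

(** A factor |y| compensates the extra singularity of the gradient, uniformly in s. *)
Lemma dregk_le s i y : 0 < s -> `|dregk s i y| * `|y| <= supk y.
Proof.
move=> s0; have [->|/rV_neq0[y0 q0]] := eqVneq y 0.
  by rewrite normr0 mulr0; exact: supk_ge0.
set p := (alpha - d%:R) / 2.
have p0 : p < 0 by rewrite /p; move: ad0; lra.
have qs : 0 < sqnorm y + s by rewrite addr_gt0.
rewrite /dregk normrN normrM (ger0_norm (powR_ge0 _ _)) mulrAC.
apply: (@le_trans _ _ ((sqnorm y + s) * (sqnorm y + s) `^ (p - 1))).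
  apply: ler_wpM2r; first exact: powR_ge0.
  apply: (@le_trans _ _ (`|y| ^+ 2)).
    by rewrite expr2 ler_wpM2r// coord_le_norm.
  by apply: le_trans (norm_sqr_le y) _; rewrite lerDl ltW.
rewrite -{1}(@powRr1 _ (sqnorm y + s)) ?(ltW qs)// -powRD; last by rewrite (gt_eqF qs) implybT.
rewrite [1 + _]addrC subrK /supk.
have -> : `|y| `^ (alpha - d%:R) = (`|y| ^+ 2) `^ p.
  by rewrite -powR_mulrn// -powRrM /p mulrC divfK.
apply: le_powR_neg; [exact: ltW|by rewrite exprn_gt0|].
by apply: le_trans (norm_sqr_le y) _; rewrite lerDl ltW.
Qed.

Lemma weight_continuous (k : space -> R) : continuous k -> weight k.
Proof. by move=> ck; exact/weight_bmeas/continuous_bmeas. Qed.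

(** Dominated convergence, the Riesz kernel being larger than all its regularisations. *)
Lemma tint_regk_cvg f : bmeas f ->
  tint (regk (n.+1%:R^-1)) f @[n --> \oo] --> tint K f.
Proof.
move=> bf; have wK := weight_riesz_kernel.
have sn0 n : 0 < n.+1%:R^-1 :> R by rewrite invr_gt0.
have wr n : weight (regk n.+1%:R^-1) by apply: weight_continuous; exact: continuous_regk.
have aey (P : T -> Prop) : (forall y : T, rowt y != 0 -> P y) -> {ae mu, forall t, P t}.
  move=> h; apply: negligibleS rowt0_negligible => t /= nP.
  by apply/eqP; apply: contrapT => /negP /h.
have [|||_ _ h] := @dominated_convergence _ _ R mu cub mC
  (fun n t => (regk n.+1%:R^-1 (rowt t) * f (rowt t))%:E)
  (fun t => (K (rowt t) * f (rowt t))%:E) (fun t => (K (rowt t) * `|f (rowt t)|)%:E)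
  (fun n => measurable_int _ (weightM (wr n) bf)) (measurable_int _ (weightM wK bf)).
- apply: aey => y y0 _.
  apply: cvg_EFin; first exact: nearW.
  apply: cvgM; last exact: cvg_cst.
  rewrite riesz_kernelE; apply: cvgM; first exact: cvg_cst.
  have [_ q0] := rV_neq0 y0.
  have cp : {for sqnorm (rowt y), continuous (fun r : R => r `^ ((alpha - d%:R) / 2))}.
    apply: differentiable_continuous; apply/derivable1_diffP.
    by have [] := is_derive1_powR ((alpha - d%:R) / 2) q0.
  apply: (@cvg_comp _ _ _ (fun n => sqnorm (rowt y) + n.+1%:R^-1)
    (fun r : R => r `^ ((alpha - d%:R) / 2)) _ _ _ _ cp).
  have : sqnorm (rowt y) + n.+1%:R^-1 @[n --> \oo] --> sqnorm (rowt y) + 0.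
    by apply: cvgD; [exact: cvg_cst|exact: cvg_harmonic].
  by rewrite addr0.
- exact: (weightM wK (bmeas_norm bf)).
- apply: aey => y y0 n _; rewrite lee_fin normrM ler_wpM2r//.
  have [_ q0] := rV_neq0 y0.
  rewrite riesz_kernelE /regk ger0_norm; last by rewrite mulr_ge0 ?powR_ge0// invr_ge0 ltW.
  rewrite ler_wpM2l ?invr_ge0 ?(ltW da0)//.
  apply: le_powR_neg => //; last by rewrite lerDl ltW.
  by move: ad0; lra.
apply: fine_cvg; rewrite fineK; first exact: h.
by apply: integrable_fin_num => //; exact: (weightM wK bf).
Qed.

End sup_kernel.

(** * Coercivity of the relative internal energy *)

Section relative_energy_bound.
Variable R : realType.
Implicit Types (p q s sb t x y b gamma : R).

(** The sign condition says that f does not decrease on the way from a to t. *)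
Lemma mvt_ge0 (f df : R -> R) (a : R) : (forall x, is_derive x 1 f (df x)) -> f a = 0 ->
  forall t, (forall x, Num.min a t < x < Num.max a t -> 0 <= df x * (x - a)) -> 0 <= f t.
Proof.
move=> fdf fa t h.
have cf b c : {within `[b, c], continuous f}.
  apply: derivable_within_continuous => x _; by have [] := fdf x.
have [ta|at_|->] := ltgtP t a; last by rewrite fa.
  have [x] := @MVT R f df t a ta (fun x _ => fdf x) (cf _ _).
  rewrite in_itv /= fa => /andP[tx xa] E.
  have := h x; rewrite (min_r (ltW ta)) (max_l (ltW ta)) tx xa => /(_ erefl).
  have xa0 : x - a < 0 by rewrite subr_lt0.
  rewrite nmulr_lge0// => dfx; move: E; rewrite sub0r => /eqP; rewrite eqr_oppLR => /eqP ->.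
  by rewrite oppr_ge0 mulr_le0_ge0// subr_ge0 ltW.
have [x] := @MVT R f df a t at_ (fun x _ => fdf x) (cf _ _).
rewrite in_itv /= fa subr0 => /andP[ax xt] ->.
have := h x; rewrite (min_l (ltW at_)) (max_r (ltW at_)) ax xt => /(_ erefl).
have xa0 : 0 < x - a by rewrite subr_gt0.
by rewrite pmulr_lge0// => dfx; rewrite mulr_ge0// subr_ge0 ltW.
Qed.

Lemma bernoulli_powR p t : 1 <= p -> 0 <= t -> 1 + p * (t - 1) <= t `^ p.
Proof.
rewrite le_eqVlt => /predU1P[<-|p1] t0.
  by rewrite powRr1// mul1r addrC subrK.
have p0 : 0 < p by apply: lt_trans p1.
pose f t := pospow p t - (1 + p * (t - 1)).
have df x : is_derive x 1 f (p * pospow (p - 1) x - p).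
  have h := is_derive_pospow x p1.
  rewrite /f; apply: is_derive_eq.
  by rewrite /GRing.scale /=; ring.
have f1 : f 1 = 0 by rewrite /f pospowE// powR1 subrr mulr0 addr0 subrr.
have := mvt_ge0 df f1 (t := t).
rewrite /f pospowE// subr_ge0; apply => x /andP[x1 x2].
have x0 : 0 < x by apply: le_lt_trans x1; rewrite le_min ler01.
rewrite pospowE ?(ltW x0)//.
rewrite [leRHS](_ : _ = p * ((x `^ (p - 1) - 1) * (x - 1))); last by ring.
rewrite mulr_ge0 ?(ltW p0)//.
have p10 : 0 <= p - 1 by rewrite subr_ge0 ltW.
have [h|h] := leP 1 x.
  rewrite mulr_ge0 ?subr_ge0//.
  by have := @le_powR _ (p - 1) 1 x p10 ler01 h; rewrite powR1.
rewrite mulr_le0 ?subr_le0 ?(ltW h)//.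
by have := @le_powR _ (p - 1) x 1 p10 (ltW x0) (ltW h); rewrite powR1.
Qed.

Lemma powR_sub1_sqr b x : 0 < b <= 1 -> 0 < x < 2 ->
  b / 2 * (x - 1) ^+ 2 <= (x `^ b - 1) * (x - 1).
Proof.
move=> /andP[b0 b1] /andP[x0 x2].
have half y : 0 < y < 2 -> 2^-1 <= y `^ (b - 1).
  move=> /andP[y0 y2]; have [y1|y1] := leP y 1.
    apply: (@le_trans _ _ 1); first by lra.
    by have := @le_powR_neg _ (b - 1) y 1 ltac:(lra) y0 y1; rewrite powR1.
  apply: (@le_trans _ _ (y `^ (-1))).
    by rewrite powR_inv1 ?(ltW y0)// lef_pV2 ?posrE// ltW.
  by apply: ler_powR; [exact: ltW|lra].
have key (u v : R) : 0 < u -> u < v -> v < 2 -> b / 2 * (v - u) <= v `^ b - u `^ b.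
  move=> u0 uv v2; have [||c] := @MVT R (@powR R ^~ b) (fun x : R => b * x `^ (b - 1)) u v uv.
  - by move=> y /[!in_itv]/= /andP[uy _]; apply: is_derive1_powR; exact: lt_trans uy.
  - apply: derivable_within_continuous => y /[!in_itv]/= /andP[uy _].
    by have [] := is_derive1_powR b (lt_le_trans u0 uy).
  move=> /[!in_itv]/= /andP[uc cv] ->; apply: ler_wpM2r; first by rewrite subr_ge0 ltW.
  by apply: ler_wpM2l; [exact: ltW|apply: half; lra].
have [x1|x1|->] := ltgtP x 1; last by rewrite subrr expr0n !mulr0.
  have := key x 1 x0 x1 ltac:(lra); rewrite powR1 => h.
  have : 0 <= (1 - x `^ b - b / 2 * (1 - x)) * (1 - x) by apply: mulr_ge0; lra.
  lra.
have := key 1 x ltr01 x1 x2; rewrite powR1 => h.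
have : 0 <= (x `^ b - 1 - b / 2 * (x - 1)) * (x - 1) by apply: mulr_ge0; lra.
lra.
Qed.

(** The relative energy density of s^q with respect to the density 1. *)
Definition relpow q t := t `^ q - 1 - q * (t - 1).

Lemma relpow_ge0 q t : 1 <= q -> 0 <= t -> 0 <= relpow q t.
Proof. by move=> q1 t0; have := bernoulli_powR q1 t0; rewrite /relpow; lra. Qed.

Lemma relpow_quadratic q t : 1 < q <= 2 -> 0 <= t <= 2 ->
  q * (q - 1) / 4 * (t - 1) ^+ 2 <= relpow q t.
Proof.
move=> /andP[q1 q2] /andP[t0 t2]; set c := q * (q - 1) / 4.
pose f t := pospow q t - 1 - q * (t - 1) - c * (t - 1) ^+ 2.
have df x : is_derive x 1 f (q * (pospow (q - 1) x - 1) - 2 * c * (x - 1)).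
  have h := is_derive_pospow x q1.
  rewrite /f; apply: is_derive_eq.
  by rewrite /GRing.scale /=; ring.
have f1 : f 1 = 0 by rewrite /f pospowE// powR1 subrr expr0n !mulr0 !subr0.
have := mvt_ge0 df f1 (t := t).
rewrite /relpow /f pospowE// subr_ge0; apply => x /andP[x1 x2].
have x0 : 0 < x by apply: le_lt_trans x1; rewrite le_min ler01.
have x3 : x < 2 by apply: lt_le_trans x2 _; rewrite ge_max t2 andbT; lra.
have := @powR_sub1_sqr (q - 1) x ltac:(lra) ltac:(lra).
rewrite pospowE ?(ltW x0)//; set X := x `^ (q - 1) => h.
rewrite [leRHS](_ : _ = q * ((X - 1) * (x - 1) - (q - 1) / 2 * (x - 1) ^+ 2)).
  by apply: mulr_ge0; [lra|rewrite subr_ge0].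
by rewrite /c; field.
Qed.

(** At t = 2 the quadratic bound applies; beyond, t^q = 2^q (t/2)^q and Bernoulli's
    inequality holds for (t/2)^q. *)
Lemma relpow_large q t : 1 < q <= 2 -> 2 <= t ->
  q * (q - 1) / 16 * (t - 1) `^ q <= relpow q t.
Proof.
move=> /andP[q1 q2] t2; set c := q * (q - 1) / 4.
have c0 : 0 <= c by rewrite /c divr_ge0 ?mulr_ge0; lra.
have two := @relpow_quadratic q 2 ltac:(lra) ltac:(lra).
have {two} : 1 + q + c <= 2 `^ q.
  move: two; rewrite /relpow -/c (_ : 2 - 1 = 1 :> R); last by lra.
  by rewrite expr1n; lra.
move=> two; pose s := t / 2.
have s1 : 1 <= s by rewrite /s; lra.
have bs := @bernoulli_powR q s ltac:(lra) ltac:(lra).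
have tE : t = 2 * s by rewrite /s; field.
have tq : t `^ q = 2 `^ q * s `^ q by rewrite tE powRM; lra.
have sq0 : 0 <= s `^ q by exact: powR_ge0.
have step1 : c * s `^ q <= relpow q t.
  rewrite /relpow tq tE.
  have h1 : 0 <= (2 `^ q - 1 - q - c) * s `^ q by apply: mulr_ge0; lra.
  have h2 : 0 <= (1 + q) * (s `^ q - (1 + q * (s - 1))) by apply: mulr_ge0; lra.
  have h3 : 0 <= q * (q - 1) * (s - 1) by rewrite !mulr_ge0; lra.
  nra.
apply: le_trans step1.
have h : (t - 1) `^ q <= 4 * s `^ q.
  apply: (@le_trans _ _ (t `^ q)); first by apply: le_powR; lra.
  rewrite tq; apply: ler_wpM2r => //.
  rewrite (_ : 4 = 2 `^ 2 :> R); first by apply: ler_powR; lra.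
  by rewrite powR_mulrn// -natrX.
rewrite (_ : q * (q - 1) / 16 = c / 4); last by rewrite /c; field.
rewrite -mulrA; apply: ler_wpM2l => //; lra.
Qed.

(** Bernoulli's inequality with exponent gamma / q, applied to t^q. *)
Lemma relpow_mono gamma q t : 1 < q -> q <= gamma -> 0 <= t -> relpow q t <= relpow gamma t.
Proof.
move=> q1 qg t0; have q0 : 0 < q by apply: lt_trans q1.
have gq : 1 <= gamma / q by rewrite ler_pdivlMr// mul1r.
have := bernoulli_powR gq (powR_ge0 t q); rewrite -powRrM mulrC [q * _]mulrC divfK ?gt_eqF//.
move=> h; have r0 := relpow_ge0 (ltW q1) t0.
have : relpow q t <= gamma / q * relpow q t by rewrite ler_peMl.
move/le_trans; apply.
rewrite /relpow; rewrite [leLHS](_ : _ = (t `^ q - 1) * (gamma / q) - gamma * (t - 1)).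
  lra.
by field; rewrite gt_eqF.
Qed.

(** By homogeneity every reference density reduces to 1. *)
Lemma relative_internal_energyE gamma s sb : 1 < gamma -> 0 <= s -> 0 < sb ->
  relative_internal_energy gamma s sb = sb `^ gamma / (gamma - 1) * relpow gamma (s / sb).
Proof.
move=> g1 s0 sb0.
have g0 : gamma - 1 != 0 by rewrite subr_eq0 gt_eqF.
rewrite /relative_internal_energy /internal_energy /internal_energy' /relpow.
rewrite powRM ?invr_ge0 ?(ltW sb0)//.
have -> : sb^-1 `^ gamma = (sb `^ gamma)^-1.
  by rewrite -powR_inv1 ?(ltW sb0)// -powRrM mulN1r powRN.
have sg0 : sb `^ gamma != 0 by rewrite gt_eqF// powR_gt0.
have -> : sb `^ (gamma - 1) = sb `^ gamma / sb.
  by rewrite powRB ?powRr1 ?(ltW sb0)// (gt_eqF sb0) implybT.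
by field; rewrite g0 sg0 gt_eqF.
Qed.

Lemma relative_internal_energy_ge0 gamma s sb : 1 < gamma -> 0 <= s -> 0 < sb ->
  0 <= relative_internal_energy gamma s sb.
Proof.
move=> g1 s0 sb0; rewrite relative_internal_energyE//.
apply: mulr_ge0; first by rewrite divr_ge0 ?powR_ge0// subr_ge0 ltW.
by apply: relpow_ge0; [exact: ltW|rewrite divr_ge0 ?(ltW sb0)].
Qed.

(** With t = s / sb, relpow q t is at least of order (t - 1)^2 for t <= 2 and (t - 1)^q
    beyond; the bounds on sb absorb the scaling factors. *)
Lemma relative_internal_energy_coercive gamma q (delta M : R) :
  1 < q <= 2 -> q <= gamma -> 0 < delta ->
  exists2 A : R, 0 < A & forall s sb, 0 <= s -> delta <= sb <= M ->
    `|s - sb| ^+ 2 <= A * relative_internal_energy gamma s sb \/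
    (0 < `|s - sb| /\ `|s - sb| `^ q <= A * relative_internal_energy gamma s sb).
Proof.
move=> /andP[q1 q2] qg d0.
have g1 : 1 < gamma by apply: lt_le_trans qg.
pose c := q * (q - 1) / 16.
have c0 : 0 < c by rewrite /c divr_gt0// mulr_gt0; lra.
have dg0 : 0 < delta `^ gamma by exact: powR_gt0.
pose M1 := `|M| + 1.
have M0 : 0 < M1 by rewrite ltr_wpDl.
pose A := (gamma - 1) / (delta `^ gamma * c) * (M1 ^+ 2 + M1 `^ q).
have fac0 : 0 < (gamma - 1) / (delta `^ gamma * c) by apply: divr_gt0; [rewrite subr_gt0|exact: mulr_gt0].
have Mq0 : 0 < M1 `^ q by exact: powR_gt0.
have M20 : 0 < M1 ^+ 2 by rewrite exprn_gt0.
exists A; first by rewrite mulr_gt0// addr_gt0.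
move=> s sb s0 /andP[dsb sbM].
have sb0 : 0 < sb by apply: lt_le_trans dsb.
have sbM1 : sb <= M1 by rewrite /M1 (le_trans sbM)// (le_trans (ler_norm _))// lerDl.
have t0 : 0 <= s / sb by rewrite divr_ge0// ltW.
have tE : s / sb - 1 = (s - sb) / sb by field; rewrite gt_eqF.
have hmono : delta `^ gamma / (gamma - 1) * relpow q (s / sb) <=
    relative_internal_energy gamma s sb.
  rewrite relative_internal_energyE//; apply: ler_pM.
  - by rewrite divr_ge0 ?(ltW dg0)// subr_ge0 ltW.
  - by apply: relpow_ge0 => //; exact: ltW.
  - by rewrite ler_pM2r ?invr_gt0 ?subr_gt0//; apply: le_powR => //; lra.
  - exact: relpow_mono.
have Ah (W X : R) : 0 <= W -> c * W <= relpow q (s / sb) -> X <= (M1 ^+ 2 + M1 `^ q) * W ->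
    X <= A * relative_internal_energy gamma s sb.
  move=> W0 hW hX; apply: le_trans hX _.
  apply: (@le_trans _ _ (A * (delta `^ gamma / (gamma - 1) * (c * W)))).
    rewrite le_eqVlt; apply/orP; left; apply/eqP; rewrite /A; field.
    by rewrite !gt_eqF// subr_gt0.
  apply: ler_wpM2l; first by rewrite mulr_ge0 ?ltW// addr_gt0.
  apply: le_trans hmono; apply: ler_wpM2l => //.
  by rewrite divr_ge0 ?(ltW dg0)// subr_ge0 ltW.
have [t2|t2] := leP (s / sb) 2.
  left; apply: (Ah (((s - sb) / sb) ^+ 2)); first exact: sqr_ge0.
    have := @relpow_quadratic q (s / sb) ltac:(lra) ltac:(rewrite t0 t2//).
    rewrite tE; apply: le_trans; apply: ler_wpM2r; first exact: sqr_ge0.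
    rewrite /c; have : 0 <= q * (q - 1) by rewrite mulr_ge0; lra.
    lra.
  rewrite real_normK ?num_real//.
  apply: (@le_trans _ _ (M1 ^+ 2 * ((s - sb) / sb) ^+ 2)); last first.
    by apply: ler_wpM2r; [exact: sqr_ge0|rewrite lerDl ltW].
  rewrite -exprMn mulrCA exprMn ler_peMr ?sqr_ge0//.
  rewrite -[leLHS](expr1n _ 2); apply: lerXn2r; rewrite ?nnegrE ?divr_ge0 ?(ltW M0) ?(ltW sb0)//.
  by rewrite ler_pdivlMr// mul1r.
right; have ssb : sb < s - sb.
  by move: t2; rewrite ltr_pdivlMr//; lra.
have r0 : 0 < s - sb by apply: lt_trans ssb.
rewrite gtr0_norm//; split=> //.
apply: (Ah (((s - sb) / sb) `^ q)); first exact: powR_ge0.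
  by have := @relpow_large q (s / sb) ltac:(lra) (ltW t2); rewrite tE.
apply: (@le_trans _ _ (M1 `^ q * ((s - sb) / sb) `^ q)); last first.
  by apply: ler_wpM2r; [exact: powR_ge0|rewrite lerDr ltW].
rewrite -powRM ?(ltW M0) ?divr_ge0 ?(ltW r0) ?(ltW sb0)//.
apply: le_powR; [lra|exact: ltW|].
rewrite mulrCA ler_peMr ?(ltW r0)//.
by rewrite ler_pdivlMr// mul1r.
Qed.

End relative_energy_bound.

(** * Correlations against a kernel *)

Section pairing.
Variables (R : realType) (d : nat).
Local Notation mR := (measurableTypeR R).
Local Notation T := (d.-tuple mR).
Local Notation cub := (@cube R d).
Local Notation space := 'rV[R]_d.
Local Notation e := (delta_mx ord0).
Implicit Types (k f g r : space -> R) (x y : space).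

(** kpair k f g is the double integral of k y * f x * g (x - y), that is the integral of
    f times the convolution of k with g. Integrating in x first leaves the singularity of
    k in the outer integral, against a bounded function. *)
Definition corr f g y : R := tint (cst 1) (fun x => f x * g (x - y)).
Definition kpair k f g : R := tint k (corr f g).

Lemma eq_kpair k f f' g g' : f =1 f' -> g =1 g' -> kpair k f g = kpair k f' g'.
Proof. by move=> /funext -> /funext ->. Qed.

Lemma continuous_reflect f x : continuous f -> continuous (fun y => f (x - y)).
Proof.
move=> cf; have cy : continuous (fun y : space => x - y).
  move=> y; exact: (@cvgB _ _ _ _ _ (fun=> x) (fun y : space => y) x y (cvg_cst _) (@cvg_id _ (nbhs y))).
by move=> y; apply: (@continuous_comp _ _ _ (fun y : space => x - y) f); [exact: cy|exact: cf].
Qed.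

Lemma continuous_translate f y : continuous f -> continuous (fun x => f (x - y)).
Proof. exact: continuous_shift. Qed.

Lemma jmeas_prod f g : continuous f -> continuous g -> jmeas (fun x y => f x * g (x - y)).
Proof. by move=> cf cg; apply: jmeasM; [exact: jmeas1|exact: jmeasB]. Qed.

Lemma bmeas_corr f g : continuous f -> continuous g -> bmeas (corr f g).
Proof.
move=> cf cg; exact: (fubini_bmeas (weight1 R d) (jmeas_swap (jmeas_prod cf cg))).
Qed.

Lemma bmeas_conv k g : weight k -> continuous g -> bmeas (fun x => tint k (fun y => g (x - y))).
Proof. by move=> wk cg; exact: (fubini_bmeas wk (jmeasB cg)). Qed.

Lemma pair_conv k f g : weight k -> continuous f -> continuous g ->
  tint (cst 1) (fun x => f x * tint k (fun y => g (x - y))) = kpair k f g.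
Proof.
move=> wk cf cg; have jF := jmeas_prod cf cg.
rewrite /kpair /corr -(tint_fubini (weight1 R d) wk jF); apply: eq_tint => x Cx.
by rewrite tintZ//; exact: (continuous_bmeas (continuous_reflect (x := rowt x) cg)).
Qed.

Lemma pairDl k f f' g : weight k -> continuous f -> continuous f' -> continuous g ->
  kpair k (fun x => f x + f' x) g = kpair k f g + kpair k f' g.
Proof.
move=> wk cf cf' cg; rewrite /kpair -tintD//; try exact: bmeas_corr.
apply: eq_tint => y _; rewrite /corr.
rewrite -tintD; first by apply: eq_tint => x _; rewrite mulrDl.
- exact: weight1.
- by apply/continuous_bmeas/continuousM_fun => //; exact: continuous_translate.
- by apply/continuous_bmeas/continuousM_fun => //; exact: continuous_translate.
Qed.

Lemma pairZl k c f g : weight k -> continuous f -> continuous g ->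
  kpair k (fun x => c * f x) g = c * kpair k f g.
Proof.
move=> wk cf cg; rewrite /kpair -tintZ//; last exact: bmeas_corr.
apply: eq_tint => y _; rewrite /corr.
rewrite -tintZ; first by apply: eq_tint => x _; rewrite mulrA.
- exact: weight1.
- by apply/continuous_bmeas/continuousM_fun => //; exact: continuous_translate.
Qed.

Lemma pairBl k f f' g : weight k -> continuous f -> continuous f' -> continuous g ->
  kpair k (fun x => f x - f' x) g = kpair k f g - kpair k f' g.
Proof.
move=> wk cf cf' cg; have cN : continuous (fun x => -1 * f' x).
  by apply: (@continuousM_fun R _ (cst (-1)) f'); [exact: cst_continuous|].
rewrite -[X in _ = _ + X]mulN1r -(pairZl (-1) wk cf' cg) -(pairDl wk cf cN cg).
by apply: eq_kpair => // x; rewrite mulN1r.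
Qed.

Lemma pair_suml k I (s : seq I) (f : I -> space -> R) g :
  weight k -> (forall i, continuous (f i)) -> continuous g ->
  kpair k (fun x => \sum_(i <- s) f i x) g = \sum_(i <- s) kpair k (f i) g.
Proof.
move=> wk cf cg; elim: s => [|i s IHs].
  rewrite big_nil.
  have c0 : continuous (cst 0 : space -> R) by exact: cst_continuous.
  transitivity (kpair k (fun x => 0 * cst 0 x) g).
    by apply: eq_kpair => // x; rewrite big_nil mul0r.
  by rewrite (pairZl 0 wk c0 cg) mul0r.
rewrite big_cons -IHs -(pairDl wk (cf i) (continuous_sum_fun cf) cg).
by apply: eq_kpair => // x; rewrite big_cons.
Qed.

(** Reflection of y followed, for fixed y, by the translation of x by y. *)
Lemma tint_corr_swap k (P : space -> space -> R) : weight k ->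
  jmeas (fun x y => P (x - y) x) ->
  (forall y, continuous (fun x => P x (x - y))) ->
  (forall y, periodic (fun x => P x (x - y))) ->
  tint k (fun y => tint (cst 1) (fun x => P x (x - y))) =
  tint (fun y => k (- y)) (fun y => tint (cst 1) (fun x => P (x - y) x)).
Proof.
move=> wk jP cP pP.
pose H y := tint (cst 1) (fun x => P (x + y) x).
have HN : (fun y => tint (cst 1) (fun x => P (x - y) x)) = (fun y => H (- y)) by [].
have bH : bmeas H.
  have := bmeas_neg (fubini_bmeas (weight1 R d) (jmeas_swap jP)).
  by congr bmeas; apply/funext => y; congr tint; apply/funext => x; rewrite opprK.
rewrite HN (tint_neg wk bH).
apply: eq_tint => y _; rewrite -torus_integralE -(torus_integral_shift (rowt y) (cP _) (pP _)).
by rewrite torus_integralE; congr tint; apply/funext => x; rewrite addrK.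
Qed.

Lemma pair_swap k f g : weight k -> continuous f -> continuous g ->
  periodic f -> periodic g -> kpair k f g = kpair (fun y => k (- y)) g f.
Proof.
move=> wk cf cg pf pg.
have := @tint_corr_swap k (fun a b => f a * g b) wk.
rewrite /kpair /corr => ->.
- by congr tint; apply/funext => y; congr tint; apply/funext => x; rewrite mulrC.
- by apply: jmeasM; [exact: jmeasB|exact: jmeas1].
- by move=> y; apply: continuousM_fun => //; exact: continuous_translate.
- by move=> y i x; rewrite pf addrAC pg.
Qed.

Lemma torus_integral_reflect f x : continuous f -> periodic f ->
  torus_integral (fun y => f (x - y)) = torus_integral f.
Proof.
move=> cf pf; have := tint_neg (weight1 R d) (continuous_bmeas (continuous_shift (y := x) cf)).
rewrite -torus_integralE torus_integral_shift// => <-.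
by rewrite torus_integralE; apply: eq_tint => y _; rewrite addrC.
Qed.

Lemma is_derive_reflect f x y i l : is_derive (x - y) (e i) f l ->
  is_derive y (e i) (fun z => f (x - z)) (- l).
Proof.
move=> df; apply: is_derive_of_line.
have h0 : (x - y) = (x - y) + (- (0 : R)) *: e i by rewrite oppr0 scale0r addr0.
have [d1 d2] := df.
have h1 : is_derive (- (0 : R)) 1 (fun t : R => f (x - y + t *: e i)) l.
  by rewrite -d2 [X in 'D_ _ _ X]h0; apply: is_derive_line; rewrite -h0.
have := @is_derive1_comp R _ (fun t : R => - t) 0 _ _ h1 _.
have -> : (fun t : R => f (x - y + t *: e i)) \o (fun t : R => - t) =
   (fun t : R => f (x - (y + t *: e i))).
  by apply/funext => t /=; rewrite scaleNr opprD addrA.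
move=> h; have h2 : is_derive (0 : R) 1 (fun t : R => - t) (- 1).
  by apply: is_derive_eq.
by have := h _ h2; rewrite mulrN1.
Qed.

Lemma partialE f x i l : is_derive x (e i) f l -> partial i f x = l.
Proof. by move=> df; rewrite /partial derive_val. Qed.

(** Integration by parts in y: the derivative passes from g to the kernel. *)
Lemma pair_partial k dk i f g dg :
  continuous k -> continuous dk -> (forall y, is_derive y (e i) k (dk y)) ->
  (forall x, x ord0 i = 0 -> k (x + 2^-1 *: e i) = k (x - 2^-1 *: e i)) ->
  continuous f -> continuous g -> continuous dg -> periodic g ->
  (forall y, is_derive y (e i) g (dg y)) ->
  kpair k f dg = kpair dk f g.
Proof.
move=> ck cdk dkE face cf cg cdg pg dgE.
have wk := weight_continuous ck; have wdk := weight_continuous cdk.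
rewrite -!pair_conv//; congr tint; apply/funext => x; congr (_ * _).
have dphi y : is_derive y (e i) (fun z => k z * g (x - z))
    (dk y * g (x - y) - k y * dg (x - y)).
  have h1 := dkE y; have h2 := is_derive_reflect (dgE (x - y)).
  apply: is_derive_eq; rewrite /GRing.scale /=; ring.
have := @torus_integral_partial R d i (fun z => k z * g (x - z)).
have -> : partial i (fun z => k z * g (x - z)) =
    (fun y => dk y * g (x - y) - k y * dg (x - y)).
  by apply/funext => y; exact: partialE.
rewrite torus_integralE tintB.
- rewrite -!torus_integralE => h; apply/esym/eqP; rewrite -subr_eq0; apply/eqP; apply: h.
  + by move=> y; have [] := dphi y.
  + apply: continuousB_fun; apply: continuousM_fun => //; exact: continuous_reflect.
  + move=> z zi; rewrite face//; congr (_ * _).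
    rewrite -[in LHS](pg i); congr g.
    apply/rowP => j; rewrite !mxE; case: (eqVneq j i) => /= _; lra.
- exact: weight1.
- by apply/continuous_bmeas/continuousM_fun => //; exact: continuous_reflect.
- by apply/continuous_bmeas/continuousM_fun => //; exact: continuous_reflect.
Qed.

(** Integration by parts in x, the kernel being a mere parameter. *)
Lemma pair_partial_move k i f df g dg : weight k ->
  continuous f -> continuous g -> continuous df -> continuous dg ->
  periodic f -> periodic g ->
  (forall y, is_derive y (e i) f (df y)) -> (forall y, is_derive y (e i) g (dg y)) ->
  kpair k df g = - kpair k f dg.
Proof.
move=> wk cf cg cdf cdg pf pg dfE dgE.
rewrite /kpair -tintN//; last exact: bmeas_corr.
apply: eq_tint => z _; set y := rowt z; rewrite /corr.
have dphi x : is_derive x (e i) (fun x => f x * g (x - y)) (df x * g (x - y) + f x * dg (x - y)).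
  have h1 := dfE x.
  have h2 : is_derive x (e i) (fun x => g (x - y)) (dg (x - y)).
    have := dgE (x - y); have E : (fun h : R => h^-1 *: (g (h *: e i + (x - y)) - g (x - y))) =
        (fun h : R => h^-1 *: ((fun x => g (x - y)) (h *: e i + x) - (fun x => g (x - y)) x)).
      by apply/funext => h /=; rewrite addrA.
    by move=> [a b]; split; [rewrite /derivable -E|rewrite /derive -E].
  apply: is_derive_eq; rewrite /GRing.scale /=; ring.
have := @torus_integral_partial R d i (fun x => f x * g (x - y)).
have -> : partial i (fun x => f x * g (x - y)) =
    (fun x => df x * g (x - y) + f x * dg (x - y)).
  by apply/funext => x; exact: partialE.
rewrite torus_integralE tintD.
- move=> h; apply/eqP; rewrite -addr_eq0; apply/eqP; apply: h.
  + by move=> x; have [] := dphi x.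
  + by apply: continuousD_fun; apply: continuousM_fun => //; exact: continuous_translate.
  + move=> x xi; have h1 := pf i (x - 2^-1 *: e i); have h2 := pg i (x - 2^-1 *: e i - y).
    have E : x - 2^-1 *: e i + e i = x + 2^-1 *: e i.
      by apply/rowP => j; rewrite !mxE; case: (eqVneq j i) => /= _; lra.
    by rewrite -h1 -h2 [_ - y + _]addrAC E.
- exact: weight1.
- by apply/continuous_bmeas/continuousM_fun => //; exact: continuous_translate.
- by apply/continuous_bmeas/continuousM_fun => //; exact: continuous_translate.
Qed.

Lemma corr_ge0 f g y : (forall x, 0 <= f x) -> (forall x, 0 <= g x) -> 0 <= corr f g y.
Proof.
move=> f0 g0; apply: tint_ge0 => // x _.
by apply: mulr_ge0.
Qed.

End pairing.

(** * Bounds on the Riesz interaction *)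

Section riesz_bounds.
Variables (R : realType) (d : nat) (alpha : R).
Hypothesis alpha0d : 0 < alpha < d%:R.
Local Notation mR := (measurableTypeR R).
Local Notation T := (d.-tuple mR).
Local Notation cub := (@cube R d).
Local Notation space := 'rV[R]_d.
Local Notation e := (delta_mx ord0).
Local Notation K := (@riesz_kernel R d alpha).
Local Notation supk := (@supk R d alpha).
Implicit Types (k f g r v : space -> R) (s L : R) (x y : space).

Let ws : weight supk := weight_supk alpha0d.

(** The gradient kernel is odd, so that exchanging the points x and x - y changes the sign;
    averaging the two expressions leaves the difference of v. *)
Lemma kpair_dregk s i r v : 0 < s -> continuous r -> continuous v -> periodic r -> periodic v ->
  2 * kpair (dregk alpha s i) (fun x => r x * v x) r =
  tint (dregk alpha s i)
    (fun y => tint (cst 1) (fun x => r x * r (x - y) * (v x - v (x - y)))).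
Proof.
move=> s0 cr cv pr pv; set m := dregk alpha s i.
have cm : continuous m by exact: continuous_dregk.
have wm : weight m by exact: weight_continuous.
have crv : continuous (fun x => r x * v x) by exact: continuousM_fun.
have prv : periodic (fun x => r x * v x) by move=> j x; rewrite pr pv.
have sw : kpair m (fun x => r x * v x) r = - kpair m r (fun x => r x * v x).
  rewrite (pair_swap wm crv cr prv pr) /kpair -tintN//; last exact: bmeas_corr.
  rewrite /tint; congr torus_integral; apply/funext => y.
  by rewrite /m dregkN mulNr mulrN.
rewrite mulr_natl mulr2n {2}sw /kpair -tintB//; try exact: bmeas_corr.
apply: eq_tint => y _; rewrite /corr -tintB.
- by apply: eq_tint => x _; ring.
- exact: weight1.
- by apply/continuous_bmeas/continuousM_fun => //; exact: continuous_translate.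
- exact/continuous_bmeas/(continuousM_fun cr (continuous_translate (y := rowt y) crv)).
Qed.

Lemma kpair_dregk_bound s i r v L : 0 < s -> 0 <= L ->
  continuous r -> continuous v -> periodic r -> periodic v ->
  (forall x y, `|v x - v (x - y)| <= L * `|y|) ->
  `|kpair (dregk alpha s i) (fun x => r x * v x) r| <=
  L / 2 * kpair supk (fun x => `|r x|) (fun x => `|r x|).
Proof.
move=> s0 L0 cr cv pr pv vL.
have car : continuous (fun x => `|r x|) by exact: continuous_norm_fun.
have bc := bmeas_corr car car.
have cm : continuous (dregk alpha s i) by exact: continuous_dregk.
suff : 2 * `|kpair (dregk alpha s i) (fun x => r x * v x) r| <=
    L * kpair supk (fun x => `|r x|) (fun x => `|r x|) by lra.
rewrite -[X in X * _]ger0_norm// -normrM kpair_dregk//.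
have jF : jmeas (fun x y => r x * r (x - y) * (v x - v (x - y))).
  apply: jmeasM; first exact: jmeas_prod.
  have [m1 [B1 h1]] := jmeas1 cv; have [m2 [B2 h2]] := jmeasB cv.
  split; first exact: measurable_funB.
  exists (B1 + B2) => x y Cx Cy; apply: le_trans (ler_normB _ _) _.
  by apply: lerD; [exact: h1|exact: h2].
have bF : bmeas (fun y => tint (cst 1) (fun x => r x * r (x - y) * (v x - v (x - y)))).
  exact: (fubini_bmeas (weight1 R d) (jmeas_swap jF)).
rewrite /kpair -tintZ//.
have wm : weight (dregk alpha s i) by exact: weight_continuous.
apply: le_trans (le_normr_Rintegral (@measurable_cube R d) (weightM wm bF)) _.
apply: le_Rintegral => //.
- exact: measurable_cube.
- exact: (weight_norm (weightM wm bF)).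
- exact: (weightM ws (bmeasZ L bc)).
move=> y Cy; set Y := \row_i _; rewrite normrM.
have cFx : continuous (fun x => r x * r (x - Y) * (v x - v (x - Y))).
  apply: continuousM_fun; first by apply: continuousM_fun => //; exact: continuous_translate.
  by apply: continuousB_fun => //; exact: continuous_translate.
apply: (@le_trans _ _ (`|dregk alpha s i Y| * (L * `|Y| * corr (fun x => `|r x|) (fun x => `|r x|) Y))).
  apply: ler_wpM2l => //.
  apply: le_trans (ler_norm_tint (weight1 R d) (continuous_bmeas cFx)) _.
  have ccr : continuous (fun x => `|r x| * `|r (x - Y)|).
    by apply: continuousM_fun => //; exact: (continuous_translate (y := Y) car).
  rewrite /corr -tintZ; [|exact: weight1|exact: continuous_bmeas].
  have -> : (fun y : space => `|cst 1 y|) = (cst 1 : space -> R).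
    by apply/funext => ?; rewrite normr1.
  apply: le_tint => //.
  - exact: weight1.
  - exact/bmeas_norm/continuous_bmeas.
  - exact/bmeasZ/continuous_bmeas.
  move=> x Cx; rewrite !normrM mulrC; apply: ler_wpM2r; first by rewrite mulr_ge0.
  exact: vL.
rewrite [leLHS](_ : _ = (`|dregk alpha s i Y| * `|Y|) *
   (L * corr (fun x => `|r x|) (fun x => `|r x|) Y)); last by ring.
apply: ler_wpM2r; first by rewrite mulr_ge0// corr_ge0.
exact: dregk_le.
Qed.

(** The derivative of r passes to the regularised kernel; the difference of v left by
    kpair_dregk and the bound dregk_le then give an estimate that does not depend on the
    regularisation. *)
Lemma riesz_stress_bound r (dr : 'I_d -> space -> R) (v : 'I_d -> space -> R) L : 0 <= L ->
  continuous r -> periodic r ->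
  (forall i, continuous (dr i)) -> (forall i x, is_derive x (e i) r (dr i x)) ->
  (forall i, continuous (v i)) -> (forall i, periodic (v i)) ->
  (forall i x y, `|v i x - v i (x - y)| <= L * `|y|) ->
  `|\sum_i kpair K (fun x => r x * v i x) (dr i)| <=
  d%:R * (L / 2) * kpair supk (fun x => `|r x|) (fun x => `|r x|).
Proof.
move=> L0 cr pr cdr drE cv pv vL; set B := kpair supk _ _.
have one i : `|kpair K (fun x => r x * v i x) (dr i)| <= L / 2 * B.
  have crv : continuous (fun x => r x * v i x) by exact: continuousM_fun.
  have sn0 n : 0 < n.+1%:R^-1 :> R by rewrite invr_gt0.
  have cvg := tint_regk_cvg alpha0d (bmeas_corr crv (cdr i)).
  have h : `|tint (regk alpha n.+1%:R^-1) (corr (fun x => r x * v i x) (dr i))| @[n --> \oo]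
      --> `|tint K (corr (fun x => r x * v i x) (dr i))| by apply: cvg_norm; exact: cvg.
  rewrite /kpair -(cvg_lim (@Rhausdorff R) h).
  apply: limr_le; first by apply: cvgP h.
  apply: nearW => n.
  rewrite -/(kpair (regk alpha n.+1%:R^-1) (fun x => r x * v i x) (dr i)).
  have -> : kpair (regk alpha n.+1%:R^-1) (fun x => r x * v i x) (dr i) =
      kpair (dregk alpha n.+1%:R^-1 i) (fun x => r x * v i x) r.
    apply: (pair_partial (i := i)) => //.
    - exact: continuous_regk.
    - exact: continuous_dregk.
    - by move=> y; exact: is_derive_regk.
    - by move=> x xi; exact: regk_face.
  exact: kpair_dregk_bound.
apply: le_trans (ler_norm_sum _ _ _) _.
apply: (@le_trans _ _ (\sum_(i < d) (L / 2 * B))); first by apply: ler_sum => i _; exact: one.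
by rewrite sumr_const card_ord -[leLHS]mulr_natl mulrA.
Qed.

(** The kernel is split at the radius a^(-1/d), the length scale of the density a. Inside,
    the minimum is at most a and the kernel is integrated; outside, the kernel is at most
    a^(1 - alpha/d) and the mass of f is left. *)
Lemma tint_supk_min f (a M : R) : continuous f -> periodic f -> (forall x, 0 <= f x) ->
  torus_integral f <= M -> 0 < a -> forall x,
  tint supk (fun y => Num.min a (f (x - y))) <=
  (supk_const d alpha + M) * a `^ (1 - alpha / d%:R).
Proof.
move=> cf pf f0 fM a0 x.
have /andP[al0 ald] := alpha0d.
have d0 : 0 < d%:R :> R by apply: lt_trans ald.
pose rho := a `^ (- d%:R^-1).
have rho0 : 0 < rho by exact: powR_gt0.
have cfx : continuous (fun y => f (x - y)) by exact: continuous_reflect.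
have cmin : continuous (fun y => Num.min a (f (x - y))).
  by apply: continuous_min_fun => //; exact: cst_continuous.
have wt := weight_supk_trunc alpha0d rho.
have bmin := continuous_bmeas cmin; have bfx := continuous_bmeas cfx.
apply: (@le_trans _ _ (a * tint (@supk_trunc R d alpha rho) (cst 1) +
   rho `^ (alpha - d%:R) * tint (cst 1) (fun y => f (x - y)))).
  have -> : a * tint (@supk_trunc R d alpha rho) (cst 1) = tint (@supk_trunc R d alpha rho) (fun=> a * 1).
    exact/esym/(tintZ a wt (@bmeas_cst R d 1)).
  rewrite -(tintZ _ (weight1 R d) bfx).
  rewrite -RintegralD; first last.
  - exact: (weightM (weight1 R d) (bmeasZ _ bfx)).
  - exact: (weightM wt (bmeasZ a (@bmeas_cst R d 1))).
  - exact: measurable_cube.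
  apply: le_Rintegral.
  - exact: measurable_cube.
  - exact: (weightM ws bmin).
  - exact: (weightD (weightM wt (bmeasZ a (@bmeas_cst R d 1)))
                    (weightM (weight1 R d) (bmeasZ _ bfx))).
  move=> y Cy; set Y := \row_i _; rewrite /= mulr1 mul1r /supk_trunc.
  have min0 : 0 <= Num.min a (f (x - Y)) by rewrite le_min (ltW a0) f0.
  case: ifPn => [Yr|]; last rewrite -leNgt => Yr.
    apply: (@le_trans _ _ (supk Y * a)).
      by apply: ler_wpM2l; [exact: supk_ge0|rewrite ge_min lexx].
    by rewrite lerDl mulr_ge0// powR_ge0.
  rewrite mul0r add0r; apply: ler_pM => //; first exact: supk_ge0.
    by apply: le_powR_neg => //; rewrite subr_le0 ltW.
  by rewrite ge_min lexx orbT.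
rewrite -torus_integralE torus_integral_reflect// mulrDl; apply: lerD.
  apply: (@le_trans _ _ (a * (supk_const d alpha * rho `^ alpha))).
    by apply: ler_wpM2l; [exact: ltW|exact: tint_supk_trunc].
  rewrite mulrCA; apply: ler_wpM2l; first exact: supk_const_ge0.
  rewrite /rho -powRrM powRD ?powRr1 ?(ltW a0)//; last by rewrite (gt_eqF a0) implybT.
  by rewrite mulNr [_^-1 * _]mulrC.
rewrite mulrC [leRHS](_ : _ = M * rho `^ (alpha - d%:R)).
  by apply: ler_wpM2r => //; exact: powR_ge0.
rewrite /rho -powRrM; congr (_ * _ `^ _); field; exact: lt0r_neq0.
Qed.

Lemma mulr_le_min (a b : R) : 0 <= a -> 0 <= b ->
  a * b <= a * Num.min a b + b * Num.min b a.
Proof.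
move=> a0 b0; have [ab|ab] := leP a b; last have := mulr_ge0 b0 b0.
  rewrite [b * a]mulrC lerDr; exact: mulr_ge0.
by rewrite lerDl.
Qed.

(** A form of the Hardy-Littlewood-Sobolev inequality. Since
    a b <= a min(a, b) + b min(b, a), the double integral is at most twice the integral of
    f x times that of supk y * min (f x, f (x - y)) in y. Where w controls f^2 the minimum is
    estimated by f x, elsewhere by tint_supk_min. *)
Lemma riesz_self_bound f (w : space -> R) (M : R) : continuous f -> periodic f ->
  (forall x, 0 <= f x) -> torus_integral f <= M -> bmeas w ->
  (forall x, f x ^+ 2 <= w x \/ (0 < f x /\ f x `^ (2 - alpha / d%:R) <= w x)) ->
  kpair supk f f <= 2 * (supk_const d alpha + M) * torus_integral w.
Proof.
move=> cf pf f0 fM bw hw.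
have int0 : 0 <= torus_integral f by rewrite torus_integralE; exact: tint_ge0.
have M0 : 0 <= M := le_trans int0 fM.
have C0 := supk_const_ge0 alpha0d.
pose P a b := f a * Num.min (f a) (f b).
have jf1 := jmeas1 cf; have jfB := jmeasB cf.
have jP1 : jmeas (fun x y => P x (x - y)).
  by apply: jmeasM => //; exact: jmeas_min.
have jP2 : jmeas (fun x y => P (x - y) x).
  by apply: jmeasM => //; exact: jmeas_min.
have cP y : continuous (fun x => P x (x - y)).
  apply: continuousM_fun => //; apply: continuous_min_fun => //.
  exact: continuous_translate.
have cP' y : continuous (fun x => P (x - y) x).
  have cft : continuous (fun x => f (x - y)) by exact: continuous_translate.
  by apply: continuousM_fun => //; exact: continuous_min_fun.
have pP y : periodic (fun x => P x (x - y)).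
  by move=> i x; rewrite /P pf addrAC pf.
pose G1 y := tint (cst 1) (fun x => P x (x - y)).
pose G2 y := tint (cst 1) (fun x => P (x - y) x).
have bG1 : bmeas G1 by exact: (fubini_bmeas (weight1 R d) (jmeas_swap jP1)).
have bG2 : bmeas G2 by exact: (fubini_bmeas (weight1 R d) (jmeas_swap jP2)).
have sw : tint supk G1 = tint supk G2.
  rewrite /G1 (tint_corr_swap ws jP2 cP pP) /tint; congr torus_integral.
  by apply/funext => y; rewrite supkN.
apply: (@le_trans _ _ (2 * tint supk G1)).
  have -> : 2 * tint supk G1 = tint supk (fun y => G1 y + G2 y).
    by rewrite (tintD ws bG1 bG2) -sw mulr_natl mulr2n.
  apply: le_tint; [exact: ws|..].
  - by move=> y; exact: supk_ge0.
  - exact: bmeas_corr.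
  - exact: bmeasD.
  move=> y Cy; rewrite /corr /G1 /G2 -tintD; [|exact: weight1|exact: continuous_bmeas..].
  apply: le_tint; [exact: weight1|by move=> ?; exact: ler01|..].
  - exact/continuous_bmeas/(continuousM_fun cf (continuous_translate (y := rowt y) cf)).
  - exact: (bmeasD (continuous_bmeas (cP _)) (continuous_bmeas (cP' _))).
  by move=> x _; exact: mulr_le_min.
rewrite -[leRHS]mulrA; apply: ler_wpM2l => //.
rewrite /G1 -(tint_fubini (weight1 R d) ws jP1) torus_integralE -tintZ//; last exact: weight1.
have wpos x : 0 <= w x.
  by case: (hw x) => [|[_]]; apply: le_trans; [exact: sqr_ge0|exact: powR_ge0].
apply: le_tint; [exact: weight1|by move=> ?; exact: ler01|..].
- exact: (fubini_bmeas ws jP1).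
- exact: bmeasZ.
move=> x Cx; set X := rowt x.
have cfX : continuous (fun y => f (X - y)) by exact: continuous_reflect.
have cmin : continuous (fun y => Num.min (f X) (f (X - y))).
  by apply: continuous_min_fun => //; exact: cst_continuous.
have -> : tint supk (fun y => P X (X - y)) =
    f X * tint supk (fun y => Num.min (f X) (f (X - y))).
  exact: (tintZ (f X) ws (continuous_bmeas cmin)).
case: (hw X) => [h2|[fX0 hq]].
  apply: (@le_trans _ _ (f X * (supk_const d alpha * f X))).
    apply: ler_wpM2l => //.
    apply: (@le_trans _ _ (f X * tint supk (cst 1))).
      rewrite -(tintZ (f X) ws (@bmeas_cst R d 1)).
      apply: le_tint; [exact: ws|by move=> y; exact: supk_ge0|..].
      + exact: continuous_bmeas.
      + by apply: bmeasZ; exact: bmeas_cst.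
      by move=> y _ /=; rewrite mulr1 ge_min lexx.
    rewrite mulrC; apply: ler_wpM2r => //.
    have := tint_supk_trunc alpha0d ltr01; rewrite powR1 mulr1; apply: le_trans.
    rewrite le_eqVlt; apply/orP; left; apply/eqP; apply: eq_Rintegral => y /set_mem Cy.
    by rewrite /supk_trunc cube_norm_lt1.
  rewrite mulrCA -expr2; apply: ler_pM => //; first exact: sqr_ge0.
  by rewrite lerDl.
have := tint_supk_min cf pf f0 fM fX0 X => h.
apply: (@le_trans _ _ (f X * ((supk_const d alpha + M) * f X `^ (1 - alpha / d%:R)))).
  exact: ler_wpM2l.
rewrite mulrCA; apply: ler_wpM2l; first exact: addr_ge0.
apply: le_trans hq; rewrite -{1}(@powRr1 _ (f X))// -powRD; last first.
  by rewrite (gt_eqF fX0) implybT.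
by rewrite addrA.
Qed.

End riesz_bounds.

(** * Differentiable fields on space-time *)

Lemma near_continuous (X : topologicalType) (R : realType) (f g : X -> R) p :
  (\forall q \near p, f q = g q) -> {for p, continuous f} -> {for p, continuous g}.
Proof.
move=> E cf; have : g @ p --> g p; last by [].
rewrite -(nbhs_singleton E).
by apply: cvg_trans cf; apply: near_eq_cvg; apply: filterS E => q ->.
Qed.

Section fields.
Variables (R : realType) (d : nat) (T : R).
Local Notation space := 'rV[R]_d.
Local Notation e := (delta_mx ord0).
Local Notation spacetime := (R^o * space)%type.

Definition slab : set spacetime := [set p | 0 <= p.1 < T].

(** C^1 regularity up to t = 0, through an extension to an open neighbourhood. *)
Definition C1slab (f : R -> space -> R) := exists (U : set spacetime) (F : spacetime -> R),
  [/\ open U, slab `<=` U,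
      (forall p, U p -> {for p, continuous F}),
      (forall v p, U p -> derivable F p v /\ {for p, continuous (fun q => 'D_v F q)})
    & forall p, slab p -> f p.1 p.2 = F p].

Lemma smooth_on_C1slab (f : R -> space -> R) :
  smooth_on slab (fun p : spacetime => f p.1 p.2 : R^o) -> C1slab f.
Proof.
move=> [U [F [oU AU CF fF]]]; exists U, F; split=> //.
- exact: (CF 0%N).
- move=> v p Up; have [dF cF] := CF 1%N; split; first exact/diff_derivable/dF.
  exact: (cF v).
- by move=> p Ap; apply: fF; exact/mem_set.
Qed.

Lemma is_derive_component (V : normedModType R) (F : V -> space) p v (i : 'I_d) :
  derivable F p v -> is_derive p v (fun q => F q ord0 i : R) ('D_v F p ord0 i).
Proof.
move=> dF; have h : (fun h : R => h^-1 *: (F (h *: v + p) - F p)) @ 0^' --> 'D_v F p by exact: dF.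
have h' : (fun h : R => h^-1 *: ((F (h *: v + p) ord0 i : R) - F p ord0 i)) @ 0^' -->
    'D_v F p ord0 i.
  have E : (fun h : R => h^-1 *: ((F (h *: v + p) ord0 i : R) - F p ord0 i)) =
      (fun M : space => M ord0 i) \o (fun h : R => h^-1 *: (F (h *: v + p) - F p)).
    by apply/funext => z /=; rewrite !mxE.
  by rewrite E; apply: (cvg_comp _ _ h); exact: continuous_coord.
by split; [apply/cvg_ex; eexists; exact: h'|exact/cvg_lim].
Qed.

Lemma smooth_on_component (u : R -> space -> space) (i : 'I_d) :
  smooth_on slab (fun p : spacetime => u p.1 p.2) -> C1slab (fun t x => u t x ord0 i).
Proof.
move=> [U [F [oU AU CF fF]]]; exists U, (fun p => F p ord0 i); split=> //.
- move=> p Up; apply: (@continuous_comp _ _ _ F (fun M : space => M ord0 i)).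
    exact: (CF 0%N).
  exact: continuous_coord.
- move=> v p Up; have [dF cF] := CF 1%N.
  have dc q : U q -> is_derive q v (fun q => F q ord0 i : R) ('D_v F q ord0 i).
    by move=> Uq; apply: is_derive_component; exact/diff_derivable/dF.
  split; first by have [] := dc p Up.
  have c1 : {for p, continuous (fun q => 'D_v F q ord0 i)}.
    apply: (@continuous_comp _ _ _ (fun q => 'D_v F q) (fun M : space => M ord0 i)).
      exact: (cF v).
    exact: continuous_coord.
  have E : \forall q \near p, 'D_v F q ord0 i = 'D_v (fun q => F q ord0 i : R) q.
    have Un : nbhs p U by exact: open_nbhs_nbhs.
    by apply: filterS Un => q Uq; have [_ ->] := dc q Uq.
  exact: near_continuous E c1.
- by move=> p Ap; rewrite (fF p (mem_set Ap)).
Qed.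

(** What differentiation under the integral sign uses: bounds that are uniform on compact
    subintervals of [0, T), and continuity at t = 0, where the equations say nothing. The
    ball |x| <= 1 contains both the cube and the differences of its points. *)
Record tfield (f ft : R -> space -> R) : Prop := Tfield {
  tf_cont : forall t, 0 <= t < T -> continuous (f t);
  tf_dcont : forall t, 0 < t < T -> continuous (ft t);
  tf_der : forall t x, 0 < t < T -> is_derive t 1 (fun s => f s x) (ft t x);
  tf_bnd : forall b, 0 < b < T -> exists B, forall t x, 0 <= t <= b -> `|x| <= 1 -> `|f t x| <= B;
  tf_dbnd : forall b, 0 < b < T -> exists B, forall t x, 0 < t <= b -> `|x| <= 1 -> `|ft t x| <= B;
  tf_zero : 0 < T -> forall x, f s x @[s --> 0^'+] --> f 0 x
}.

Record xfield (f : space -> R) (fx : 'I_d -> space -> R) : Prop := Xfield {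
  xf_cont : continuous f;
  xf_dcont : forall i, continuous (fx i);
  xf_der : forall i x, is_derive x (e i) f (fx i x)
}.

Let box : set space := [set v | forall i, v ord0 i \in `[- 1, 1]].

Let compact_box : compact box.
Proof. by apply: (@rV_compact R d (fun=> `[- 1, 1]%classic)) => i; exact: segment_compact. Qed.

Lemma slab_compact_bounded (F : spacetime -> R) b : 0 < b < T ->
  (forall p, slab p -> {for p, continuous F}) ->
  exists B, forall t x, 0 <= t <= b -> `|x| <= 1 -> `|F (t, x)| <= B.
Proof.
move=> /andP[b0 bT] cF.
pose Q : set spacetime := (`[0, b]%classic : set R^o) `*` box.
have cQ : compact Q by apply: compact_setX => //; exact: segment_compact.
have QA : Q `<=` slab by move=> [t x] [/= ]; rewrite in_itv/= => /andP[t0 tb] _; rewrite /slab /= t0 (le_lt_trans tb).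
have /compact_bounded [M [_ hM]] : compact (F @` Q).
  apply: continuous_compact => //; apply: continuous_in_subspaceT => p /set_mem Qp.
  exact/cF/QA.
exists (M + 1) => t x tb x1; apply: hM; first by rewrite ltrDl.
exists (t, x) => //; split; first by rewrite /= in_itv.
move=> i; rewrite in_itv/= -ler_norml.
by apply: le_trans x1; exact: coord_le_norm.
Qed.

Lemma continuous_pairl (F : spacetime -> R) t x : {for (t, x), continuous F} ->
  {for x, continuous (fun z => F (t, z))}.
Proof.
move=> cF; apply: (@continuous_comp _ _ _ (fun z : space => (t, z) : spacetime) F) => //.
exact: (cvg_pair (cvg_cst (t : R^o)) (@cvg_id _ (nbhs x))).
Qed.

Lemma continuous_pairr (F : spacetime -> R) (t : R^o) x : {for (t, x), continuous F} ->
  {for t, continuous (fun s : R^o => F (s, x))}.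
Proof.
move=> cF; apply: (@continuous_comp _ _ _ (fun s : R^o => (s, x) : spacetime) F) => //.
exact: (cvg_pair (@cvg_id _ (nbhs t)) (cvg_cst (x : space))).
Qed.

Lemma C1slab_fields f : C1slab f -> exists ft fx,
  [/\ tfield f ft, forall t, 0 <= t < T -> xfield (f t) (fun i => fx i t) &
      forall i p, slab p -> exists2 G : spacetime -> R, {for p, continuous G} &
        forall q, slab q -> G q = fx i q.1 q.2].
Proof.
move=> [U [F [oU AU cF dF fF]]].
exists (fun t x => 'D_((1 : R^o), (0 : space)) F (t, x)), (fun i t x => 'D_((0 : R^o), (e i : space)) F (t, x)).
have fE t : 0 <= t < T -> f t = (fun x => F (t, x)).
  by move=> tT; apply/funext => x; exact: (fF (t, x)).
split.
- split.
  + move=> t tT; rewrite fE// => x; apply: continuous_pairl; exact/cF/AU.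
  + move=> t /andP[t0 tT] x; apply: (@continuous_pairl (fun p => 'D_(1, 0) F p)).
    by apply: (dF _ _ _).2; apply: AU; rewrite /slab /= (ltW t0).
  + move=> t x /andP[t0 tT].
    have Up : U (t, x) by apply: AU; rewrite /slab /= (ltW t0).
    have [dFp _] := dF (1, 0) _ Up.
    have dd : is_derive t 1 (fun s : R => F (s, x)) ('D_(1, 0) F (t, x)).
      have E : (fun h : R => h^-1 *: (F (h *: ((1 : R^o), (0 : space)) + (t, x)) - F (t, x))) =
          (fun h : R => h^-1 *: ((fun s : R => F (s, x)) (h *: (1 : R) + t) - (fun s : R => F (s, x)) t)).
        apply/funext => h /=; congr (_ *: (F _ - _)).
        by congr pair => /=; rewrite scaler0 add0r.
      by split; [rewrite /derivable -E|rewrite /derive -E].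
    have nE : \forall s \near t, F (s, x) = f s x.
      near=> s; rewrite fE//; apply/andP; split.
        by apply: ltW; near: s; exact: lt_nbhsr.
      by near: s; exact: lt_nbhsl.
    have nE' : \forall s \near t, f s x = F (s, x) by apply: filterS nE => s ->.
    have [d1 d2] := dd.
    split; first by apply: (near_eq_derivable nE).
    by rewrite (near_eq_derive _ nE').
  + move=> b bT; have [B hB] := @slab_compact_bounded F b bT (fun p Ap => cF p (AU _ Ap)).
    exists B => t x tb x1; rewrite fE; first exact: hB.
    by move: tb bT => /andP[-> tb] /andP[_ bT]; rewrite (le_lt_trans tb).
  + move=> b bT; have [B hB] := @slab_compact_bounded (fun p => 'D_(1, 0) F p) b bT
      (fun p Ap => (dF _ _ (AU _ Ap)).2).
    by exists B => t x /andP[t0 tb] x1; apply: hB => //; rewrite (ltW t0).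
  + move=> T0 x; rewrite fE ?lexx//.
    have c0 : {for (0 : R^o), continuous (fun s : R^o => F (s, x))}.
      by apply: continuous_pairr; apply: cF; apply: AU; rewrite /slab /= lexx.
    apply: (@cvg_trans _ ((fun s : R => F (s, x)) @ 0^'+)).
      apply: near_eq_cvg; near=> s; rewrite fE//; apply/andP; split.
        by apply: ltW; near: s; exact: nbhs_right_gt.
      by near: s; exact: nbhs_right_lt.
    exact: cvg_at_right_filter.
- move=> t tT; have Up x : U (t, x) by exact: AU.
  split.
  + by rewrite fE// => x; apply: continuous_pairl; exact/cF.
  + by move=> i x; apply: (@continuous_pairl (fun p => 'D_(0, e i) F p)); exact: (dF _ _ _).2.
  + move=> i x; rewrite fE//; have [dFp _] := dF (0, e i) _ (Up x).
    have E : (fun h : R => h^-1 *: (F (h *: ((0 : R^o), (e i : space)) + (t, x)) - F (t, x))) =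
        (fun h : R => h^-1 *: ((fun z => F (t, z)) (h *: (e i : space) + x) - (fun z => F (t, z)) x)).
      apply/funext => h /=; congr (_ *: (F _ - _)).
      by congr pair => /=; rewrite scaler0 add0r.
    by split; [rewrite /derivable -E|rewrite /derive -E].
- move=> i p Ap; exists (fun q => 'D_(0, e i) F q); first exact: (dF _ _ (AU _ Ap)).2.
  by move=> [t x].
Unshelve. all: by end_near. Qed.

End fields.

Section field_algebra.
Variables (R : realType) (d : nat) (T : R).
Local Notation space := 'rV[R]_d.
Local Notation e := (delta_mx ord0).
Local Notation tfield := (@tfield R d T).
Local Notation xfield := (@xfield R d).
Implicit Types (f ft g gt : R -> space -> R) (t s b c B : R) (x : space).

Lemma xfield_cst c : xfield (fun=> c) (fun _ _ => 0).
Proof. by split => [|i|i x]; [exact: cst_continuous|exact: cst_continuous|exact: is_derive_cst]. Qed.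

Lemma xfieldD (f g : space -> R) fx gx : xfield f fx -> xfield g gx ->
  xfield (fun x => f x + g x) (fun i x => fx i x + gx i x).
Proof.
move=> [cf cfx df] [cg cgx dg]; split.
- exact: continuousD_fun.
- by move=> i; exact: continuousD_fun.
- by move=> i x; have h1 := df i x; have h2 := dg i x; exact: is_deriveD.
Qed.

Lemma xfieldB (f g : space -> R) fx gx : xfield f fx -> xfield g gx ->
  xfield (fun x => f x - g x) (fun i x => fx i x - gx i x).
Proof.
move=> [cf cfx df] [cg cgx dg]; split.
- exact: continuousB_fun.
- by move=> i; exact: continuousB_fun.
- by move=> i x; have h1 := df i x; have h2 := dg i x; exact: is_deriveB.
Qed.

Lemma xfieldM (f g : space -> R) fx gx : xfield f fx -> xfield g gx ->
  xfield (fun x => f x * g x) (fun i x => fx i x * g x + f x * gx i x).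
Proof.
move=> [cf cfx df] [cg cgx dg]; split.
- exact: continuousM_fun.
- by move=> i; apply: continuousD_fun; exact: continuousM_fun.
- move=> i x; have h1 := df i x; have h2 := dg i x.
  apply: is_derive_eq; rewrite /GRing.scale /=; ring.
Qed.

Lemma xfieldZ c (f : space -> R) fx : xfield f fx ->
  xfield (fun x => c * f x) (fun i x => c * fx i x).
Proof.
move=> hf; have := xfieldM (xfield_cst c) hf.
congr xfield; apply/funext => i; apply/funext => x.
by rewrite mul0r add0r.
Qed.

Lemma xfield_sum (f : 'I_d -> space -> R) fx : (forall k, xfield (f k) (fx k)) ->
  xfield (fun x => \sum_k f k x) (fun i x => \sum_k fx k i x).
Proof.
move=> hf; elim: (index_enum _) => [|k l IHl].
  have := xfield_cst 0; congr xfield; [|apply/funext => i]; apply/funext => x;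
  by rewrite big_nil.
have := xfieldD (hf k) IHl.
by congr xfield; [|apply/funext => i]; apply/funext => x; rewrite big_cons.
Qed.

Lemma is_derive_chain (f : space -> R) (g : R -> R) x (v : space) l m :
  is_derive x v f l -> is_derive (f x) 1 g m -> is_derive x v (fun x => g (f x)) (m * l).
Proof.
move=> df dg; apply: is_derive_of_line.
have h : is_derive (0 : R) 1 (fun t : R => f (x + t *: v)) l.
  have [d1 d2] := df.
  have E : x = x + (0 : R) *: v by rewrite scale0r addr0.
  by rewrite -d2 [X in 'D_ _ _ X]E; apply: is_derive_line; rewrite -E.
apply: (@is_derive1_comp R g (fun t : R => f (x + t *: v)) 0) => //.
by rewrite scale0r addr0.
Qed.

Lemma is_derive1_continuous (g : R -> R) s m : is_derive s 1 g m -> {for s, continuous g}.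
Proof.
by move=> [dg _]; apply: differentiable_continuous; exact/derivable1_diffP.
Qed.

Lemma xfield_comp (A : set R) (g g' : R -> R) (f : space -> R) fx : xfield f fx ->
  (forall s, A s -> is_derive s 1 g (g' s)) -> (forall s, A s -> {for s, continuous g'}) ->
  (forall x, A (f x)) ->
  xfield (fun x => g (f x)) (fun i x => g' (f x) * fx i x).
Proof.
move=> [cf cfx df] dg cg' Af; split.
- move=> x; apply: continuous_comp; [exact: cf|exact: is_derive1_continuous (dg _ (Af x))].
- move=> i; apply: continuousM_fun => // x.
  by apply: continuous_comp; [exact: cf|exact: cg'].
- by move=> i x; exact: is_derive_chain (df i x) (dg _ (Af x)).
Qed.

Lemma tfield_cst c : tfield (fun _ _ => c) (fun _ _ => 0).
Proof.
split.
- by move=> t _; exact: cst_continuous.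
- by move=> t _; exact: cst_continuous.
- by move=> t x _; exact: is_derive_cst.
- by move=> b _; exists `|c|.
- by move=> b _; exists 0 => *; rewrite normr0.
- by move=> _ x; exact: cvg_cst.
Qed.

Lemma tfieldD f ft g gt : tfield f ft -> tfield g gt ->
  tfield (fun t x => f t x + g t x) (fun t x => ft t x + gt t x).
Proof.
move=> [cf cft df bf bft zf] [cg cgt dg bg bgt zg]; split.
- by move=> t tT; apply: continuousD_fun; [exact: cf|exact: cg].
- by move=> t tT; apply: continuousD_fun; [exact: cft|exact: cgt].
- by move=> t x tT; have h1 := df t x tT; have h2 := dg t x tT; exact: is_deriveD.
- move=> b bT; have [B hB] := bf b bT; have [C hC] := bg b bT; exists (B + C) => t x tb x1.
  by apply: le_trans (ler_normD _ _) _; apply: lerD; [exact: hB|exact: hC].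
- move=> b bT; have [B hB] := bft b bT; have [C hC] := bgt b bT; exists (B + C) => t x tb x1.
  by apply: le_trans (ler_normD _ _) _; apply: lerD; [exact: hB|exact: hC].
- by move=> T0 x; apply: cvgD; [exact: zf|exact: zg].
Qed.

Lemma tfieldM f ft g gt : tfield f ft -> tfield g gt ->
  tfield (fun t x => f t x * g t x) (fun t x => ft t x * g t x + f t x * gt t x).
Proof.
move=> [cf cft df bf bft zf] [cg cgt dg bg bgt zg]; split.
- by move=> t tT; apply: continuousM_fun; [exact: cf|exact: cg].
- move=> t tT; have tT' : 0 <= t < T by case/andP: tT => [/ltW -> ->].
  by apply: continuousD_fun; apply: continuousM_fun;
    [exact: cft|exact: cg|exact: cf|exact: cgt].
- move=> t x tT; have h1 := df t x tT; have h2 := dg t x tT.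
  apply: is_derive_eq; rewrite /GRing.scale /=; ring.
- move=> b bT; have [B hB] := bf b bT; have [C hC] := bg b bT; exists (B * C) => t x tb x1.
  by rewrite normrM; apply: ler_pM => //; [exact: hB|exact: hC].
- move=> b bT; have [B hB] := bf b bT; have [C hC] := bg b bT.
  have [B' hB'] := bft b bT; have [C' hC'] := bgt b bT; exists (B' * C + B * C') => t x tb x1.
  have tb' : 0 <= t <= b by case/andP: tb => [/ltW -> ->].
  apply: le_trans (ler_normD _ _) _; rewrite !normrM; apply: lerD; apply: ler_pM => //;
    [exact: hB'|exact: hC|exact: hB|exact: hC'].
- by move=> T0 x; apply: cvgM; [exact: zf|exact: zg].
Qed.

Lemma tfieldZ c f ft : tfield f ft -> tfield (fun t x => c * f t x) (fun t x => c * ft t x).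
Proof.
move=> hf; have := tfieldM (tfield_cst c) hf.
by congr tfield; apply/funext => t; apply/funext => x; rewrite mul0r add0r.
Qed.

Lemma tfieldB f ft g gt : tfield f ft -> tfield g gt ->
  tfield (fun t x => f t x - g t x) (fun t x => ft t x - gt t x).
Proof.
move=> hf hg; have := tfieldD hf (tfieldZ (-1) hg).
by congr tfield; apply/funext => t; apply/funext => x; rewrite mulN1r.
Qed.

Lemma tfield_sum (f ft : 'I_d -> R -> space -> R) : (forall k, tfield (f k) (ft k)) ->
  tfield (fun t x => \sum_k f k t x) (fun t x => \sum_k ft k t x).
Proof.
move=> hf; elim: (index_enum _) => [|k l IHl].
  have := tfield_cst 0; congr tfield; apply/funext => t; apply/funext => x; by rewrite big_nil.
have := tfieldD (hf k) IHl.
by congr tfield; apply/funext => t; apply/funext => x; rewrite big_cons.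
Qed.

Lemma tfield_comp (A : set R) (g g' : R -> R) f ft : tfield f ft ->
  (forall s, A s -> is_derive s 1 g (g' s)) -> (forall s, A s -> {for s, continuous g'}) ->
  (forall B, exists C, forall s, A s -> `|s| <= B -> `|g s| <= C /\ `|g' s| <= C) ->
  (forall t x, 0 <= t < T -> A (f t x)) ->
  tfield (fun t x => g (f t x)) (fun t x => g' (f t x) * ft t x).
Proof.
move=> [cf cft df bf bft zf] dg cg' bg Af; split.
- move=> t tT x; apply: continuous_comp; first exact: cf.
  exact: is_derive1_continuous (dg _ (Af t x tT)).
- move=> t tT; have tT' : 0 <= t < T by case/andP: tT => [/ltW -> ->].
  apply: continuousM_fun; last exact: cft.
  by move=> x; apply: continuous_comp; [exact: cf|apply: cg'; exact: Af].
- move=> t x tT; have tT' : 0 <= t < T by case/andP: tT => [/ltW -> ->].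
  exact: (@is_derive1_comp R g (fun s => f s x) t _ _ (dg _ (Af t x tT')) (df t x tT)).
- move=> b bT; have [B hB] := bf b bT; have [C hC] := bg B; exists C => t x tb x1.
  apply: (hC _ _ (hB t x tb x1)).1; apply: Af.
  by case/andP: tb => [-> tb]; case/andP: bT => [_ bT]; rewrite (le_lt_trans tb).
- move=> b bT; have [B hB] := bf b bT; have [C hC] := bg B; have [B' hB'] := bft b bT.
  exists (C * B') => t x tb x1; rewrite normrM; apply: ler_pM => //; last exact: hB'.
  have tb' : 0 <= t <= b by case/andP: tb => [/ltW -> ->].
  apply: (hC _ _ (hB t x tb' x1)).2; apply: Af.
  by case/andP: tb' => [-> tb']; case/andP: bT => [_ bT]; rewrite (le_lt_trans tb').
- move=> T0 x; apply: continuous_cvg; last exact: zf.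
  by apply: is_derive1_continuous; apply: dg; apply: Af; rewrite lexx.
Qed.

End field_algebra.

(** * Time derivatives of torus integrals *)

Section time_integrals.
Variables (R : realType) (d : nat) (T : R).
Local Notation mR := (measurableTypeR R).
Local Notation tup := (d.-tuple mR).
Local Notation mu := (lebesgue_tuple R d).
Local Notation cub := (@cube R d).
Local Notation space := 'rV[R]_d.
Local Notation tfield := (@tfield R d T).
Implicit Types (f ft g gt : R -> space -> R) (t s b c B : R) (x : space).

(** The weaker regularity in time that correlations of fields have. *)
Record mfield (f ft : R -> space -> R) : Prop := Mfield {
  mf_bmeas : forall t, 0 <= t < T -> bmeas (f t);
  mf_der : forall t y, 0 < t < T -> cub y ->
    is_derive t 1 (fun s => f s (rowt y)) (ft t (rowt y));
  mf_dbnd : forall b, 0 < b < T -> exists B, forall t y, 0 < t <= b -> cub y ->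
    `|ft t (rowt y)| <= B;
  mf_zero : 0 < T -> forall y, cub y -> f s (rowt y) @[s --> 0^'+] --> f 0 (rowt y)
}.

Lemma tfield_mfield f ft : tfield f ft -> mfield f ft.
Proof.
move=> [cf cft df bf bft zf]; split.
- by move=> t tT; apply: continuous_bmeas; exact: cf.
- by move=> t y tT _; exact: df.
- move=> b bT; have [B hB] := bft b bT; exists B => t y tb Cy; apply: hB => //.
  by apply: ltW; exact: cube_norm_lt1.
- by move=> T0 y _; exact: zf.
Qed.

Lemma tint_derive k f ft : weight k -> mfield f ft -> forall t, 0 < t < T ->
  is_derive t 1 (fun s => tint k (f s)) (tint k (ft t)).
Proof.
move=> wk [bf df bft _] t /andP[t0 tT].
pose u : R := t / 2; pose v : R := (t + T) / 2.
have uv s : s \in `]u, v[ -> 0 < s <= v by rewrite in_itv/= /u /v; lra.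
have vT : 0 < v < T by rewrite /v; lra.
have [B hB] := bft v vT.
have sT s : s \in `]u, v[ -> 0 < s < T by move=> /uv; lra.
have sT' s : s \in `]u, v[ -> 0 <= s < T by move=> /uv; lra.
have It : (`]u, v[%classic : set R) t by rewrite /= in_itv/= /u /v; lra.
pose F s (y : tup) := k (rowt y) * f s (rowt y).
have dF s y : (`]u, v[%classic : set R) s -> cub y ->
    is_derive s 1 (F ^~ y) (k (rowt y) * ft s (rowt y)).
  move=> Is Cy; have h := df s y (sT _ Is) Cy.
  rewrite /F; apply: is_derive_eq; rewrite /GRing.scale /=; ring.
have mC := @measurable_cube R d.
have iF s : (`]u, v[%classic : set R) s -> mu.-integrable cub (EFin \o F s).
  by move=> Is; exact: (weightM wk (bf _ (sT' _ Is))).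
have derF s y : (`]u, v[%classic : set R) s -> cub y -> derivable (F ^~ y) s 1.
  by move=> Is Cy; have [] := dF s y Is Cy.
have iG : mu.-integrable cub (EFin \o (fun y : tup => `|k (rowt y)| * `|B|)).
  exact: (weightM (weight_norm wk) (@bmeas_cst R d `|B|)).
have G0 y : 0 <= `|k (rowt y)| * `|B| :> R by rewrite mulr_ge0.
have Gub s y : (`]u, v[%classic : set R) s -> cub y ->
    `|partial1of2 F s y| <= `|k (rowt y)| * `|B|.
  move=> Is Cy; have [_ E] := dF s y Is Cy.
  rewrite partial1of2E E normrM ler_wpM2l//.
  by apply: le_trans (hB s y (uv _ Is) Cy) _; exact: ler_norm.
have h1 := @derivable_under_integral R _ _ mu F cub mC t u v It iF derF _ G0 iG Gub.
have h2 := @differentiation_under_integral R _ _ mu F cub mC t u v It iF derF _ G0 iG Gub.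
split; first exact: h1.
rewrite -derive1E [LHS]h2 /tint /torus_integral; apply: eq_Rintegral => y /set_mem Cy.
by have [_ E] := dF t y It Cy; rewrite partial1of2E E.
Qed.

Lemma mfield_lipschitz f ft b : mfield f ft -> 0 < b < T ->
  exists2 B, 0 <= B & forall s y, 0 < s <= b -> cub y ->
    `|f s (rowt y) - f 0 (rowt y)| <= B * s.
Proof.
move=> [bf df bft zf] bT; have T0 : 0 < T by lra.
have [B hB] := bft b bT; exists `|B| => // s y /andP[s0 sb] Cy.
have dfs r : 0 < r < T -> is_derive r 1 (fun s => f s (rowt y)) (ft r (rowt y)).
  by move=> rT; exact: df.
have cr r : 0 < r < T -> {for r, continuous (fun s => f s (rowt y))}.
  by move=> rT; exact: is_derive1_continuous (dfs _ rT).
have [||c] := @MVT R (fun s => f s (rowt y)) (fun r => ft r (rowt y)) 0 s s0.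
- by move=> r /[!in_itv]/= /andP[r0 rs]; apply: dfs; lra.
- apply/(continuous_within_itvP _ s0); split.
  + by move=> r /[!in_itv]/= /andP[r0 rs]; apply: cr; lra.
  + exact: zf.
  + by apply: cvg_at_left_filter; apply: cr; lra.
move=> /[!in_itv]/= /andP[c0 cs] ->; rewrite subr0 normrM (gtr0_norm s0).
apply: ler_wpM2r; first exact: ltW.
by apply: le_trans (ler_norm B); apply: hB => //; lra.
Qed.

Lemma tint_cvg0 k f ft : weight k -> mfield f ft -> 0 < T ->
  tint k (f s) @[s --> 0^'+] --> tint k (f 0).
Proof.
move=> wk hf T0; have b0 : 0 < T / 2 < T by lra.
have [B B0 hB] := mfield_lipschitz hf b0.
pose I := tint (fun y => `|k y|) (cst 1).
have I0 : 0 <= I by apply: tint_ge0.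
apply/cvgrPdist_le => eps eps0.
have BI : 0 < B * I + 1 by rewrite ltr_wpDl// mulr_ge0.
have q0 : 0 < eps / (B * I + 1) by rewrite divr_gt0.
near=> s.
have s0 : 0 < s by near: s; exact: nbhs_right_gt.
have sb : s <= T / 2 by near: s; apply: nbhs_right_le; lra.
have bs : bmeas (f s) by apply: (mf_bmeas hf); lra.
have bz : bmeas (f 0) by apply: (mf_bmeas hf); lra.
rewrite distrC -(tintB wk bs bz).
apply: (@le_trans _ _ (B * s * I)).
  apply: tint_bound => //; first exact: bmeasB.
  by move=> y Cy; apply: hB => //; rewrite s0.
have : s <= eps / (B * I + 1) by near: s; exact: nbhs_right_le.
rewrite ler_pdivlMr// => h; apply: le_trans h.
by rewrite mulrAC mulrC ler_wpM2l ?(ltW s0)// lerDl.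
Unshelve. all: by end_near. Qed.

(** For fixed y a correlation is itself a torus integral that depends on time. *)
Lemma corr_mfield f ft g gt : tfield f ft -> tfield g gt ->
  mfield (fun t => corr (f t) (g t)) (fun t y => corr (ft t) (g t) y + corr (f t) (gt t) y).
Proof.
move=> hf hg.
have [cf cft df bf bft zf] := hf; have [cg cgt dg bg bgt zg] := hg.
have fixed y : cub y -> mfield (fun t x => f t x * g t (x - rowt y))
    (fun t x => ft t x * g t (x - rowt y) + f t x * gt t (x - rowt y)).
  move=> Cy; have ny (x : tup) : cub x -> `|rowt x - rowt y| <= 1.
    move=> Cx; apply: norm_le_coord => // i; rewrite !mxE ler_norml.
    by have := Cx i; have := Cy i; lra.
  have nx (x : tup) : cub x -> `|rowt x| <= 1 by move=> /cube_norm_lt1/ltW.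
  split.
  - move=> t tT; apply: continuous_bmeas; apply: continuousM_fun; first exact: cf.
    by apply: continuous_translate; exact: cg.
  - move=> t x tT Cx; have h1 := df t (rowt x) tT; have h2 := dg t (rowt x - rowt y) tT.
    apply: is_derive_eq; rewrite /GRing.scale /=; ring.
  - move=> b bT; have [B hB] := bf b bT; have [C hC] := bg b bT.
    have [B' hB'] := bft b bT; have [C' hC'] := bgt b bT; exists (B' * C + B * C') => t x tb Cx.
    have tb' : 0 <= t <= b by case/andP: tb => [/ltW -> ->].
    apply: le_trans (ler_normD _ _) _; rewrite !normrM; apply: lerD; apply: ler_pM => //.
    + by apply: hB' => //; exact: nx.
    + by apply: hC => //; exact: ny.
    + by apply: hB => //; exact: nx.
    + by apply: hC' => //; exact: ny.
  - by move=> T0 x Cx; apply: cvgM; [exact: zf|exact: zg].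
have split_int t y : 0 < t < T ->
    tint (cst 1) (fun x => ft t x * g t (x - y) + f t x * gt t (x - y)) =
    corr (ft t) (g t) y + corr (f t) (gt t) y.
  move=> tT; have tT' : 0 <= t < T by case/andP: tT => [/ltW -> ->].
  rewrite /corr -tintD//; first exact: weight1.
    apply/continuous_bmeas/continuousM_fun; first exact: cft.
    by apply: continuous_translate; exact: cg.
  apply/continuous_bmeas/continuousM_fun; first exact: cf.
  by apply: continuous_translate; exact: cgt.
split.
- by move=> t tT; apply: bmeas_corr; [exact: cf|exact: cg].
- move=> t y tT Cy; rewrite -split_int//.
  exact: (tint_derive (weight1 R d) (fixed y Cy)).
- move=> b bT; have [B hB] := bf b bT; have [C hC] := bg b bT.
  have [B' hB'] := bft b bT; have [C' hC'] := bgt b bT.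
  exists ((B' * C + B * C') * tint (fun y : space => `|cst (1 : R) y|) (cst 1)) => t y tb Cy.
  have tT : 0 < t < T by lra.
  have tT' : 0 <= t < T by lra.
  have tb' : 0 <= t <= b by lra.
  rewrite -split_int//; apply: tint_bound; first exact: weight1.
    apply: bmeasD; apply/continuous_bmeas/continuousM_fun.
    + exact: cft.
    + by apply: continuous_translate; exact: cg.
    + exact: cf.
    + by apply: continuous_translate; exact: cgt.
  move=> x Cx.
  have ny : `|rowt x - rowt y| <= 1.
    apply: norm_le_coord => // i; rewrite !mxE ler_norml.
    by have := Cx i; have := Cy i; lra.
  have nx : `|rowt x| <= 1 by apply: ltW; exact: cube_norm_lt1.
  apply: le_trans (ler_normD _ _) _; rewrite !normrM; apply: lerD; apply: ler_pM => //.
  + exact: hB'.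
  + exact: hC.
  + exact: hB.
  + exact: hC'.
- by move=> T0 y Cy; exact: (tint_cvg0 (weight1 R d) (fixed y Cy) T0).
Qed.

End time_integrals.

(** * Periodic functions and their gradients *)

Section torus_bounds.
Variables (R : realType) (d : nat).
Local Notation mR := (measurableTypeR R).
Local Notation tup := (d.-tuple mR).
Local Notation cub := (@cube R d).
Local Notation space := 'rV[R]_d.
Local Notation e := (delta_mx ord0).
Implicit Types (f : space -> R) (x y : space).

Lemma periodic_int (W : Type) (f : space -> W) (i : 'I_d) (m : int) x : periodic f ->
  f (x + m%:~R *: e i) = f x.
Proof.
move=> pf; have nat_case (n : nat) z : f (z + n%:R *: e i) = f z.
  elim: n z => [|n IHn] z; first by rewrite scale0r addr0.
  by rewrite -natr1 scalerDl scale1r addrA pf IHn.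
case: m => n; first exact: nat_case.
by rewrite NegzE mulrNz scaleNr -[LHS](nat_case n.+1) subrK.
Qed.

Lemma periodic_ints (W : Type) (f : space -> W) (m : 'I_d -> int) (s : seq 'I_d) x :
  periodic f -> f (x + \sum_(i <- s) (m i)%:~R *: e i) = f x.
Proof.
move=> pf; elim: s x => [|i s IHs] x; first by rewrite big_nil addr0.
by rewrite big_cons addrA IHs periodic_int.
Qed.

Lemma torus_cell x : exists m : 'I_d -> int,
  forall i, - 2^-1 <= (x + \sum_j (m j)%:~R *: e j) ord0 i <= 2^-1.
Proof.
exists (fun i => - Num.floor (x ord0 i + 2^-1)) => i.
have -> : (x + \sum_j (- Num.floor (x ord0 j + 2^-1))%:~R *: e j) ord0 i =
    x ord0 i - (Num.floor (x ord0 i + 2^-1))%:~R.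
  rewrite mxE summxE (bigD1 i)//= big1 ?addr0.
    by rewrite !mxE !eqxx mulr1 mulrNz.
  by move=> j ji; rewrite !mxE eq_sym (negbTE ji) andbF mulr0.
have h1 := floor_le (x ord0 i + 2^-1).
have h2 := floorD1_gt (x ord0 i + 2^-1).
rewrite intrD in h2.
by move: h1 h2; set F := (Num.floor _)%:~R; lra.
Qed.

(** The mean value theorem along each coordinate in turn, whence the factor d. *)
Lemma lipschitz_of_gradient f (fx : 'I_d -> space -> R) (B : R) : 0 <= B -> xfield f fx ->
  (forall i x, `|fx i x| <= B) -> forall x y, `|f x - f (x - y)| <= d%:R * B * `|y|.
Proof.
move=> B0 [cf _ df] fB x y.
have step z i c : `|f (z + c *: e i) - f z| <= B * `|c|.
  pose phi (s : R) := f (z + s *: e i).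
  have dphi (s : R) : is_derive s 1 phi (fx i (z + s *: e i)).
    have [d1 d2] := df i (z + s *: e i).
    by rewrite -d2; exact: is_derive_line.
  have cphi a b : {within `[a, b], continuous phi}.
    by apply: derivable_within_continuous => s _; have [] := dphi s.
  have E : f (z + c *: e i) - f z = phi c - phi 0 by rewrite /phi scale0r addr0.
  rewrite E; have [c0|c0|->] := ltgtP c 0; last by rewrite subrr !normr0 mulr0.
    have [s _ h] := @MVT R phi _ c 0 c0 (fun s _ => dphi s) (cphi _ _).
    rewrite distrC h sub0r normrM normrN ler_wpM2r//.
  have [s _ h] := @MVT R phi _ 0 c c0 (fun s _ => dphi s) (cphi _ _).
  by rewrite h subr0 normrM ler_wpM2r.
pose z := x - y; have xE : x = z + \sum_i y ord0 i *: e i.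
  by rewrite -row_sum_delta subrK.
suff h : `|f (z + \sum_i y ord0 i *: e i) - f z| <= \sum_(i < d) B * `|y|.
  rewrite -/z {1}xE; apply: le_trans h _.
  by rewrite sumr_const card_ord -[leLHS]mulr_natl mulrA.
elim: (index_enum _) => [|i s IHs] /=.
  by rewrite !big_nil addr0 subrr normr0.
rewrite !big_cons.
have -> : z + (y ord0 i *: e i + \sum_(j <- s) y ord0 j *: e j) =
   (z + \sum_(j <- s) y ord0 j *: e j) + y ord0 i *: e i by rewrite addrA addrAC.
set w := z + _ in IHs *.
have -> : f (w + y ord0 i *: e i) - f z = (f (w + y ord0 i *: e i) - f w) + (f w - f z) by ring.
apply: le_trans (ler_normD _ _) _; apply: lerD => //.
by apply: le_trans (step _ _ _) _; rewrite ler_wpM2l// coord_le_norm.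
Qed.

(** Translation along e i plays the role of time, at the time 1 of the interval (0, 2). *)
Lemma is_derive_conv k f fx i x : weight k -> xfield f fx ->
  is_derive x (e i) (fun x => tint k (fun y => f (x - y))) (tint k (fun y => fx i (x - y))).
Proof.
move=> wk [cf cfx df].
pose g (s : R) y := f (x + (s - 1) *: e i - y).
pose gs (s : R) y := fx i (x + (s - 1) *: e i - y).
have dg (s : R) y : is_derive s 1 (fun s => g s y) (gs s y).
  have E : (fun s => g s y) = (fun s => f ((x - y - e i) + s *: e i)).
    apply/funext => r; rewrite /g; congr (f _).
    by apply/rowP => j; rewrite !mxE; ring.
  have E' : gs s y = fx i ((x - y - e i) + s *: e i).
    rewrite /gs; congr (fx i _).
    by apply/rowP => j; rewrite !mxE; ring.
  rewrite E E'; have [d1 d2] := df i ((x - y - e i) + s *: e i).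
  by rewrite -d2; exact: is_derive_line.
have [B hB] := continuous_ball_bounded (`|x| + 2) (cfx i).
have mg : mfield 2 g gs.
  split.
  - by move=> s _; exact: (continuous_bmeas (continuous_reflect (x := x + (s - 1) *: e i) cf)).
  - by move=> s y _ _; exact: dg.
  - move=> b bT; exists B => s y sb Cy; apply: hB.
    rewrite -addrA; apply: le_trans (ler_normD _ _) _; rewrite lerD2l.
    apply: norm_le_coord => // j; rewrite !mxE.
    have hd : `|(j == i)%:R * (s - 1)| <= 1 :> R.
      by case: (j == i); rewrite ?mul1r ?mul0r ?normr0// ler_norml; lra.
    have := Cy j; move: hd; rewrite eqxx/= mulrC !ler_norml.
    set q := (s - 1) * _; lra.
  - move=> _ y _; apply: cvg_at_right_filter.
    exact: (is_derive1_continuous (dg 0 (rowt y))).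
have := tint_derive wk mg (t := 1) ltac:(lra).
have -> : gs 1 = (fun y => fx i (x - y)).
  by apply/funext => y; rewrite /gs subrr scale0r addr0.
move=> h; apply: is_derive_of_line.
have sh : is_derive (0 : R) 1 (fun s : R => s + 1) 1.
  by apply: is_derive_eq; rewrite addr0.
have h' : is_derive ((fun s : R => s + 1) 0) 1 (fun s => tint k (g s)) (tint k (fun y => fx i (x - y))).
  by rewrite /= add0r.
have := @is_derive1_comp R _ (fun s : R => s + 1) 0 _ _ h' sh.
rewrite mulr1; congr is_derive; apply/funext => s /=.
by congr tint; apply/funext => y; rewrite /g addrK.
Qed.

End torus_bounds.

(** * Algebra of the relative energy identity *)

Section energy_algebra.
Variables (R : realType) (d : nat).

(** The relative energy identity at one point. All densities, velocities and derivatives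
    are independent numbers related by the equations alone: A and B2 stand for
    rho^(gamma - 1) and rhob^(gamma - 2), G and Gb for the gradients of the two
    convolutions. The first sum on the right is a divergence. *)
Lemma energy_algebra (kappa gamma r rb A B2 rt rbt : R)
    (rx rbx u ub ut ubt G Gb : 'I_d -> R) (ux ubx : 'I_d -> 'I_d -> R) :
  gamma - 1 != 0 ->
  rt + \sum_i (rx i * u i + r * ux i i) = 0 ->
  rbt + \sum_i (rbx i * ub i + rb * ubx i i) = 0 ->
  (forall i, r * (ut i + \sum_j u j * ux i j) + gamma * A * rx i + kappa * (r * G i) = 0) ->
  (forall i, ubt i + \sum_j ub j * ubx i j + gamma * B2 * rbx i + kappa * Gb i = 0) ->
  let w i := u i - ub i in
  let B1 := rb * B2 in
  let c := gamma / (gamma - 1) in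
  let q := \sum_k w k * w k in
  2^-1 * rt * q
    + 2^-1 * r * \sum_k ((ut k - ubt k) * w k + w k * (ut k - ubt k))
    + (c * A * rt - c * B1 * rbt - (gamma * B2 * rbt * (r - rb) + c * B1 * (rt - rbt)))
  = \sum_i (- 2^-1 * (rx i * q * u i
                      + r * (\sum_k (2 * w k * (ux k i - ubx k i))) * u i
                      + r * q * ux i i)
            - c * (gamma * A * rx i * u i + r * A * ux i i)
            + (gamma * A * rx i * ub i + r * A * ubx i i)
            + (gamma * B2 * rbx i * (r * u i) + c * B1 * (rx i * u i + r * ux i i))
            - (gamma * B1 * rbx i * ub i + rb * B1 * ubx i i))
    - r * \sum_i \sum_j w i * w j * ubx i j
    - (r * A - rb * B1 - gamma * B1 * (r - rb)) * \sum_i ubx i i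
    - kappa * \sum_i r * w i * (G i - Gb i).
Proof.
move=> g0 mass massb mom momb w B1 c q.
pose a1 := \sum_i rx i * u i; pose a2 := \sum_i ux i i.
pose b1 := \sum_i rbx i * ub i; pose b2 := \sum_i ubx i i.
pose c1 := \sum_i rx i * ub i; pose c2 := \sum_i rbx i * u i.
pose D := \sum_k w k * \sum_j u j * ux k j.
pose F := \sum_k w k * \sum_j u j * ubx k j.
pose Db := \sum_k w k * \sum_j ub j * ubx k j.
pose g1 := \sum_k w k * G k; pose g2 := \sum_k w k * Gb k.
have Ert : rt = - (a1 + r * a2).
  move/eqP: mass; rewrite big_split /= -mulr_sumr -/a1 -/a2 addr_eq0 => /eqP ->.
  by [].
have Erbt : rbt = - (b1 + rb * b2).
  move/eqP: massb; rewrite big_split /= -mulr_sumr -/b1 -/b2 addr_eq0 => /eqP ->.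
  by [].
have Eut : \sum_k w k * (r * ut k) = - (r * D + gamma * A * (a1 - c1) + kappa * r * g1).
  rewrite (eq_bigr (fun k => - (r * (w k * \sum_j u j * ux k j)
      + gamma * A * (rx k * u k - rx k * ub k) + kappa * r * (w k * G k)))).
    by rewrite sumrN !big_split /= -!mulr_sumr sumrB.
  move=> k _; have h := mom k; rewrite (_ : r * ut k = - (r * (\sum_j u j * ux k j)
    + gamma * A * rx k + kappa * (r * G k))); first by rewrite /w; ring.
  by apply/eqP; rewrite -subr_eq0 opprK; apply/eqP; rewrite -[RHS]h; ring.
have Eubt : \sum_k w k * ubt k = - (Db + gamma * B2 * (c2 - b1) + kappa * g2).
  rewrite (eq_bigr (fun k => - ((w k * \sum_j ub j * ubx k j)
      + gamma * B2 * (rbx k * u k - rbx k * ub k) + kappa * (w k * Gb k)))).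
    by rewrite sumrN !big_split /= -!mulr_sumr sumrB.
  move=> k _; have h := momb k; rewrite (_ : ubt k = - ((\sum_j ub j * ubx k j)
    + gamma * B2 * rbx k + kappa * Gb k)); first by rewrite /w; ring.
  by apply/eqP; rewrite -subr_eq0 opprK; apply/eqP; rewrite -[RHS]h; ring.
have EK : 2^-1 * r * (\sum_k ((ut k - ubt k) * w k + w k * (ut k - ubt k))) =
    (\sum_k w k * (r * ut k)) - r * (\sum_k w k * ubt k).
  rewrite !mulr_sumr -sumrB; apply: eq_bigr => k _; by field.
have EQ : \sum_i (\sum_k (2 * w k * (ux k i - ubx k i))) * u i = 2 * (D - F).
  rewrite (eq_bigr (fun i => \sum_k (2 * (w k * (u i * ux k i) - w k * (u i * ubx k i))))).
    rewrite exchange_big /= /D /F -sumrB mulr_sumr; apply: eq_bigr => k _.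
    by rewrite -mulr_sumr sumrB -!mulr_sumr.
  by move=> i _; rewrite mulr_suml; apply: eq_bigr => k _; ring.
have EW : \sum_i \sum_j w i * w j * ubx i j = F - Db.
  rewrite /F /Db -sumrB; apply: eq_bigr => k _; rewrite -mulrBr -sumrB mulr_sumr.
  by apply: eq_bigr => j _; rewrite /w; ring.
have EG : \sum_i r * w i * (G i - Gb i) = r * (g1 - g2).
  by rewrite /g1 /g2 -sumrB mulr_sumr; apply: eq_bigr => i _; ring.
rewrite EK Eut Eubt EW EG -/b2.
rewrite [X in _ = X - _ - _ - _](_ : _ =
  - 2^-1 * (q * a1 + r * (2 * (D - F)) + r * q * a2)
  - c * (gamma * A * a1 + r * A * a2) + (gamma * A * c1 + r * A * b2)
  + (gamma * B2 * r * c2 + c * B1 * (a1 + r * a2)) - (gamma * B1 * b1 + rb * B1 * b2)).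
  rewrite Ert Erbt /B1 /c; field.
  exact: g0.
rewrite -EQ; clearbody q; rewrite /a1 /a2 /b1 /b2 /c1 /c2 !mulrDr !mulr_sumr.
rewrite !opprD -!sumrN -!big_split /=.
by apply: eq_bigr => i _; ring.
Qed.

End energy_algebra.

(** * Solutions in non-conservative form *)

Section flow.
Variables (R : realType) (d : nat) (alpha gamma kappa T : R).
Hypothesis alpha0d : 0 < alpha < d%:R.
Hypothesis gamma1 : 1 < gamma.
Local Notation space := 'rV[R]_d.
Local Notation e := (delta_mx ord0).
Local Notation K := (@riesz_kernel R d alpha).
Implicit Types (x : space) (t : R).

Lemma tfield_ext (f ft f' ft' : R -> space -> R) :
  (forall t x, 0 <= t < T -> f t x = f' t x) -> (forall t x, 0 < t < T -> ft t x = ft' t x) ->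
  tfield T f ft -> tfield T f' ft'.
Proof.
move=> E Et [cf cft df bf bft zf].
have sub (b t : R) : 0 < b < T -> 0 <= t <= b -> 0 <= t < T by lra.
have sub' (b t : R) : 0 < b < T -> 0 < t <= b -> 0 < t < T by lra.
split.
- by move=> t tT; have -> : f' t = f t by [apply/funext => x; rewrite E]; exact: cf.
- by move=> t tT; have -> : ft' t = ft t by [apply/funext => x; rewrite Et]; exact: cft.
- move=> t x tT; rewrite -Et//.
  have near_f : \forall s \near t, f s x = f' s x.
    case/andP: tT => t0 tT; near=> s; apply: E; apply/andP; split.
      by apply: ltW; near: s; exact: lt_nbhsr.
    by near: s; exact: lt_nbhsl.
  have near_f' : \forall s \near t, f' s x = f s x by apply: filterS near_f => s ->.
  have [d1 d2] := df t x tT.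
  by split; [apply: (near_eq_derivable near_f)|rewrite (near_eq_derive _ near_f')].
- move=> b bT; have [B hB] := bf b bT; exists B => t x tb x1.
  by rewrite -E; [exact: hB|exact: sub tb].
- move=> b bT; have [B hB] := bft b bT; exists B => t x tb x1.
  by rewrite -Et; [exact: hB|exact: sub' tb].
- move=> T0 x; rewrite -E ?lexx//.
  apply: cvg_trans (zf T0 x); apply: near_eq_cvg; near=> s; apply: E.
  apply/andP; split; first by apply: ltW; near: s; exact: nbhs_right_gt.
  by near: s; exact: nbhs_right_lt.
Unshelve. all: by end_near. Qed.

(** First-order data of a solution, with the momentum equation in non-conservative form.
    The joint continuity in fl_joint turns an essential bound on the velocity gradient into
    a bound at every point. *)
Record flow (rho : R -> space -> R) (u : R -> space -> space)
    (rt : R -> space -> R) (rx : 'I_d -> R -> space -> R)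
    (ut : 'I_d -> R -> space -> R) (ux : 'I_d -> 'I_d -> R -> space -> R) : Prop := Flow {
  fl_rt : tfield T rho rt;
  fl_rx : forall t, 0 <= t < T -> xfield (rho t) (fun i => rx i t);
  fl_ut : forall i, tfield T (fun t x => u t x ord0 i) (ut i);
  fl_ux : forall i t, 0 <= t < T -> xfield (fun x => u t x ord0 i) (fun j => ux i j t);
  fl_joint : forall i j (p : R^o * space), slab T p ->
    exists2 G : R^o * space -> R, {for p, continuous G} &
      forall q, slab T q -> G q = ux i j q.1 q.2;
  fl_prho : forall t, 0 <= t < T -> periodic (rho t);
  fl_pu : forall i t, 0 <= t < T -> periodic (fun x => u t x ord0 i);
  fl_ge0 : forall t x, 0 <= t < T -> 0 <= rho t x;
  fl_mass : forall t x, 0 < t < T ->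
    rt t x + \sum_i (rx i t x * u t x ord0 i + rho t x * ux i i t x) = 0;
  fl_mom : forall t x i, 0 < t < T ->
    rho t x * (ut i t x + \sum_j u t x ord0 j * ux i j t x)
    + gamma * pospow (gamma - 1) (rho t x) * rx i t x
    + kappa * (rho t x * tint K (fun y => rx i t (x - y))) = 0
}.

(** Where the density vanishes both forms of the force are zero. *)
Lemma pressure_force (f : space -> R) fx i x : xfield f fx -> (forall x, 0 <= f x) ->
  f x * partial i (variational_derivative alpha gamma kappa f) x =
  gamma * pospow (gamma - 1) (f x) * fx i x
  + kappa * (f x * tint K (fun y => fx i (x - y))).
Proof.
move=> xf f0; have := f0 x; rewrite le_eqVlt => /predU1P[<-|fx0].
  by rewrite !mul0r pospow0 ?subr_eq0 ?gt_eqF// !mulr0 mul0r addr0.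
have g10 : gamma - 1 != 0 by rewrite subr_eq0 gt_eqF.
have wK := weight_riesz_kernel alpha0d.
have h1 : is_derive x (e i) (fun z => gamma / (gamma - 1) * f z `^ (gamma - 1))
    (gamma * f x `^ (gamma - 2) * fx i x).
  have hp := is_derive1_powR (gamma - 1) fx0.
  have hc := is_derive_chain (xf_der xf i x) hp.
  have := is_deriveZ (gamma / (gamma - 1)) hc.
  congr is_derive; rewrite /GRing.scale /=.
  have -> : gamma - 1 - 1 = gamma - 2 by lra.
  by field.
have h2 := is_derive_conv i x wK xf.
have h3 := is_deriveD h1 (is_deriveZ kappa h2).
rewrite (partialE h3) /GRing.scale /= mulrDr; congr (_ + _); last by ring.
rewrite pospowE ?(ltW fx0)//.
have -> : f x `^ (gamma - 1) = f x * f x `^ (gamma - 2).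
  rewrite -{2}(@powRr1 _ (f x)) ?(ltW fx0)// -powRD; last by rewrite (gt_eqF fx0) implybT.
  by congr (_ `^ _); ring.
ring.
Qed.

(** Velocity times the mass equation is subtracted from the momentum equation. *)
Lemma euler_riesz_flow rho u : euler_riesz_solution alpha gamma kappa T rho u ->
  exists rt rx ut ux, flow rho u rt rx ut ux.
Proof.
move=> [[srho su] per rho0 mass mom].
have [rt [rx [tr xr _]]] := C1slab_fields (smooth_on_C1slab srho).
have hu i := C1slab_fields (smooth_on_component i su).
have [ut hut] := choice hu.
have [ux hux] := choice hut.
have tu i := let: And3 a _ _ := hux i in a.
have xu i := let: And3 _ b _ := hux i in b.
have ju i := let: And3 _ _ c := hux i in c.
exists rt, rx, ut, ux; split => //.
- by move=> t tT; exact: (per t tT).1.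
- by move=> i t tT j x; rewrite (per t tT).2.
- move=> t x tT; have tT' : 0 <= t < T by lra.
  rewrite -[RHS](mass t x tT); congr (_ + _).
    by rewrite derive1E; have [_ ->] := tf_der tr x tT.
  apply: eq_bigr => i _.
  by rewrite (partialE (xf_der (xfieldM (xr t tT') (xu i t tT')) i x)).
- move=> t x i tT; have tT' : 0 <= t < T by lra.
  have := mom t x i tT; rewrite (pressure_force _ _ (xr t tT')); last by move=> z; exact: rho0.
  rewrite derive1E (_ : 'D_1 _ t = rt t x * u t x ord0 i + rho t x * ut i t x); last first.
    by have [_ ->] := tf_der (tfieldM tr (tu i)) x tT.
  rewrite (eq_bigr (fun j => u t x ord0 i * (rx j t x * u t x ord0 j + rho t x * ux j j t x)
      + rho t x * (u t x ord0 j * ux i j t x))); last first.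
    move=> j _.
    rewrite (partialE (xf_der (xfieldM (xfieldM (xr t tT') (xu i t tT')) (xu j t tT')) j x)).
    ring.
  rewrite big_split /= -!mulr_sumr.
  have ms : rt t x + \sum_j (rx j t x * u t x ord0 j + rho t x * ux j j t x) = 0.
    rewrite -[RHS](mass t x tT); congr (_ + _).
      by rewrite derive1E; have [_ ->] := tf_der tr x tT.
    apply: eq_bigr => j _.
    by rewrite (partialE (xf_der (xfieldM (xr t tT') (xu j t tT')) j x)).
  set S := \sum_j _ in ms *; set S' := \sum_j _.
  have -> : rt t x = - S by apply/eqP; rewrite -addr_eq0; exact/eqP.
  by move=> <-; ring.
Qed.

Section flow_theory.
Variables (rho : R -> space -> R) (u : R -> space -> space)
    (rt : R -> space -> R) (rx : 'I_d -> R -> space -> R)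
    (ut : 'I_d -> R -> space -> R) (ux : 'I_d -> 'I_d -> R -> space -> R).
Hypothesis fl : flow rho u rt rx ut ux.

Lemma flow_flux_xfield i t : 0 <= t < T ->
  xfield (fun x => rho t x * u t x ord0 i)
    (fun j x => rx j t x * u t x ord0 i + rho t x * ux i j t x).
Proof. by move=> tT; exact: (xfieldM (fl_rx fl tT) (fl_ux fl i tT)). Qed.

Lemma flow_rtE t : 0 < t < T ->
  rt t = (fun x => - \sum_i (rx i t x * u t x ord0 i + rho t x * ux i i t x)).
Proof.
move=> tT; apply/funext => x; apply/eqP; rewrite -addr_eq0; apply/eqP.
exact: (fl_mass fl x tT).
Qed.

Lemma periodic_face (f : space -> R) i x : periodic f -> f (x + 2^-1 *: e i) = f (x - 2^-1 *: e i).
Proof.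
move=> pf; rewrite -[RHS](pf i); congr f.
by apply/rowP => j; rewrite !mxE; case: (eqVneq j i) => /= _; lra.
Qed.

Lemma torus_integral_div (f : space -> R) fx i : xfield f fx -> periodic f ->
  tint (cst 1) (fx i) = 0.
Proof.
move=> xf pf; have E : partial i f = fx i.
  by apply/funext => x; exact: partialE (xf_der xf i x).
rewrite -torus_integralE -E; apply: torus_integral_partial.
- by move=> x; have [] := xf_der xf i x.
- by rewrite E; exact: (xf_dcont xf).
- by move=> x _; exact: periodic_face.
Qed.

Lemma flow_rt_periodic t : 0 < t < T -> periodic (rt t).
Proof.
move=> tT i x; have [_ <-] := tf_der (fl_rt fl) (x + e i) tT.
have [_ <-] := tf_der (fl_rt fl) x tT.
apply: near_eq_derive; case/andP: tT => t0 tT; near=> s; apply: fl_prho => //.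
  exact: fl.
apply/andP; split; first by apply: ltW; near: s; exact: lt_nbhsr.
by near: s; exact: lt_nbhsl.
Unshelve. all: by end_near. Qed.

Lemma flow_mass_conservation t : 0 <= t < T ->
  torus_integral (rho t) = torus_integral (rho 0).
Proof.
move=> /andP[]; rewrite le_eqVlt => /predU1P[<- //|t0] tT.
have T0 : 0 < T by apply: lt_trans tT.
pose m s := tint (cst 1) (rho s).
have dm s : 0 < s < T -> is_derive s 1 m 0.
  move=> sT; have sT' : 0 <= s < T by lra.
  have := tint_derive (weight1 R d) (tfield_mfield (fl_rt fl)) sT.
  rewrite (flow_rtE sT) tintN; [|exact: weight1|].
    rewrite tint_sum; [|exact: weight1|].
      rewrite big1 ?oppr0// => i _.
      apply: (torus_integral_div i (flow_flux_xfield i sT')).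
      by move=> j x; rewrite (fl_prho fl sT') (fl_pu fl i sT').
    by move=> i; apply: continuous_bmeas; exact: (xf_dcont (flow_flux_xfield i sT')).
  apply: bmeas_sum => i; apply: continuous_bmeas.
  exact: (xf_dcont (flow_flux_xfield i sT')).
have zm := tint_cvg0 (weight1 R d) (tfield_mfield (fl_rt fl)) T0.
rewrite !torus_integralE -/(m t) -/(m 0); apply/eqP; rewrite -subr_eq0; apply/eqP.
have [||c _ ->] := @MVT R m (cst 0) 0 t t0.
- by move=> s /[!in_itv]/= /andP[s0 st]; apply: dm; lra.
- apply/(continuous_within_itvP _ t0); split.
  + move=> s /[!in_itv]/= /andP[s0 st].
    have sT : 0 < s < T by lra.
    exact: is_derive1_continuous (dm s sT).
  + exact: zm.
  + have tT' : 0 < t < T by rewrite t0.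
    by apply: cvg_at_left_filter; exact: is_derive1_continuous (dm t tT').
by rewrite mul0r.
Qed.

End flow_theory.
End flow.

(** * From an essential to a uniform gradient bound *)

Lemma ae_point (dsp : measure_display) (X : measurableType dsp) (R : realType)
    (mu : {measure set X -> \bar R}) (A : set X) (P : X -> Prop) :
  measurable A -> (0 < mu A)%E -> {ae mu, forall x, P x} -> exists2 x, A x & P x.
Proof.
move=> mA A0 [N [mN N0 hN]]; apply: contrapT => h.
have AN : A `<=` N by move=> x Ax; apply: hN => Px; apply: h; exists x.
have := le_measure mu (mem_set mA) (mem_set mN) AN => /(lt_le_trans A0) mN0.
exact: (negP (negbT (ltxx (0%R : \bar R)))) (eq_ind _ (fun z => (0%R < z)%E) mN0 _ N0).
Qed.

Lemma lebesgue_itv_gt0 (R : realType) (a b : R) : a < b ->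
  (0%:E < @lebesgue_measure R `]a, b[%classic)%E.
Proof. by move=> ab; rewrite lebesgue_measure_itv /= lte_fin ab -EFinB lte_fin subr_gt0. Qed.

Section gradient_bound.
Variables (R : realType) (d : nat) (T : R).
Local Notation mR := (measurableTypeR R).
Local Notation tup := (d.-tuple mR).
Local Notation cub := (@cube R d).
Local Notation space := 'rV[R]_d.
Local Notation e := (delta_mx ord0).

Lemma periodic_partial (f : space -> R) j : periodic f -> periodic (partial j f).
Proof.
move=> pf i x; rewrite /partial /derive.
rewrite pf (_ : f \o shift (x + e i) = f \o shift x)//.
by apply/funext => y /=; rewrite addrA pf.
Qed.

(** A point of the closed cell may lie on the boundary of the cube, but every ball around
    it meets the cube in a box of positive measure. *)
Lemma near_cell (x : space) (eps : R) : 0 < eps -> (forall i, - 2^-1 <= x ord0 i <= 2^-1) ->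
  exists A : set tup, [/\ measurable A, (0 < lebesgue_tuple R d A)%E &
    forall y, A y -> cub y /\ `|rowt y - x| < eps].
Proof.
move=> e0 hx.
pose a i := Num.max (- 2^-1) (x ord0 i - eps); pose b i := Num.min 2^-1 (x ord0 i + eps).
have ab i : a i < b i.
  have := hx i; rewrite /a /b lt_min !gt_max => /andP[h1 h2].
  by apply/andP; split; apply/andP; split; lra.
pose I i : set mR := `]a i, b i[%classic.
have mI i : measurable (I i) by exact: measurable_itv.
exists [set y | forall i, I i (tnth y i)]; split.
- rewrite (_ : [set y | _] =
     \bigcap_(i in [set: 'I_d]) (@tnth d mR ^~ i @^-1` I i)).
    apply: fin_bigcap_measurable => // i _.
    by rewrite -[X in measurable X]setTI; exact: measurable_tnth.
  by apply/seteqP; split => [t h i _|t h i]; [exact: h|exact: (h i)].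
- rewrite lebesgue_tuple_box//.
  rewrite (eq_bigr (fun i => (b i - a i)%:E)); last first.
    by move=> i _; rewrite /I lebesgue_measure_itv /= lte_fin ab EFinB.
  rewrite prodEFin lte_fin; apply: prodr_gt0 => i _; by rewrite subr_gt0.
- move=> y hy; split.
    move=> i; have := hy i; rewrite /I /= in_itv /= /a /b gt_max lt_min.
    by move=> /andP[/andP[-> _] /andP[-> _]].
  apply: norm_lt_coord => // i; have := hy i; rewrite /I /= in_itv /= /a /b gt_max lt_min !mxE.
  move=> /andP[/andP[_ h1] /andP[_ h2]].
  by rewrite ltr_norml; apply/andP; split; lra.
Qed.

(** Where a continuous gradient exceeds its essential bound, it does so during a time
    interval and on a box inside the cube, both of positive measure. *)
Lemma gradient_bound (u : R -> space -> space) (ux : 'I_d -> 'I_d -> R -> space -> R) :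
  (forall i (t : R), 0 <= t < T -> xfield (fun x => u t x ord0 i) (fun j => ux i j t)) ->
  (forall i j (p : R^o * space), slab T p ->
    exists2 G : R^o * space -> R, {for p, continuous G} &
      forall q, slab T q -> G q = ux i j q.1 q.2) ->
  (forall i (t : R), 0 <= t < T -> periodic (fun x => u t x ord0 i)) ->
  gradient_Linfty T u ->
  exists2 B, 0 <= B & forall i j (t : R) x, 0 < t < T -> `|ux i j t x| <= B.
Proof.
move=> xu ju pu [B0 hB]; exists `|B0|; first exact: normr_ge0.
move=> i j t0 x0 t0T; rewrite leNgt; apply/negP => hlt.
have uxE (t : R) : 0 <= t < T -> ux i j t = partial j (fun z => u t z ord0 i).
  by move=> tT; apply/funext => x; rewrite (partialE (xf_der (xu i t tT) j x)).
have t0T' : 0 <= t0 < T by lra.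
have [m hm] := torus_cell x0; set x1 := x0 + _ in hm.
have E1 : ux i j t0 x1 = ux i j t0 x0.
  by rewrite uxE// (periodic_ints _ _ _ (periodic_partial j (pu i t0 t0T'))).
have [G cG GE] := ju i j (t0, x1) t0T'.
have : \forall q \near ((t0 : R^o), x1), `|B0| < `|G q|.
  have cGn : {for ((t0 : R^o), x1), continuous (fun q => `|G q|)}.
    by apply: (@continuous_comp _ _ _ G (fun r : R => `|r|)) => //; exact: norm_continuous.
  have h1 : nbhs (`|G (t0, x1)|) (fun r : R => `|B0| < r).
    by apply: lt_nbhsr; rewrite GE//= E1.
  exact: (cGn _ h1).
move=> /nbhs_ballP[eps /= eps0 hball].
have [t1 t1I ht1] : exists2 t1 : mR, (`]Num.max 0 (t0 - eps), Num.min T (t0 + eps)[%classic : set mR) t1 &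
    (0 < t1 < T -> {ae lebesgue_tuple R d, forall y, cube y ->
      forall i j, `|partial j (fun z => u t1 z ord0 i) (\row_k tnth y k)| <= B0}).
  apply: ae_point hB; first exact: measurable_itv.
  have lt01 : Num.max 0 (t0 - eps) < Num.min T (t0 + eps).
    by rewrite lt_min !gt_max; apply/andP; split; apply/andP; split; lra.
  exact: (lebesgue_itv_gt0 lt01).
move: t1I; rewrite /= in_itv /= gt_max lt_min => /andP[/andP[t10 t11] /andP[t12 t13]].
have {}ht1 := ht1 (introT andP (conj t10 t12)).
have [A [mA A0 hA]] := near_cell eps0 hm.
have [y Ay hy] := ae_point mA A0 ht1.
have [Cy yx] := hA y Ay.
have t1T : 0 <= t1 < T by rewrite (ltW t10).
have := hball (t1, rowt y).
rewrite GE//= uxE// => /(_ _)/wrap[|].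
  split => /=; first by rewrite /ball /= ltr_norml; apply/andP; split; lra.
  by rewrite -ball_normE /= distrC.
apply/negP; rewrite -leNgt; apply: le_trans (ler_norm _).
exact: hy.
Qed.

End gradient_bound.

(** * The relative energy of two solutions *)

Lemma pospow_bound (R : realType) (p s B : R) : 0 <= p -> `|s| <= B -> `|pospow p s| <= B `^ p.
Proof.
move=> p0 sB; have B0 : 0 <= B by apply: le_trans sB.
rewrite /pospow ger0_norm ?powR_ge0//; apply: ge0_ler_powR => //; rewrite ?nnegrE//.
  by rewrite le_max lexx orbT.
by rewrite ge_max B0 andbT; apply: le_trans sB; exact: ler_norm.
Qed.

Section two_flows.
Variables (R : realType) (d : nat) (alpha gamma kappa T delta M : R).
Hypothesis alpha0d : 0 < alpha < d%:R.
Hypothesis gamma1 : 1 < gamma.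
Hypothesis delta0 : 0 < delta.
Local Notation space := 'rV[R]_d.
Local Notation e := (delta_mx ord0).
Local Notation K := (@riesz_kernel R d alpha).
Local Notation flow := (@flow R d alpha gamma kappa T).
Variables (rho : R -> space -> R) (u : R -> space -> space)
    (rt : R -> space -> R) (rx : 'I_d -> R -> space -> R)
    (ut : 'I_d -> R -> space -> R) (ux : 'I_d -> 'I_d -> R -> space -> R).
Variables (rhob : R -> space -> R) (ub : R -> space -> space)
    (rbt : R -> space -> R) (rbx : 'I_d -> R -> space -> R)
    (ubt : 'I_d -> R -> space -> R) (ubx : 'I_d -> 'I_d -> R -> space -> R).
Hypothesis fl : flow rho u rt rx ut ux.
Hypothesis flb : flow rhob ub rbt rbx ubt ubx.
Hypothesis rhob_bounds : forall (t : R) x, 0 <= t < T -> delta <= rhob t x <= M.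
Implicit Types (x : space) (t : R).

Local Notation c := (gamma / (gamma - 1)).
Local Notation P := (pospow gamma).

Definition veldiff (k : 'I_d) t x : R := u t x ord0 k - ub t x ord0 k.
Definition sqveldiff t x : R := \sum_k veldiff k t x * veldiff k t x.
Definition intdens t x : R := relative_internal_energy gamma (rho t x) (rhob t x).
Definition edens t x : R := 2^-1 * rho t x * enorm (u t x - ub t x) ^+ 2 + intdens t x.
Local Notation w := veldiff.
Local Notation q := sqveldiff.

Let g10 : gamma - 1 != 0. Proof. by rewrite subr_eq0 gt_eqF. Qed.
Let g0 : 0 < gamma. Proof. exact: lt_trans gamma1. Qed.

Lemma enorm_veldiff t x : enorm (u t x - ub t x) ^+ 2 = q t x.
Proof. by rewrite sqr_enorm; apply: eq_bigr => k _; rewrite !mxE expr2. Qed.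

Lemma pospow_step (s : R) : 0 <= s -> P s = s * pospow (gamma - 1) s.
Proof.
move=> s0; rewrite !pospowE//; have [->|s0'] := eqVneq s 0.
  by rewrite mul0r powR0// gt_eqF.
rewrite -{2}(@powRr1 _ s)// -powRD; last by rewrite s0' implybT.
by congr (_ `^ _); ring.
Qed.

Lemma powR_step (s : R) : 0 < s -> pospow (gamma - 1) s = s * s `^ (gamma - 2).
Proof.
move=> s0; rewrite pospowE ?ltW// -{2}(@powRr1 _ s) ?ltW// -powRD; last by rewrite (gt_eqF s0) implybT.
by congr (_ `^ _); ring.
Qed.

Lemma rhob_gt0 t x : 0 <= t < T -> 0 < rhob t x.
Proof. by move=> tT; case/andP: (rhob_bounds x tT) => h _; exact: lt_le_trans h. Qed.

Lemma intdensE t x : 0 <= t < T -> intdens t x =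
  (gamma - 1)^-1 * P (rho t x) - (gamma - 1)^-1 * P (rhob t x)
  - c * rhob t x `^ (gamma - 1) * (rho t x - rhob t x).
Proof.
move=> tT; rewrite /intdens /relative_internal_energy /internal_energy /internal_energy'.
by rewrite !pospowE ?(fl_ge0 fl)// ltW// rhob_gt0.
Qed.

Lemma intdens_ge0 t x : 0 <= t < T -> 0 <= intdens t x.
Proof.
move=> tT; apply: relative_internal_energy_ge0 => //; first exact: (fl_ge0 fl).
exact: rhob_gt0.
Qed.

Lemma sqveldiff_ge0 t x : 0 <= q t x.
Proof. by apply: sumr_ge0 => k _; rewrite -expr2 sqr_ge0. Qed.

Lemma is_derive_enthalpy (s : R) : delta <= s ->
  is_derive s 1 (fun s => c * s `^ (gamma - 1)) (gamma * s `^ (gamma - 2)).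
Proof.
move=> ds; have s0 : 0 < s by apply: lt_le_trans ds.
have := is_deriveZ c (is_derive1_powR (gamma - 1) s0).
congr is_derive; rewrite /GRing.scale /=.
have -> : gamma - 1 - 1 = gamma - 2 by lra.
by field.
Qed.

Lemma continuous_enthalpy' (s : R) : delta <= s -> {for s, continuous (fun s => gamma * s `^ (gamma - 2))}.
Proof.
move=> ds; have s0 : 0 < s by apply: lt_le_trans ds.
exact: is_derive1_continuous (is_deriveZ gamma (is_derive1_powR (gamma - 2) s0)).
Qed.

Let tP (f ft : R -> space -> R) : tfield T f ft ->
  tfield T (fun t x => P (f t x)) (fun t x => gamma * pospow (gamma - 1) (f t x) * ft t x).
Proof.
move=> tf; apply: (tfield_comp (A := setT) (g' := fun s => gamma * pospow (gamma - 1) s) tf) => //.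
- by move=> s _; exact: is_derive_pospow.
- move=> s _; apply: (@continuousM_fun R R (cst gamma) (pospow (gamma - 1))).
    exact: cst_continuous.
  by apply: continuous_pospow; rewrite subr_gt0.
- move=> B; exists (Num.max (B `^ gamma) (gamma * B `^ (gamma - 1))) => s _ sB; split.
    by rewrite le_max pospow_bound// ltW.
  by rewrite le_max normrM (gtr0_norm g0) ler_pM2l// pospow_bound ?orbT// subr_ge0 ltW.
Qed.

Let tfield_enthalpy : tfield T (fun t x => c * rhob t x `^ (gamma - 1))
    (fun t x => gamma * rhob t x `^ (gamma - 2) * rbt t x).
Proof.
apply: (tfield_comp (A := [set s | delta <= s]) (g := fun s => c * s `^ (gamma - 1))
  (g' := fun s => gamma * s `^ (gamma - 2)) (fl_rt flb)).
- exact: is_derive_enthalpy.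
- exact: continuous_enthalpy'.
- move=> B; exists (Num.max (c * B `^ (gamma - 1)) (gamma * (B `^ (gamma - 1) / delta))) => s ds sB.
  have s0 : 0 < s by apply: lt_le_trans ds.
  have hB : s `^ (gamma - 1) <= B `^ (gamma - 1).
    have g1 : 0 <= gamma - 1 by rewrite subr_ge0 ltW.
    by have := pospow_bound g1 sB; rewrite (pospowE _ (ltW s0)) ger0_norm ?powR_ge0.
  have c0 : 0 < c by rewrite divr_gt0// subr_gt0.
  split; rewrite le_max ger0_norm ?mulr_ge0 ?powR_ge0 ?(ltW g0) ?invr_ge0 ?subr_ge0 ?(ltW gamma1)//.
    by rewrite ler_wpM2l// ltW.
  apply/orP; right; rewrite ler_pM2l// ler_pdivlMr//; apply: le_trans hB.
  by rewrite -(pospowE (gamma - 1) (ltW s0)) (powR_step s0) mulrC ler_wpM2r// powR_ge0.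
- by move=> t x tT; case/andP: (rhob_bounds x tT).
Qed.

Definition intdenst t x : R :=
  let r := rho t x in let rb := rhob t x in
  let A := pospow (gamma - 1) r in let B2 := rb `^ (gamma - 2) in let B1 := rb * B2 in
  c * A * rt t x - c * B1 * rbt t x
  - (gamma * B2 * rbt t x * (r - rb) + c * B1 * (rt t x - rbt t x)).

Definition edenst t x : R :=
  2^-1 * rt t x * q t x
  + 2^-1 * rho t x * \sum_k ((ut k t x - ubt k t x) * w k t x + w k t x * (ut k t x - ubt k t x))
  + intdenst t x.

Lemma intdens_tfield : tfield T intdens intdenst.
Proof.
have t2 := tfieldZ (gamma - 1)^-1 (tP (fl_rt fl)).
have t3 := tfieldZ (gamma - 1)^-1 (tP (fl_rt flb)).
have t4 := tfieldM tfield_enthalpy (tfieldB (fl_rt fl) (fl_rt flb)).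
apply: (tfield_ext _ _ (tfieldB (tfieldB t2 t3) t4)) => t x tT; first by rewrite intdensE.
have tT' : 0 <= t < T by lra.
rewrite /intdenst -(pospowE (gamma - 1) (ltW (rhob_gt0 x tT'))).
rewrite !(powR_step (rhob_gt0 x tT')); field.
exact: g10.
Qed.

Lemma edens_tfield : tfield T edens edenst.
Proof.
have tw k := tfieldB (fl_ut fl k) (fl_ut flb k).
have tq : tfield T q _ := tfield_sum (fun k => tfieldM (tw k) (tw k)).
apply: (tfield_ext _ _ (tfieldD (tfieldM (tfieldZ 2^-1 (fl_rt fl)) tq) intdens_tfield)) => // t x tT.
by rewrite /edens enorm_veldiff.
Qed.

(** The flux of the relative energy: besides its divergence, edenstE contains only terms
    controlled by the gradient of ub and the Riesz interaction. *)
Definition eflux (i : 'I_d) t x : R :=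
  - 2^-1 * (rho t x * q t x * u t x ord0 i)
  - c * (P (rho t x) * u t x ord0 i) + P (rho t x) * ub t x ord0 i
  + c * rhob t x `^ (gamma - 1) * (rho t x * u t x ord0 i)
  - P (rhob t x) * ub t x ord0 i.

Definition efluxx (i j : 'I_d) t x : R :=
  let r := rho t x in let rb := rhob t x in
  let A := pospow (gamma - 1) r in let B2 := rb `^ (gamma - 2) in let B1 := rb * B2 in
  - 2^-1 * (rx j t x * q t x * u t x ord0 i
            + r * (\sum_k (2 * w k t x * (ux k j t x - ubx k j t x))) * u t x ord0 i
            + r * q t x * ux i j t x)
  - c * (gamma * A * rx j t x * u t x ord0 i + r * A * ux i j t x)
  + (gamma * A * rx j t x * ub t x ord0 i + r * A * ubx i j t x)
  + (gamma * B2 * rbx j t x * (r * u t x ord0 i)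
     + c * B1 * (rx j t x * u t x ord0 i + r * ux i j t x))
  - (gamma * B1 * rbx j t x * ub t x ord0 i + rb * B1 * ubx i j t x).

Let xP (f : space -> R) fx : xfield f fx ->
  xfield (fun x => P (f x)) (fun i x => gamma * pospow (gamma - 1) (f x) * fx i x).
Proof.
move=> xf; apply: (xfield_comp (A := setT) (g' := fun s => gamma * pospow (gamma - 1) s) xf) => //.
- by move=> s _; exact: is_derive_pospow.
- move=> s _; apply: (@continuousM_fun R R (cst gamma) (pospow (gamma - 1))).
    exact: cst_continuous.
  by apply: continuous_pospow; rewrite subr_gt0.
Qed.

Lemma eflux_xfield i t : 0 <= t < T -> xfield (eflux i t) (fun j => efluxx i j t).
Proof.
move=> tT.
have xw k := xfieldB (fl_ux fl k tT) (fl_ux flb k tT).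
have xq := xfield_sum (fun k => xfieldM (xw k) (xw k)).
have xr := fl_rx fl tT.
have xenthalpy : xfield (fun x => c * rhob t x `^ (gamma - 1))
    (fun j x => gamma * rhob t x `^ (gamma - 2) * rbx j t x).
  apply: (xfield_comp (A := [set s | delta <= s]) (g := fun s => c * s `^ (gamma - 1))
    (g' := fun s => gamma * s `^ (gamma - 2)) (fl_rx flb tT)).
  - exact: is_derive_enthalpy.
  - exact: continuous_enthalpy'.
  - by move=> x; case/andP: (rhob_bounds x tT).
have x1 := xfieldZ (- 2^-1) (xfieldM (xfieldM xr xq) (fl_ux fl i tT)).
have x2 := xfieldZ c (xfieldM (xP xr) (fl_ux fl i tT)).
have x3 := xfieldM (xP xr) (fl_ux flb i tT).
have x4 := xfieldM xenthalpy (xfieldM xr (fl_ux fl i tT)).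
have x5 := xfieldM (xP (fl_rx flb tT)) (fl_ux flb i tT).
have := xfieldB (xfieldD (xfieldD (xfieldB x1 x2) x3) x4) x5.
congr xfield; apply/funext => j; apply/funext => x.
have rb0 := rhob_gt0 x tT.
rewrite /efluxx -(pospowE (gamma - 1) (ltW rb0)) !(pospow_step (ltW rb0)) !(powR_step rb0).
rewrite !(pospow_step (fl_ge0 fl x tT)).
rewrite (_ : \sum_k (2 * w k t x * (ux k j t x - ubx k j t x)) =
  \sum_k ((ux k j t x - ubx k j t x) * (u t x ord0 k - ub t x ord0 k) +
      (u t x ord0 k - ub t x ord0 k) * (ux k j t x - ubx k j t x))).
  by rewrite /sqveldiff /veldiff; ring.
by apply: eq_bigr => k _; rewrite /veldiff; ring.
Qed.

Lemma eflux_periodic i t : 0 <= t < T -> periodic (eflux i t).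
Proof.
move=> tT j x; have h1 k := fl_pu fl k tT j x; have h2 k := fl_pu flb k tT j x.
rewrite /eflux /sqveldiff /veldiff (fl_prho fl tT) (fl_prho flb tT) h1 h2.
by under eq_bigr do rewrite h1 h2.
Qed.

(** The energy production that the gradient of the comparison velocity multiplies. *)
Definition stress t x : R :=
  rho t x * (\sum_i \sum_j w i t x * w j t x * ubx i j t x)
  + (gamma - 1) * intdens t x * \sum_i ubx i i t x.

Lemma edenstE t x : 0 < t < T ->
  edenst t x = \sum_i efluxx i i t x - stress t x
  - kappa * \sum_i rho t x * w i t x * tint K (fun y => rx i t (x - y) - rbx i t (x - y)).
Proof.
move=> tT; have tT' : 0 <= t < T by lra.
have rb0 := rhob_gt0 x tT'.
have momb i : ubt i t x + \sum_j ub t x ord0 j * ubx i j t x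
    + gamma * rhob t x `^ (gamma - 2) * rbx i t x
    + kappa * tint K (fun y => rbx i t (x - y)) = 0.
  have := fl_mom flb x i tT; rewrite (powR_step rb0).
  rewrite (_ : _ + _ + _ = rhob t x * (ubt i t x + \sum_j ub t x ord0 j * ubx i j t x
    + gamma * rhob t x `^ (gamma - 2) * rbx i t x
    + kappa * tint K (fun y => rbx i t (x - y)))); last by ring.
  by move/eqP; rewrite mulf_eq0 gt_eqF//= => /eqP.
rewrite /edenst /intdenst (energy_algebra g10 (fl_mass fl x tT) (fl_mass flb x tT)
  (fun i => fl_mom fl x i tT) momb) /stress.
have wK := weight_riesz_kernel alpha0d.
have cr i : continuous (rx i t) by exact: (xf_dcont (fl_rx fl tT')).
have crb i : continuous (rbx i t) by exact: (xf_dcont (fl_rx flb tT')).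
rewrite intdensE// -(pospowE (gamma - 1) (ltW rb0)) !(pospow_step (ltW rb0)) !(powR_step rb0).
rewrite !(pospow_step (fl_ge0 fl x tT')).
rewrite [X in _ - kappa * X = _](eq_bigr (fun i => rho t x * w i t x *
    tint K (fun y => rx i t (x - y) - rbx i t (x - y)))); last first.
  move=> i _; rewrite (tintB wK (continuous_bmeas (continuous_reflect (cr i)))
    (continuous_bmeas (continuous_reflect (crb i)))).
  by rewrite /veldiff.
rewrite /efluxx /veldiff; set X := \sum_i _; set Y := \sum_i _ ; set Z := \sum_i _; set W := \sum_i _.
field.
exact: g10.
Qed.

Definition rdiff t x : R := rho t x - rhob t x.
Definition rdiffx (i : 'I_d) t x : R := rx i t x - rbx i t x.
Local Notation r := rdiff.
Local Notation dr := rdiffx.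

Let wK : weight K. Proof. exact: weight_riesz_kernel. Qed.
Let w1 : weight (cst 1) := weight1 R d.

Let xr t (tT : 0 <= t < T) : xfield (r t) (fun i => dr i t) :=
  xfieldB (fl_rx fl tT) (fl_rx flb tT).

Let xw k t (tT : 0 <= t < T) : xfield (w k t) (fun j x => ux k j t x - ubx k j t x) :=
  xfieldB (fl_ux fl k tT) (fl_ux flb k tT).

Let pr t : 0 <= t < T -> periodic (r t).
Proof. by move=> tT i x; rewrite /rdiff (fl_prho fl tT) (fl_prho flb tT). Qed.

Lemma continuous_edens t : 0 <= t < T -> continuous (edens t).
Proof. exact: (tf_cont edens_tfield). Qed.

Lemma continuous_intdens t : 0 <= t < T -> continuous (intdens t).
Proof. exact: (tf_cont intdens_tfield). Qed.

Lemma continuous_stress t : 0 <= t < T -> continuous (stress t).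
Proof.
move=> tT.
have cubx i j : continuous (ubx i j t) by exact: (xf_dcont (fl_ux flb i tT)).
apply: (@continuousD_fun R _ (fun x => rho t x * (\sum_i \sum_j w i t x * w j t x * ubx i j t x))
  (fun x => (gamma - 1) * intdens t x * \sum_i ubx i i t x)).
  apply: continuousM_fun; first exact: (xf_cont (fl_rx fl tT)).
  apply: continuous_sum_fun => i; apply: continuous_sum_fun => j.
  apply: continuousM_fun; last exact: cubx.
  by apply: continuousM_fun; [exact: (xf_cont (xw i tT))|exact: (xf_cont (xw j tT))].
apply: (@continuousM_fun R _ (fun x => (gamma - 1) * intdens t x) (fun x => \sum_i ubx i i t x)).
  apply: (@continuousM_fun R _ (cst (gamma - 1)) (intdens t)); first exact: cst_continuous.
  exact: continuous_intdens.
by apply: continuous_sum_fun => i; exact: cubx.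
Qed.

Lemma edenst_integral t : 0 < t < T -> tint (cst 1) (edenst t) =
  - tint (cst 1) (stress t) - kappa * \sum_i kpair K (fun x => rho t x * w i t x) (dr i t).
Proof.
move=> tT; have tT' : 0 <= t < T by lra.
have cdr i : continuous (dr i t) by exact: (xf_dcont (xr tT')).
have crw i : continuous (fun x => rho t x * w i t x).
  by apply: continuousM_fun; [exact: (xf_cont (fl_rx fl tT'))|exact: (xf_cont (xw i tT'))].
pose F (i : 'I_d) x := rho t x * w i t x * tint K (fun y => dr i t (x - y)).
have bF i : bmeas (F i).
  by apply: bmeasM; [exact: continuous_bmeas|exact: bmeas_conv].
have bJ i : bmeas (efluxx i i t).
  by apply: continuous_bmeas; exact: (xf_dcont (eflux_xfield i tT')).
have bS : bmeas (stress t) by apply: continuous_bmeas; exact: continuous_stress.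
have -> : edenst t = (fun x => (\sum_i efluxx i i t x - stress t x) - kappa * \sum_i F i x).
  by apply/funext => x; rewrite edenstE.
have bsJ : bmeas (fun x => \sum_i efluxx i i t x) by exact: bmeas_sum.
have bsF : bmeas (fun x => \sum_i F i x) by exact: bmeas_sum.
rewrite (tintB w1 (bmeasB bsJ bS) (bmeasZ kappa bsF)) (tintB w1 bsJ bS) (tintZ kappa w1 bsF).
rewrite (tint_sum _ w1 bJ) (tint_sum _ w1 bF) big1 ?sub0r.
  congr (_ - _ * _); apply: eq_bigr => i _; exact: pair_conv.
move=> i _; exact: (torus_integral_div i (eflux_xfield i tT') (eflux_periodic i tT')).
Qed.

Lemma energy_is_derive t : 0 < t < T ->
  is_derive t 1 (fun s => tint (cst 1) (edens s))
    (- tint (cst 1) (stress t) - kappa * \sum_i kpair K (fun x => rho t x * w i t x) (dr i t)).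
Proof.
by move=> tT; rewrite -edenst_integral//; exact: tint_derive w1 (tfield_mfield edens_tfield) t tT.
Qed.

(** The kernel is even, so both factors contribute equally; the mass equations and an
    integration by parts in x do the rest. *)
Lemma potential_is_derive t : 0 < t < T ->
  is_derive t 1 (fun s => kpair K (r s) (r s))
    (2 * \sum_i kpair K (fun x => rho t x * u t x ord0 i - rhob t x * ub t x ord0 i) (dr i t)).
Proof.
move=> tT; have tT' : 0 <= t < T by lra.
have tr := tfieldB (fl_rt fl) (fl_rt flb).
have := tint_derive wK (corr_mfield tr tr) tT.
pose rdt x := rt t x - rbt t x.
have crdt : continuous rdt by exact: (tf_dcont tr).
have cr : continuous (r t) by exact: (xf_cont (xr tT')).
have prdt : periodic rdt.
  by move=> i x; rewrite /rdt (flow_rt_periodic fl tT) (flow_rt_periodic flb tT).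
rewrite (tintD wK (bmeas_corr crdt cr) (bmeas_corr cr crdt)) -!/(kpair _ _ _).
rewrite [X in _ + X](pair_swap wK cr crdt (pr tT') prdt).
rewrite (_ : (fun y => K (- y)) = K); last by apply/funext => y; exact: riesz_kernelN.
pose m i x := rho t x * u t x ord0 i - rhob t x * ub t x ord0 i.
have xm i := xfieldB (flow_flux_xfield fl i tT') (flow_flux_xfield flb i tT').
have pm i : periodic (m i).
  move=> j x; rewrite /m (fl_prho fl tT') (fl_prho flb tT').
  by rewrite (fl_pu fl i tT') (fl_pu flb i tT').
pose dm i x := (rx i t x * u t x ord0 i + rho t x * ux i i t x)
  - (rbx i t x * ub t x ord0 i + rhob t x * ubx i i t x).
have cdm i : continuous (dm i) by exact: (xf_dcont (xm i)).
have -> : kpair K rdt (r t) = \sum_i kpair K (m i) (dr i t).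
  have E : rdt =1 (fun x => \sum_i (-1) * dm i x).
    move=> x; rewrite /rdt (flow_rtE fl tT) (flow_rtE flb tT) /dm -mulr_sumr sumrB; ring.
  rewrite (eq_kpair _ E (frefl _)) (pair_suml _ wK _ cr); last first.
    by move=> i; apply: (@continuousM_fun R _ (cst (-1)) (dm i)) => //; exact: cst_continuous.
  apply: eq_bigr => i _; rewrite (pairZl _ wK (cdm i) cr).
  rewrite (pair_partial_move wK (xf_cont (xm i)) cr (cdm i) (xf_dcont (xr tT') (i := i)) (pm i) (pr tT')
    (xf_der (xm i) i) (xf_der (xr tT') i)).
  by rewrite mulN1r opprK.
have twice (a : R) : a + a = 2 * a by ring.
by rewrite twice => h; exact: h.
Qed.

Definition total_energy t : R := tint (cst 1) (edens t) + kappa / 2 * kpair K (r t) (r t).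

(** The terms that contain u cancel between the energy and the potential. *)
Lemma total_energy_is_derive t : 0 < t < T ->
  is_derive t 1 total_energy (- tint (cst 1) (stress t)
    + kappa * \sum_i kpair K (fun x => r t x * ub t x ord0 i) (dr i t)).
Proof.
move=> tT; have tT' : 0 <= t < T by lra.
have := is_deriveD (energy_is_derive tT) (is_deriveZ (kappa / 2) (potential_is_derive tT)).
congr is_derive; rewrite /GRing.scale /=.
have cdr i : continuous (dr i t) by exact: (xf_dcont (xr tT')).
have crw i : continuous (fun x => rho t x * w i t x).
  by apply: continuousM_fun; [exact: (xf_cont (fl_rx fl tT'))|exact: (xf_cont (xw i tT'))].
have cm i : continuous (fun x => rho t x * u t x ord0 i - rhob t x * ub t x ord0 i).
  by exact: (xf_cont (xfieldB (flow_flux_xfield fl i tT') (flow_flux_xfield flb i tT'))).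
rewrite [X in _ = _ + _ * X](eq_bigr (fun i =>
    kpair K (fun x => rho t x * u t x ord0 i - rhob t x * ub t x ord0 i) (dr i t)
    - kpair K (fun x => rho t x * w i t x) (dr i t))); last first.
  move=> i _; rewrite -(pairBl wK (cm i) (crw i) (cdr i)); apply: eq_kpair => // x.
  by rewrite /rdiff /veldiff; ring.
have alg (a b1 b2 : R) : a - kappa * b1 + kappa / 2 * (2 * b2) = a + kappa * (b2 - b1) by field.
by rewrite sumrB; exact: alg.
Qed.

Lemma relative_energyE t : 0 <= t < T ->
  relative_energy alpha gamma kappa rho rhob u ub t = total_energy t.
Proof.
move=> tT; have cr : continuous (r t) by exact: (xf_cont (xr tT)).
have bc : bmeas (fun x => r t x * tint K (fun y => r t (x - y))).
  by apply: bmeasM; [exact: continuous_bmeas|exact: bmeas_conv].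
rewrite /total_energy -(pair_conv wK cr cr) -(tintZ _ w1 bc).
rewrite -(tintD w1 (continuous_bmeas (continuous_edens tT)) (bmeasZ _ bc)).
by rewrite -torus_integralE.
Qed.

Lemma edens_ge0 t x : 0 <= t < T -> 0 <= edens t x.
Proof.
move=> tT; apply: addr_ge0; last exact: intdens_ge0.
by rewrite mulr_ge0 ?sqr_ge0// mulr_ge0 ?invr_ge0// (fl_ge0 fl).
Qed.

Lemma edens_integral_ge0 t : 0 <= t < T -> 0 <= tint (cst 1) (edens t).
Proof. by move=> tT; apply: tint_ge0 => [y|y _]; [exact: ler01|exact: edens_ge0]. Qed.

Lemma le_intdens_edens t : 0 <= t < T ->
  tint (cst 1) (intdens t) <= tint (cst 1) (edens t).
Proof.
move=> tT; apply: le_tint; [exact: w1|by move=> ?; exact: ler01| | |].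
- exact: continuous_bmeas (continuous_intdens tT).
- exact: continuous_bmeas (continuous_edens tT).
- move=> y _; rewrite lerDr mulr_ge0 ?sqr_ge0// mulr_ge0 ?invr_ge0// (fl_ge0 fl)//.
Qed.

Lemma total_energy_ge (C : R) t : 0 <= t < T -> 0 <= C ->
  torus_L1norm (fun x => (rho t x - rhob t x)
      * riesz_conv alpha (fun z => rho t z - rhob t z) x)
    <= C * torus_integral (intdens t) ->
  (1 - `|kappa| * C / 2) * tint (cst 1) (edens t) <= total_energy t.
Proof.
move=> tT C0; rewrite torus_integralE => hC.
have cr : continuous (r t) by exact: (xf_cont (xr tT)).
have bc : bmeas (fun x => r t x * tint K (fun y => r t (x - y))).
  by apply: bmeasM; [exact: continuous_bmeas|exact: bmeas_conv].
have hk : `|kpair K (r t) (r t)| <= C * tint (cst 1) (edens t).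
  rewrite -(pair_conv wK cr cr); apply: le_trans (ler_norm_tint w1 bc) _.
  rewrite (_ : (fun y => `|cst 1 y|) = cst 1); last by apply/funext => y /=; rewrite normr1.
  apply: le_trans (ler_wpM2l C0 (le_intdens_edens tT)); apply: le_trans hC.
  by rewrite /torus_L1norm torus_integralE.
have h1 : `|kappa / 2 * kpair K (r t) (r t)| <= `|kappa| / 2 * (C * tint (cst 1) (edens t)).
  have e2 : `|kappa / 2| = `|kappa| / 2 by rewrite normrM normfV normr_nat.
  by rewrite normrM e2; apply: ler_pM => //; rewrite -e2.
move: h1; rewrite ler_norml /total_energy => /andP[h1 _].
have -> : (1 - `|kappa| * C / 2) * tint (cst 1) (edens t) =
    tint (cst 1) (edens t) - `|kappa| / 2 * (C * tint (cst 1) (edens t)) by field.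
by rewrite lerD2l.
Qed.

Lemma stress_le (B : R) t x : 0 <= t < T -> (forall i j x, `|ubx i j t x| <= B) ->
  `|stress t x| <= d%:R * B * (gamma + 1) * edens t x.
Proof.
move=> tT hB; have r0 := fl_ge0 fl x tT; have i0 := intdens_ge0 x tT.
have gm0 : 0 <= gamma - 1 by rewrite subr_ge0 ltW.
have [i1|dB0] : (forall i : 'I_d, False) \/ 0 <= d%:R * B.
  case: (posnP d) => [d0|d0]; [left => -[i]; by rewrite d0|right].
  by rewrite mulr_ge0//; apply: le_trans (hB (Ordinal d0) (Ordinal d0) x).
  rewrite /stress big1 ?big1 ?mulr0 ?addr0 ?normr0 => [|i|i]; [|by case: (i1 i)|by case: (i1 i)].
  have -> : d%:R = 0 :> R by case: (posnP d) => [->//|d0]; case: (i1 (Ordinal d0)).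
  by rewrite !mul0r.
have s1 : `|\sum_i \sum_j w i t x * w j t x * ubx i j t x| <= d%:R * B * q t x.
  apply: le_trans (ler_norm_sum _ _ _) _.
  have h i : `|\sum_j w i t x * w j t x * ubx i j t x| <=
      \sum_(j < d) B * ((w i t x * w i t x + w j t x * w j t x) / 2).
    apply: le_trans (ler_norm_sum _ _ _) _; apply: ler_sum => j _.
    rewrite normrM mulrC; apply: ler_pM => //.
    rewrite ler_norml; apply/andP; split.
      have := sqr_ge0 (w i t x + w j t x); rewrite expr2; lra.
    have := sqr_ge0 (w i t x - w j t x); rewrite expr2; lra.
  apply: le_trans (ler_sum _ (fun i _ => h i)) _.
  rewrite le_eqVlt; apply/orP; left; apply/eqP.
  under eq_bigr do rewrite -mulr_sumr -mulr_suml big_split /= sumr_const card_ord.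
  rewrite -mulr_sumr -mulr_suml big_split /= sumr_const card_ord -sumrMnl.
  rewrite -/(sqveldiff t x) -[X in X + _]/(\sum_(i < d) _) sumrMnl -/(sqveldiff t x) -mulr_natl.
  by field.
have s2 : `|\sum_i ubx i i t x| <= d%:R * B.
  apply: le_trans (ler_norm_sum _ _ _) _; apply: le_trans (ler_sum _ (fun i _ => hB i i x)) _.
  by rewrite sumr_const card_ord mulr_natl.
rewrite /stress; apply: le_trans (ler_normD _ _) _; rewrite !normrM (ger0_norm r0) (ger0_norm gm0) (ger0_norm i0).
apply: (@le_trans _ _ (rho t x * (d%:R * B * q t x) + (gamma - 1) * intdens t x * (d%:R * B))).
  by apply: lerD; apply: ler_wpM2l; rewrite ?mulr_ge0.
rewrite /edens enorm_veldiff; set D := d%:R * B in dB0 *.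
have h1 := mulr_ge0 (mulr_ge0 dB0 (mulr_ge0 r0 (sqveldiff_ge0 t x))) gm0.
have h2 := mulr_ge0 dB0 i0.
lra.
Qed.

Lemma mass_bound t : 0 <= t < T ->
  torus_integral (fun x => `|r t x|) <= torus_integral (rho 0) + torus_integral (rhob 0).
Proof.
move=> tT; rewrite -(flow_mass_conservation fl tT) -(flow_mass_conservation flb tT) !torus_integralE.
have b1 := continuous_bmeas (xf_cont (fl_rx fl tT)).
have b2 := continuous_bmeas (xf_cont (fl_rx flb tT)).
rewrite -(tintD w1 b1 b2); apply: le_tint; [exact: w1|by move=> ?; exact: ler01| | |].
- exact: bmeas_norm (bmeasB b1 b2).
- exact: bmeasD b1 b2.
- move=> y _; apply: le_trans (ler_normB _ _) _.
  by rewrite !ger0_norm ?(fl_ge0 fl)// (fl_ge0 flb).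
Qed.

(** The exponent 2 - alpha / d is the one for which the coercivity of the internal energy
    matches the hypothesis of riesz_self_bound. The masses of both densities are conserved,
    so the constant does not depend on time. *)
Lemma total_energy_derivative_bound (B : R) : 2 - alpha / d%:R <= gamma -> 0 <= B ->
  (forall i j t x, 0 < t < T -> `|ubx i j t x| <= B) ->
  exists2 L, 0 <= L & forall t, 0 < t < T ->
    - tint (cst 1) (stress t) + kappa * \sum_i kpair K (fun x => r t x * ub t x ord0 i) (dr i t)
    <= L * tint (cst 1) (edens t).
Proof.
move=> gq B0 hB; have [a0 ad] := andP alpha0d.
have d0 : 0 < d%:R :> R by apply: lt_trans ad.
have q12 : 1 < 2 - alpha / d%:R <= 2.
  have h1 : alpha / d%:R < 1 by rewrite ltr_pdivrMr// mul1r.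
  have h2 : 0 <= alpha / d%:R by rewrite divr_ge0// ltW.
  by apply/andP; split; lra.
have [A A0 hA] := relative_internal_energy_coercive M q12 gq delta0.
pose M' := torus_integral (rho 0) + torus_integral (rhob 0).
pose L2 := d%:R * (d%:R * B / 2) * (2 * (supk_const d alpha + M') * A).
have [T0|T0] := ltP 0 T; last by exists 0 => // t /andP[t0 tT]; move: (lt_trans t0 tT); rewrite ltNge T0.
have M'0 : 0 <= M'.
  have h0 : 0 <= (0 : R) < T by rewrite lexx.
  apply: le_trans (mass_bound h0); rewrite torus_integralE; apply: tint_ge0 => [y|y _].
    exact: ler01.
  exact: normr_ge0.
have L20 : 0 <= L2.
  rewrite /L2; apply: mulr_ge0; first by rewrite !mulr_ge0// ltW.
  apply: mulr_ge0 (ltW A0); apply: mulr_ge0 => //; apply: addr_ge0 => //; exact: supk_const_ge0.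
exists (d%:R * B * (gamma + 1) + `|kappa| * L2).
  by apply: addr_ge0; apply: mulr_ge0 => //; [exact: mulr_ge0|rewrite addr_ge0// ltW].
move=> t tT; have tT' : 0 <= t < T by lra.
have cr : continuous (r t) by exact: (xf_cont (xr tT')).
have bi := continuous_bmeas (continuous_intdens tT').
have be := continuous_bmeas (continuous_edens tT').
have bs := continuous_bmeas (continuous_stress tT').
rewrite mulrDl; apply: lerD.
  have := ler_norm_tint w1 bs; rewrite ler_norml => /andP[h _].
  rewrite lerNl; apply: le_trans h; rewrite lerN2.
  rewrite (_ : (fun y => `|cst 1 y|) = cst 1); last by apply/funext => y /=; rewrite normr1.
  rewrite -(tintZ _ w1 be); apply: le_tint; [exact: w1|by move=> ?; exact: ler01| | |].
  - exact: bmeas_norm.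
  - exact: bmeasZ.
  - by move=> y _; apply: stress_le => // i j x; exact: hB.
apply: le_trans (ler_norm _) _; rewrite normrM -mulrA; apply: ler_wpM2l => //.
have L0 : 0 <= d%:R * B by rewrite mulr_ge0// ltW.
have cub i : continuous (fun x => ub t x ord0 i) by exact: (xf_cont (fl_ux flb i tT')).
have lip i (x y : space) : `|ub t x ord0 i - ub t (x - y) ord0 i| <= d%:R * B * `|y|.
  by apply: (lipschitz_of_gradient B0 (fl_ux flb i tT')) => j z; exact: hB.
have h1 := riesz_stress_bound alpha0d L0 cr (pr tT') (xf_dcont (xr tT')) (xf_der (xr tT'))
  cub (fun i => fl_pu flb i tT') lip.
apply: le_trans h1 _; rewrite /L2 -[leRHS]mulrA; apply: ler_wpM2l; first by rewrite !mulr_ge0// ltW.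
have cnr : continuous (fun x => `|r t x|) by exact: continuous_norm_fun.
have pnr : periodic (fun x => `|r t x|) by move=> i x; rewrite (pr tT').
have bw : bmeas (fun x => A * intdens t x) by exact: bmeasZ.
have h2 := riesz_self_bound alpha0d cnr pnr (fun x => normr_ge0 _) (mass_bound tT') bw
  (fun x => hA _ _ (fl_ge0 fl x tT') (rhob_bounds x tT')).
apply: le_trans h2 _; rewrite -[leRHS]mulrA; apply: ler_wpM2l.
  by rewrite mulr_ge0// addr_ge0// supk_const_ge0.
rewrite torus_integralE (tintZ _ w1 bi); apply: ler_wpM2l; first exact: ltW.
exact: le_intdens_edens.
Qed.

Lemma total_energy_cvg0 : 0 < T -> total_energy s @[s --> 0^'+] --> total_energy 0.
Proof.
move=> T0; apply: cvgD; first exact: (tint_cvg0 w1 (tfield_mfield edens_tfield) T0).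
have tr := tfieldB (fl_rt fl) (fl_rt flb).
apply: cvgM; first exact: cvg_cst.
exact: (tint_cvg0 wK (corr_mfield tr tr) T0).
Qed.

End two_flows.

(** * Conclusion *)

Lemma gronwall (R : realType) (T C : R) (f df : R -> R) : 0 <= C ->
  (forall t : R, 0 < t < T -> is_derive t 1 f (df t)) ->
  (forall t : R, 0 < t < T -> df t <= C * f t) ->
  f s @[s --> 0^'+] --> f 0 -> 0 <= f 0 ->
  forall t : R, 0 <= t < T -> f t <= expR (C * T) * f 0.
Proof.
move=> C0 hf hdf f0 p0 t /andP[t0 tT].
have e1 : 1 <= expR (C * T) by rewrite -expR0 ler_expR mulr_ge0// (le_trans t0)// ltW.
move: t0; rewrite le_eqVlt => /predU1P[<-|t0]; first by rewrite ler_peMl.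
pose g (s : R) : R := expR (- C * s) * f s.
have dg (s : R) : 0 < s < T -> is_derive s 1 g (expR (- C * s) * (df s - C * f s)).
  move=> sT; have h := hf s sT.
  have he : is_derive s 1 (fun s => expR (- C * s)) (- C * expR (- C * s)).
    have h1 : is_derive s 1 (fun s : R => - C * s) (- C).
      have := is_deriveZ (- C) (is_derive_id s (1 : R)).
      by congr is_derive; rewrite /GRing.scale /= mulr1.
    have := is_derive1_comp (f := expR) (is_derive_expR _) h1.
    by congr is_derive; rewrite mulrC.
  apply: is_derive_eq; rewrite /GRing.scale /=; ring.
have gt : g t <= g 0.
  apply: (@ler0_derive1_nincr R g 0 t) => //; last exact: ltW.
  - move=> s /[!in_itv]/= /andP[s0 st]; have sT : 0 < s < T by lra.
    by have [] := dg s sT.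
  - move=> s /[!in_itv]/= /andP[s0 st]; have sT : 0 < s < T by lra.
    rewrite derive1E; have [_ ->] := dg s sT.
    by rewrite mulr_ge0_le0 ?expR_ge0// subr_le0 hdf.
  - apply/(continuous_within_itvP _ t0); split.
    + move=> s /[!in_itv]/= /andP[s0 st]; have sT : 0 < s < T by lra.
      exact: is_derive1_continuous (dg s sT).
    + apply: cvgM => //; apply: cvg_at_right_filter.
      apply: (@continuous_comp _ _ _ (fun s : R => - C * s) expR); last exact: continuous_expR.
      exact: mulrl_continuous.
    + have tT' : 0 < t < T by rewrite t0.
      by apply: cvg_at_left_filter; exact: is_derive1_continuous (dg t tT').
move: gt; rewrite /g mulr0 expR0 mul1r mulNr expRN mulrC ler_pdivrMr ?expR_gt0// => gt.
by apply: le_trans gt _; rewrite mulrC ler_wpM2r// ler_expR ler_wpM2l// ltW.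
Qed.

Theorem mainTheorem4 (R : realType) (d : nat) (alpha gamma T kappa : R)
    (rho rhob : R -> 'rV[R]_d -> R) (u ub : R -> 'rV[R]_d -> 'rV[R]_d)
    (deltab Mb Cstar : R) :
  (1 <= d)%N -> 0 < alpha < d%:R ->
  1 < gamma -> 2 - alpha / d%:R <= gamma -> 0 < T -> kappa != 0 ->
  euler_riesz_solution alpha gamma kappa T rho u ->
  euler_riesz_solution alpha gamma kappa T rhob ub ->
  0 < deltab -> (forall t x, 0 <= t < T -> deltab <= rhob t x <= Mb) ->
  gradient_Linfty T ub ->
  0 < Cstar ->
  (forall t, 0 <= t < T ->
    torus_L1norm (fun x => (rho t x - rhob t x)
      * riesz_conv alpha (fun z => rho t z - rhob t z) x)
    <= Cstar * torus_integral (fun x =>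
         relative_internal_energy gamma (rho t x) (rhob t x))) ->
  0 < `|kappa| < 2 / Cstar ->
  (forall t, 0 <= t < T ->
    0 <= relative_energy alpha gamma kappa rho rhob u ub t) /\
  (exists C : R, 0 < C /\ forall t, 0 <= t < T ->
    relative_energy alpha gamma kappa rho rhob u ub t
    <= expR (C * T) * relative_energy alpha gamma kappa rho rhob u ub 0).
Proof.
move=> _ alpha0d gamma1 gq T0 _ sol solb delta0 rb_bounds grad C0 hC /andP[_ kC].
have [rt [rx [ut [ux fl]]]] := euler_riesz_flow alpha0d gamma1 sol.
have [rbt [rbx [ubt [ubx flb]]]] := euler_riesz_flow alpha0d gamma1 solb.
have [B B0 hB] := gradient_bound (fl_ux flb) (fl_joint flb) (fl_pu flb) grad.
have [L L0 hL] := total_energy_derivative_bound alpha0d gamma1 delta0 fl flb rb_bounds gq B0 hB.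
pose E t := tint (cst 1) (edens gamma rho u rhob ub t).
pose Psi := total_energy alpha gamma kappa rho u rhob ub.
(* the share of the energy that the interaction cannot cancel *)
pose eta := 1 - `|kappa| * Cstar / 2.
have eta0 : 0 < eta.
  by rewrite subr_gt0 ltr_pdivrMr// mul1r -ltr_pdivlMr.
have lowPsi t (tT : 0 <= t < T) : eta * E t <= Psi t.
  exact: (total_energy_ge alpha0d gamma1 delta0 fl flb rb_bounds tT (ltW C0) (hC t tT)).
have E0 t (tT : 0 <= t < T) : 0 <= E t.
  exact: (edens_integral_ge0 gamma1 delta0 ub fl rb_bounds tT).
have Psi0 t (tT : 0 <= t < T) : 0 <= Psi t.
  by apply: le_trans (lowPsi t tT); rewrite mulr_ge0 ?E0// ltW.
have PsiE t (tT : 0 <= t < T) : relative_energy alpha gamma kappa rho rhob u ub t = Psi t.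
  exact: (relative_energyE alpha0d gamma1 delta0 fl flb rb_bounds).
have zT : 0 <= (0 : R) < T by rewrite lexx.
split=> [t tT|]; first by rewrite PsiE// Psi0.
exists (L / eta + 1); split; first by rewrite ltr_wpDl// divr_ge0// ltW.
move=> t tT; rewrite !PsiE//.
apply: (gronwall _ (total_energy_is_derive alpha0d gamma1 delta0 fl flb rb_bounds) _
  (total_energy_cvg0 alpha0d gamma1 delta0 fl flb rb_bounds T0) (Psi0 0 zT)) => //.
  by rewrite addr_ge0// divr_ge0// ltW.
move=> s sT; have sT' : 0 <= s < T by lra.
apply: le_trans (hL s sT) _; rewrite mulrDl mul1r -[leLHS]addr0; apply: lerD; last exact: Psi0.
by rewrite -mulrA; apply: ler_wpM2l => //; rewrite ler_pdivlMl// lowPsi.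
Qed.
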